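(* Let $m\ge2$, $1\le l\le m$, $1<p_1,\dots,p_m<\infty$ and $\frac1p=\frac1{p_1}+\cdots+\frac1{p_m}$ with $0<p\le1$. Let $\vec w=(w_1,\dots,w_m)$ be weights on $\mathbb R^n$, $\nu_{\vec w}=\prod_{s=1}^mw_s^{p/p_s}$, and $\vec b=(b_1,\dots,b_l)\in\mathrm{BMO}^l$. Let $\mathcal T$ be an $m$-linear operator whose iterated commutator $\mathcal T_{\vec b}$ satisfies the sparse domination hypothesis (SD) of the context with constants $C_0,\eta$. Then, with a constant $C$ independent of $\vec w$ and $\vec b$ (depending only on $n,m,l,p_1,\dots,p_m,C_0,\eta$), the following hold for all bounded compactly supported $f_1,\dots,f_m$. (1) If $w_s\in A_\infty$ for all $1\le s\le m$, then $$\|\mathcal T_{\vec b}(\vec f)\|_{L^p(\nu_{\vec w})}\le C\prod_{s=1}^l[w_s]_{A_\infty}\prod_{s=1}^l\|b_s\|_{\mathrm{BMO}}\prod_{s=1}^m\|f_s\|_{L^{p_s}(Mw_s)} .$$ (2) If $w_s\in A_\infty^{\mathrm{weak}}$ for all $1\le s\le m$, then $$\|\mathcal T_{\vec b}(\vec f)\|_{L^p(\nu_{\vec w})}\le C\sum_{\vec\gamma\in\{1,2\}^l}\Big(\prod_{s:\gamma_s=1}[w_s]_{A_\infty}^{\mathrm{weak}}\Big)\prod_{s=1}^l\|b_s\|_{\mathrm{BMO}}\prod_{s=1}^m\|f_s\|_{L^{p_s}(Mw_s)} .$$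
   Context: Cubes have sides parallel to the axes; $2Q$ is the concentric cube of twice the side length. $\langle g\rangle_Q=\frac1{|Q|}\int_Q g$. $\|b\|_{\mathrm{BMO}}=\sup_Q\langle|b-\langle b\rangle_Q|\rangle_Q$. A weight is a nonnegative locally integrable function; $M$ is the Hardy–Littlewood maximal operator over cubes. $A_\infty=\bigcup_{p>1}A_p$ (Muckenhoupt classes), $[w]_{A_\infty}=\sup_Q\frac1{w(Q)}\int_QM(w\chi_Q)$. $w\in A_\infty^{\mathrm{weak}}$ if there are $0<c,\delta<\infty$ with $w(E)\le c(|E|/|Q|)^\delta w(2Q)$ for all cubes $Q$ and measurable $E\subset Q$; $[w]_{A_\infty}^{\mathrm{weak}}=\sup_Q\frac1{w(2Q)}\int_QM(w\chi_Q)$. Iterated commutator. For an $m$-linear operator $\mathcal T$ acting on (suitable) functions on $\mathbb R^n$, and $\vec b=(b_1,\dots,b_l)$, set $[\mathcal T,\vec b]_{e_i}(\vec f)(x)=b_i(x)\mathcal T(f_1,\dots,f_m)(x)-\mathcal T(f_1,\dots,b_if_i,\dots,f_m)(x)$ and $\mathcal T_{\vec b}=[\cdots[[\mathcal T,\vec b]_{e_1},\vec b]_{e_2}\cdots,\vec b]_{e_l}$. Dyadic lattice: a collection $\mathcal D$ of cubes such that (i) if $Q\in\mathcal D$ then all dyadic descendants of $Q$ are in $\mathcal D$; (ii) any two $Q_1,Q_2\in\mathcal D$ have a common ancestor in $\mathcal D$; (iii) every compact set is contained in some $Q\in\mathcal D$. A subfamily $\mathcal S$ of a dyadic lattice is $\eta$-sparse,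 $\eta\in(0,1)$, if $|\bigcup_{P\in\mathcal S,P\subsetneq Q}P|\le(1-\eta)|Q|$ for all $Q\in\mathcal S$. Hypothesis (SD). There are constants $C_0>0$, $\eta\in(0,1)$ such that for all bounded compactly supported $f_1,\dots,f_m$ there are $3^n$ $\eta$-sparse families $\mathcal S_1,\dots,\mathcal S_{3^n}$ (each in a dyadic lattice) with, for a.e. $x\in\mathbb R^n$, $$|\mathcal T_{\vec b}(\vec f)(x)|\le C_0\sum_{j=1}^{3^n}\sum_{\vec\gamma\in\{1,2\}^l}\sum_{Q\in\mathcal S_j}\Big(\prod_{s=1}^l\mathcal U(b_s,f_s,Q,\gamma_s)(x)\Big)\Big(\prod_{s=l+1}^m\langle|f_s|\rangle_Q\Big)\chi_Q(x),$$ where $\mathcal U(b,f,Q,1)(x)=|b(x)-\langle b\rangle_Q|\langle|f|\rangle_Q$ and $\mathcal U(b,f,Q,2)(x)=\langle|(b-\langle b\rangle_Q)f|\rangle_Q$. *)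

(* Defs.v *)
From HB Require Import structures.
From mathcomp Require Import all_boot all_order all_algebra.
From mathcomp Require Import all_classical all_reals all_analysis.

Set Implicit Arguments.
Unset Strict Implicit.
Unset Printing Implicit Defensive.

Import Order.TTheory GRing.Theory Num.Theory.
Import numFieldNormedType.Exports.

Local Open Scope classical_set_scope.
Local Open Scope ring_scope.

Section lebesgue_tuple.
Variable R : realType.
Notation RT := (measurableTypeR R).

Definition cons_pair (n : nat) (z : RT * n.-tuple RT) : n.+1.-tuple RT :=
  [tuple of z.1 :: z.2].

Lemma measurable_cons_pair (n : nat) :
  measurable_fun [set: RT * n.-tuple RT] (@cons_pair n).
Proof. exact: measurable_cons. Qed.

Section step.
Variables (n : nat) (mu : {sigma_finite_measure set (n.-tuple RT) -> \bar R}).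

Definition lebesgue_tuple_step : set (n.+1.-tuple RT) -> \bar R :=
  pushforward (@lebesgue_measure R \x mu)%E (@cons_pair n).

Let m : {measure set (n.+1.-tuple RT) -> \bar R} :=
  measure_function_pushforward__canonical__measure_function_Measure
    (@lebesgue_measure R \x mu)%E (@measurable_cons_pair n).

Let step0 : lebesgue_tuple_step set0 = 0%E.
Proof. exact: (measure0 m). Qed.

Let step_ge0 A : (0 <= lebesgue_tuple_step A)%E.
Proof. exact: (measure_ge0 m). Qed.

Let step_additive : semi_sigma_additive lebesgue_tuple_step.
Proof. exact: (@measure_semi_sigma_additive _ _ _ m). Qed.

HB.instance Definition _ := isMeasure.Build _ _ _ lebesgue_tuple_step
  step0 step_ge0 step_additive.

Let step_sigma_finite : sigma_finite setT lebesgue_tuple_step.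
Proof.
have /sigma_finiteP[F [TF ndF Foo]] := sigma_finiteT (@lebesgue_measure R).
have /sigma_finiteP[G [TG ndG Goo]] := sigma_finiteT mu.
pose g (t : n.+1.-tuple RT) : RT * n.-tuple RT :=
  (tnth t ord0, [tuple of behead t]).
have mg : measurable_fun setT g.
  by apply: measurable_fun_pair;
    [exact: measurable_tnth | exact: measurable_behead].
have gK z : g (cons_pair z) = z.
  by case: z => x t; congr pair => //; exact/val_inj.
exists (fun k => g @^-1` (F k `*` G k)).
  rewrite -preimage_bigcup (_ : \bigcup_k _ = setT) ?preimage_setT//.
  apply/seteqP; split=> // -[x t] _.
  have [i _ Fx] : (\bigcup_k F k) x by rewrite -TF.
  have [j _ Gt] : (\bigcup_k G k) t by rewrite -TG.
  exists (maxn i j) => //; split=> /=.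
    by move: x Fx; exact/subsetPset/ndF/leq_maxl.
  by move: t Gt; exact/subsetPset/ndG/leq_maxr.
move=> k; have [mF Fk] := Foo k; have [mG Gk] := Goo k; split.
  by rewrite -[X in measurable X]setTI; apply: mg => //; exact: measurableX.
rewrite /lebesgue_tuple_step /pushforward -comp_preimage.
rewrite (_ : g \o _ = id); last by apply/funext => z /=; exact: gK.
by rewrite preimage_id product_measure1E// lte_mul_pinfty// ge0_fin_numE.
Qed.

HB.instance Definition _ := Measure_isSigmaFinite.Build _ _ _
  lebesgue_tuple_step step_sigma_finite.

End step.

Fixpoint lebesgue_tuple (n : nat) :
    {sigma_finite_measure set (n.-tuple RT) -> \bar R} :=
  match n with
  | 0 => \d_([tuple] : 0.-tuple RT)
  | n'.+1 => lebesgue_tuple_step (lebesgue_tuple n')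
  end.

End lebesgue_tuple.

Section lebesgue_rV.
Variables (R : realType) (n : nat).

Definition row_of_tuple (t : n.-tuple (measurableTypeR R)) : 'rV[R]_n :=
  \row_i tnth t i.

Definition lebesgue_outer (A : set 'rV[R]_n) : \bar R :=
  ((lebesgue_tuple R n)^*)%mu (row_of_tuple @^-1` A).

Let lebesgue_outer0 : lebesgue_outer set0 = 0%E.
Proof. by rewrite /lebesgue_outer preimage_set0 outer_measure0. Qed.

Let lebesgue_outer_ge0 A : (0 <= lebesgue_outer A)%E.
Proof. exact: outer_measure_ge0. Qed.

Let le_lebesgue_outer :
  {homo lebesgue_outer : A B / A `<=` B >-> (A <= B)%E}.
Proof. by move=> A B AB; apply: le_outer_measure => t; exact: AB. Qed.

Let lebesgue_outer_sigma_subadditive : sigma_subadditive lebesgue_outer.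
Proof.
move=> F; rewrite /lebesgue_outer preimage_bigcup.
exact: outer_measure_sigma_subadditive.
Qed.

HB.instance Definition _ := isOuterMeasure.Build R 'rV[R]_n lebesgue_outer
  lebesgue_outer0 lebesgue_outer_ge0 le_lebesgue_outer
  lebesgue_outer_sigma_subadditive.

(* R^n with the sigma-algebra of Lebesgue (not just Borel) measurable sets. *)
Definition euclid : Type := caratheodory_type lebesgue_outer.
HB.instance Definition _ := Measurable.on euclid.

Definition lebesgue : set euclid -> \bar R := lebesgue_outer.

Let lebesgue0 : lebesgue set0 = 0%E.
Proof. exact: outer_measure0. Qed.

Let lebesgue_ge0 A : (0 <= lebesgue A)%E.
Proof. exact: outer_measure_ge0. Qed.

Let lebesgue_semi_sigma_additive : semi_sigma_additive lebesgue.
Proof. exact: caratheodory_measure_sigma_additive. Qed.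

HB.instance Definition _ := isMeasure.Build _ _ _ lebesgue
  lebesgue0 lebesgue_ge0 lebesgue_semi_sigma_additive.

End lebesgue_rV.

Section cubes.
Variables (R : realType) (n : nat).
Notation Rn := (euclid R n).

(* A cube is given by its lower corner and its side length; cubes are
   half-open, so that the cubes of one generation tile space. *)
Definition cube : Type := ('rV[R]_n * {posnum R})%type.

Definition corner (Q : cube) : 'rV[R]_n := Q.1.
Definition side (Q : cube) : R := Q.2%:num.

Definition cube_set (Q : cube) : set Rn :=
  [set x : 'rV[R]_n | forall i, corner Q 0 i <= x 0 i < corner Q 0 i + side Q].

Definition double (Q : cube) : cube :=
  (\row_i (corner Q 0 i - side Q / 2), (2 * Q.2%:num)%:pos).

Definition dyadic_descendant (Q P : cube) : Prop :=
  exists (k : nat) (v : 'I_n -> 'I_(2 ^ k)),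
    side P = side Q / 2 ^+ k /\
    forall i, corner P 0 i = corner Q 0 i + (v i)%:R * side P.

Definition dyadic_lattice (D : set cube) : Prop :=
  [/\ forall Q P, D Q -> dyadic_descendant Q P -> D P,
      forall Q1 Q2, D Q1 -> D Q2 ->
        exists Q, [/\ D Q, dyadic_descendant Q Q1 & dyadic_descendant Q Q2] &
      forall K : set 'rV[R]_n, compact K ->
        exists2 Q, D Q & K `<=` cube_set Q].

Definition sparse (eta : R) (S : set cube) : Prop :=
  forall Q, S Q ->
    (lebesgue (\bigcup_(P in [set P | S P /\ cube_set P `<` cube_set Q])
                 cube_set P)
     <= (1 - eta)%:E * lebesgue (cube_set Q))%E.

End cubes.

Section weights.
Variables (R : realType) (n : nat).
Notation Rn := (euclid R n).
Notation mu := (@lebesgue R n).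
Local Open Scope ereal_scope.

Definition avg (Q : cube R n) (g : Rn -> \bar R) : \bar R :=
  (\int[mu]_(x in cube_set Q) g x) / mu (cube_set Q).

Definition ravg (Q : cube R n) (b : Rn -> R) : R :=
  fine (avg Q (EFin \o b)).

Definition locally_integrable_rV (f : Rn -> R) : Prop :=
  measurable_fun setT f /\
  forall K : set 'rV[R]_n, compact K ->
    \int[mu]_(x in (K : set Rn)) `|f x|%:E < +oo.

Definition bmo_norm (b : Rn -> R) : \bar R :=
  ereal_sup (range (fun Q => avg Q (fun x => `|b x - ravg Q b|%:E))).

Definition BMO (b : Rn -> R) : Prop :=
  locally_integrable_rV b /\ bmo_norm b < +oo.

Definition weight (w : Rn -> R) : Prop :=
  (forall x, (0 <= w x)%R) /\ locally_integrable_rV w.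

Definition maximal (f : Rn -> R) (x : Rn) : \bar R :=
  ereal_sup [set avg Q (fun y => `|f y|%:E) |
             Q in [set Q | cube_set Q x]].

Definition wmeas (w : Rn -> R) (E : set Rn) : \bar R :=
  \int[mu]_(x in E) (w x)%:E.

(* Extended-real inverses and powers: w x = 0 contributes +oo to the second
   average. *)
Definition muckenhoupt (p : R) (w : Rn -> R) : Prop :=
  ereal_sup (range (fun Q => avg Q (EFin \o w) *
    avg Q (fun x => (w x)%:E^-1 `^ (p - 1)^-1) `^ (p - 1))) < +oo.

Definition A_infty (w : Rn -> R) : Prop :=
  exists2 p : R, (1 < p)%R & muckenhoupt p w.

Definition weak_A_infty (w : Rn -> R) : Prop :=
  exists c delta : R, [/\ (0 < c)%R, (0 < delta)%R &
    forall (Q : cube R n) (E : set Rn), measurable E -> E `<=` cube_set Q ->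
      wmeas w E <=
        c%:E * (mu E / mu (cube_set Q)) `^ delta
             * wmeas w (cube_set (double Q))].

Definition maximal_integral (w : Rn -> R) (Q : cube R n) : \bar R :=
  \int[mu]_(x in cube_set Q) maximal (w \* \1_(cube_set Q))%R x.

(* In both suprema the quotient 0 / 0 counts as 0. *)
Definition A_infty_const (w : Rn -> R) : \bar R :=
  ereal_sup (range (fun Q => maximal_integral w Q / wmeas w (cube_set Q))).

Definition weak_A_infty_const (w : Rn -> R) : \bar R :=
  ereal_sup (range (fun Q =>
    maximal_integral w Q / wmeas w (cube_set (double Q)))).

Definition weighted_norm (p : R) (v : Rn -> \bar R) (f : Rn -> R) : \bar R :=
  (\int[mu]_x ((`|f x| `^ p)%:E * v x)) `^ p^-1.

Definition bounded_compactly_supported (f : Rn -> R) : Prop :=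
  [/\ measurable_fun setT f,
      exists M : R, forall x, (`|f x| <= M)%R &
      exists2 K : set 'rV[R]_n, compact K &
        forall x : Rn, ~ K x -> f x = 0%R].

End weights.

Section operators.
Variables (R : realType) (n m : nat).
Notation Rn := (euclid R n).
Notation mu := (@lebesgue R n).

(* T is total as a function; V s is the space of functions on which its
   s-th slot is meaningful, and nothing is assumed of T outside these. *)
Definition multilinear_operator (V : 'I_m -> set (Rn -> R))
    (T : ('I_m -> Rn -> R) -> Rn -> R) : Prop :=
  [/\ forall s (a : R) f g, V s f -> V s g -> V s (fun x => a * f x + g x),
      forall f, (forall s, V s (f s)) -> measurable_fun setT (T f) &
      forall f s (a : R) g, (forall r, V r (f r)) -> V s g ->
        {ae mu, forall x,
          T (fun r => if r == s then (fun y => a * f r y + g y) else f r) x =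
          a * T f x + T (fun r => if r == s then g else f r) x}].

Variables (l : nat) (llem : (l <= m)%N).

Definition slot (s : 'I_l) : 'I_m := widen_ord llem s.

Definition suitable_domain (V : 'I_m -> set (Rn -> R)) (b : 'I_l -> Rn -> R) :
    Prop :=
  (forall s f, bounded_compactly_supported f -> V s f) /\
  (forall s f, bounded_compactly_supported f -> V (slot s) (b s \* f)).

Definition commutator (b : 'I_l -> Rn -> R)
    (T : ('I_m -> Rn -> R) -> Rn -> R) (i : 'I_l) :
    ('I_m -> Rn -> R) -> Rn -> R :=
  fun f x => b i x * T f x -
             T (fun r => if r == slot i then b i \* f r else f r) x.

Definition iterated_commutator (T : ('I_m -> Rn -> R) -> Rn -> R)
    (b : 'I_l -> Rn -> R) : ('I_m -> Rn -> R) -> Rn -> R :=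
  foldl (commutator b) T (enum 'I_l).

Local Open Scope ereal_scope.

(* gamma = true encodes the value 1, gamma = false the value 2. *)
Definition U (b f : Rn -> R) (Q : cube R n) (gamma : bool) (x : Rn) : \bar R :=
  if gamma then `|b x - ravg Q b|%:E * avg Q (fun y => `|f y|%:E)
  else avg Q (fun y => `|(b y - ravg Q b) * f y|%:E).

Definition sparse_form (b : 'I_l -> Rn -> R) (f : 'I_m -> Rn -> R)
    (S : 'I_(3 ^ n) -> set (cube R n)) (x : Rn) : \bar R :=
  \sum_(j < 3 ^ n) \sum_(gamma : {ffun 'I_l -> bool})
    esum (S j) (fun Q =>
      (\prod_(s < l) U (b s) (f (slot s)) Q (gamma s) x) *
      (\prod_(s < m | (l <= s)%N) avg Q (fun y => `|f s y|%:E)) *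
      (\1_(cube_set Q) x)%:E).

Definition sparse_domination (C0 eta : R)
    (T : ('I_m -> Rn -> R) -> Rn -> R) (b : 'I_l -> Rn -> R) : Prop :=
  forall f : 'I_m -> Rn -> R, (forall s, bounded_compactly_supported (f s)) ->
    exists S : 'I_(3 ^ n) -> set (cube R n),
      (forall j, (exists2 D, dyadic_lattice D & S j `<=` D) /\
                 sparse eta (S j)) /\
      {ae mu, forall x,
        `|iterated_commutator T b f x|%:E <= C0%:E * sparse_form b f S x}.

End operators.

(* Main.v *)
Require Import Defs.
From HB Require Import structures.
From mathcomp Require Import all_boot all_order all_algebra.
From mathcomp Require Import all_classical all_reals all_analysis.
From mathcomp Require Import measurable_realfun.
From mathcomp Require Import ring lra zify.
Import Order.TTheory GRing.Theory Num.Theory.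
Import numFieldNormedType.Exports.
Set Implicit Arguments.
Unset Strict Implicit.
Unset Printing Implicit Defensive.
Local Open Scope classical_set_scope.
Local Open Scope ring_scope.

(* Since p <= 1, the p-th power of the sparse form is at most the sum of the p-th powers of its terms, and
   Hoelder's inequality with exponents p_s / p, applied jointly to the sum over cubes and the integral,
   separates the slots.  It remains to bound, for a finite sparse family F and q = p_s, the three sums over Q in F
     <|f|>_Q^q w(Q),   <|(b - b_Q) f|>_Q^q w(Q),   <|f|>_Q^q int_Q |b - b_Q|^q w
   by the integral of |f|^q Mw.  With N_Q(x) the number of P in F such that x in P and P contained in Q, one
   inserts N_Q^(-2/q) N_Q^(2/q) in the average: the negative power is summable along chains, since
   sum_k k^-2 <= 2, the positive one is absorbed by the moments of N_Q on Q, which a sparse family controls,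
   and w(Q) <= |Q| Mw on Q.
   The moments of b - b_Q, with or without a weight, come from the John-Nirenberg stopping cubes: |b - b_Q| is
   at most a multiple of the number of stopping cubes containing x, and the moments of this number are computed
   by iterating a Carleson packing estimate.  Each iteration costs one doubling of the cube and one factor
   [w]_weak, so neither reverse Hoelder nor the doubling property is needed.
   Part (1) follows from part (2): the strong constant dominates the weak one, and it is at least 1 unless
   w = 0 almost everywhere, in which case Mw = 0. *)

(** * Lebesgue measure of cubes and dyadic approximation *)

Section cube_measure.
Variable R : realType.
Notation RT := (measurableTypeR R).

(** Each weak constant must enter to the first power, although the iteration yields integer moments:
    the [k]-th moment of [b - b_Q] carries [([w] * ||b||) ^ k]. Taking [k] above [q] and [t = [w] *
    ||b||], the inequality [y ^ q <= t ^ q * (1 + (y / t) ^ k)] restores the exponent [q]. The price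
    is a fixed number of doublings of [Q], harmless because [Mw] on [Q] dominates the averages of
    [w] over all dilates of [Q]. Maximal functions are never shown to be measurable. Comparison with
    them rests on monotonicity of the integral of nonnegative functions, while linearity is applied
    to finite sums of measurable terms; hence finite families first, with bounds uniform in the
    family, then a monotone limit. The stopping argument needs [b] to be controlled almost
    everywhere by its averages. In place of Lebesgue differentiation, a set whose density is at most
    some [r < 1] in every dyadic subcube is shown to be null. Estimates are in the extended reals,
    so zero or infinite constants are treated apart wherever a normalisation would divide by
    them. *)

Lemma lebesgue_tuple_cube n (c : 'I_n -> R) (s : R) : 0 <= s ->
  lebesgue_tuple R n [set t | forall i, c i <= tnth t i < c i + s]
  = (s ^+ n)%:E.
Proof.
move=> s0; elim: n c => [|n IH] c.
  rewrite expr0 /= diracE mem_set//=; by case.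
rewrite /= /lebesgue_tuple_step /pushforward.
rewrite (_ : _ @^-1` _ = `[c ord0, c ord0 + s[ `*`
    [set t : n.-tuple RT | forall i, c (lift ord0 i) <= tnth t i < c (lift ord0 i) + s]).
  rewrite product_measure1E//=.
  - rewrite [X in (X * _)%E](_ : _ = s%:E).
      by rewrite IH -EFinM exprS.
    rewrite lebesgue_measure_itv/= lte_fin ltrDl.
    case: ltP => [_|s0']; first by congr EFin; rewrite addrC addKr.
    by congr EFin; apply/eqP; rewrite eq_le s0 s0'.
  - rewrite (_ : [set t | _] = \bigcap_(i in [set: 'I_n]) ((fun t : n.-tuple RT => tnth t i) @^-1`
        `[c (lift ord0 i), c (lift ord0 i) + s[)).
      apply: fin_bigcap_measurable => // i _.
      rewrite -[X in measurable X]setTI.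
      exact: (measurable_tnth i).
    apply/seteqP; split => t /= H i; first by move=> _; rewrite /= in_itv/=.
    by have := H i I; rewrite /= in_itv.
apply/seteqP; split => -[x t] /=.
  move=> H; split.
    by have := H ord0; rewrite /= in_itv/= tnth0.
  move=> i; have := H (lift ord0 i); by rewrite /cons_pair/= tnthS.
rewrite in_itv/= => -[Hx Ht] i.
case: (unliftP ord0 i) => [j ->|->]; first by rewrite tnthS.
by rewrite tnth0.
Qed.

End cube_measure.

Section euclid_measure.
Variables (R : realType) (n : nat).
Notation Rn := (euclid R n).
Notation mu := (@lebesgue R n).

Lemma row_of_tupleK : cancel (fun x : 'rV[R]_n => [tuple x 0 i | i < n]) (@row_of_tuple R n).
Proof. by move=> x; apply/rowP => i; rewrite mxE tnth_mktuple. Qed.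

Lemma tuple_of_rowK : cancel (@row_of_tuple R n) (fun x : 'rV[R]_n => [tuple x 0 i | i < n]).
Proof. by move=> t; apply/eq_from_tnth => i; rewrite tnth_mktuple mxE. Qed.

(** The Carathéodory test of [A] against [X] is, by definition of the outer measure, the test of the
    preimage of [A] against the preimage of [X]. *)
Lemma measurable_euclid (A : set Rn) :
  measurable (@row_of_tuple R n @^-1` A) -> measurable A.
Proof.
move=> mA; move=> X; have := @caratheodory_measurable_mu_ext _ _ _ (lebesgue_tuple R n) _ mA.
by move=> /(_ (@row_of_tuple R n @^-1` X)).
Qed.

Lemma lebesgueE (A : set Rn) : measurable (@row_of_tuple R n @^-1` A) ->
  mu A = lebesgue_tuple R n (@row_of_tuple R n @^-1` A).
Proof. by move=> mA; rewrite /lebesgue /= /lebesgue_outer measurable_mu_extE. Qed.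

Lemma row_of_tuple_cube (Q : cube R n) : @row_of_tuple R n @^-1` (cube_set Q) =
  [set t | forall i, corner Q 0 i <= tnth t i < corner Q 0 i + side Q].
Proof.
by apply/seteqP; split => t H i; have := H i; rewrite /= ?mxE.
Qed.

Lemma measurable_tuple_cube (Q : cube R n) : measurable (@row_of_tuple R n @^-1` cube_set Q).
Proof.
rewrite row_of_tuple_cube.
rewrite (_ : [set t | _] = \bigcap_(i in [set: 'I_n])
  ((fun t : n.-tuple (measurableTypeR R) => tnth t i) @^-1`
        `[corner Q 0 i, corner Q 0 i + side Q[)).
  apply: fin_bigcap_measurable => // i _.
  rewrite -[X in measurable X]setTI.
  exact: (measurable_tnth i).
apply/seteqP; split => t /= H i; first by move=> _; rewrite /= in_itv/=.
by have := H i I; rewrite /= in_itv.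
Qed.

Lemma measurable_cube (Q : cube R n) : measurable (cube_set Q).
Proof. by apply: measurable_euclid; exact: measurable_tuple_cube. Qed.

Lemma side_gt0 (Q : cube R n) : 0 < side Q. Proof. by rewrite /side. Qed.

Lemma lebesgue_cube (Q : cube R n) : mu (cube_set Q) = (side Q ^+ n)%:E.
Proof.
rewrite lebesgueE; last exact: measurable_tuple_cube.
by rewrite row_of_tuple_cube lebesgue_tuple_cube// ltW// side_gt0.
Qed.

Lemma preimage_tuple_of_row (F : set (n.-tuple (measurableTypeR R))) :
  @row_of_tuple R n @^-1` ((fun x : 'rV[R]_n => [tuple x 0 i | i < n]) @^-1` F) = F.
Proof. by apply/seteqP; split => t /=; rewrite tuple_of_rowK. Qed.

(** The outer measure is an infimum over countable covers by measurable sets of tuples; the union of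
    a nearly optimal cover serves as [B]. This passes from Lebesgue measurable sets to Borel
    ones. *)
Lemma lebesgue_outerP (A : set Rn) (e : R) : (0 < e) -> (mu A < +oo)%E ->
  exists B : set Rn, [/\ measurable (@row_of_tuple R n @^-1` B), A `<=` B &
    (mu B <= mu A + e%:E)%E].
Proof.
move=> e0 Aoo.
have Afin : mu A \is a fin_num by rewrite ge0_fin_numE// outer_measure_ge0.
have /lb_ereal_inf_adherent -/(_ _ e0) : mu A \is a fin_num by [].
move=> [_ [F [mF AF] <-]] /ltW lt.
exists (\bigcup_k (fun x => [tuple x 0 i | i < n]) @^-1` (F k)).
have pE : @row_of_tuple R n @^-1` (\bigcup_k (fun x : 'rV[R]_n => [tuple x 0 i | i < n]) @^-1` (F k)) =
    \bigcup_k F k.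
  by rewrite preimage_bigcup; apply: eq_bigcupr => k _; exact: preimage_tuple_of_row.
split.
- by rewrite pE; exact: bigcup_measurable.
- move=> x Ax; have [|k _ Fk] := AF [tuple x 0 i | i < n]; first by rewrite /= row_of_tupleK.
  by exists k.
- apply: le_trans lt; rewrite lebesgueE pE; last exact: bigcup_measurable.
  by apply: measure_sigma_subadditive => //; exact: bigcup_measurable.
Qed.

End euclid_measure.

(** * Dyadic subcubes, addressed by paths of halvings *)

Section cube_geometry.
Variables (R : realType) (n : nat).
Notation Rn := (euclid R n).
Notation mu := (@lebesgue R n).
Implicit Types (P Q : cube R n).

Definition child Q (c : {ffun 'I_n -> bool}) : cube R n :=
  (\row_i (corner Q 0 i + (c i)%:R * (side Q / 2)), (Q.2%:num / 2)%:pos).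

Definition subcube Q (t : seq {ffun 'I_n -> bool}) := foldl child Q t.

Lemma side_child Q c : side (child Q c) = side Q / 2. Proof. by []. Qed.

Lemma corner_child Q c i :
  corner (child Q c) 0 i = corner Q 0 i + (c i)%:R * (side Q / 2).
Proof. by rewrite /corner /= mxE. Qed.

Lemma child_subset Q c : cube_set (child Q c) `<=` cube_set Q.
Proof.
move=> x /= H i; have := H i; rewrite corner_child side_child.
have := side_gt0 Q; case: (c i) => /=; lra.
Qed.

Lemma child_cover Q x : cube_set Q x -> exists c, cube_set (child Q c) x.
Proof.
move=> Qx; exists [ffun i => corner Q 0 i + side Q / 2 <= (x : 'rV[R]_n) 0 i] => i.
rewrite corner_child side_child ffunE; have := Qx i.
case: (lerP (corner Q 0 i + side Q / 2)) => /= *; lra.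
Qed.

Lemma child_inj Q x c c' :
  cube_set (child Q c) x -> cube_set (child Q c') x -> c = c'.
Proof.
move=> Hc Hc'; apply/ffunP => i; move: (Hc i) (Hc' i).
rewrite !corner_child !side_child; have := side_gt0 Q.
by case: (c i); case: (c' i) => //= *; exfalso; lra.
Qed.

Lemma corner_in_cube Q : cube_set Q (corner Q).
Proof. by move=> i; rewrite lexx /= ltrDl side_gt0. Qed.

Lemma lebesgue_child Q c :
  mu (cube_set Q) = ((2 ^+ n)%:E * mu (cube_set (child Q c)))%E.
Proof.
rewrite !lebesgue_cube side_child -EFinM -exprMn; congr ((_ ^+ _)%:E).
by field.
Qed.

Lemma cube_setE Q : cube_set Q = \big[setU/set0]_c cube_set (child Q c).
Proof.
rewrite -bigcup_seq; apply/seteqP; split => x.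
  by move=> /child_cover[c xc]; exists c => //=; rewrite mem_index_enum.
by move=> [c _]; exact: child_subset.
Qed.

Lemma trivIset_child Q (A : set {ffun 'I_n -> bool}) (F : _ -> set Rn) :
  (forall c, F c `<=` cube_set (child Q c)) -> trivIset A F.
Proof.
move=> FQ; apply/trivIsetP => c c' _ _ cc'; rewrite -subset0 => x [Fx Fx'].
by move/eqP: cc'; apply; exact: (child_inj (FQ _ _ Fx) (FQ _ _ Fx')).
Qed.

Lemma subcube_subset Q t : cube_set (subcube Q t) `<=` cube_set Q.
Proof.
elim: t Q => [|c t IH] Q//=; apply: (subset_trans _ (@child_subset Q c)).
exact: IH.
Qed.

Lemma subcube_cover Q k x : cube_set Q x ->
  exists2 t, size t = k & cube_set (subcube Q t) x.
Proof.
elim: k Q => [|k IH] Q Qx; first by exists [::].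
have [c /IH[t tk tx]] := child_cover Qx.
by exists (c :: t) => //=; rewrite tk.
Qed.

Lemma subcube_inj Q x t t' : size t = size t' ->
  cube_set (subcube Q t) x -> cube_set (subcube Q t') x -> t = t'.
Proof.
elim: t t' Q => [|c t IH] [|c' t'] Q //= [st] tx tx'.
have cc' : c = c'.
  by apply: (child_inj (subcube_subset tx)); exact: (subcube_subset tx').
by rewrite -cc' in tx' *; rewrite (IH _ _ st tx tx').
Qed.

Lemma side_subcube Q t : side (subcube Q t) = side Q / 2 ^+ size t.
Proof.
elim: t Q => [|c t IH] Q /=; first by rewrite divr1.
by rewrite IH side_child exprS; field; exact: expf_neq0.
Qed.

Lemma dyadic_descendant_subcube Q t : dyadic_descendant Q (subcube Q t).
Proof.
elim/last_ind: t => [|t c [k [v [sE cE]]]].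
  exists 0%N, (fun=> ord0); split; first by rewrite divr1.
  by move=> i; rewrite mul0r addr0.
rewrite /subcube foldl_rcons -/(subcube Q t).
(* Halving once more appends the bit [c i] to the binary position [v i]. *)
have vP i : (2 * v i + c i < 2 ^ k.+1)%N.
  rewrite expnS; have := ltn_ord (v i); case: (c i) => /= h; last by rewrite addn0 ltn_mul2l.
  by rewrite addn1; apply: (@leq_trans (2 * (v i).+1)); [rewrite mulnSr; lia | rewrite leq_mul2l].
exists k.+1, (fun i => Ordinal (vP i)); split.
  by rewrite side_child sE exprS; field; exact: expf_neq0.
move=> i; rewrite corner_child side_child cE /= natrD natrM.
by field.
Qed.

(** Measured in sides of the smaller cube, both positions are integers. The common point gives two
    strict inequalities between integers, and each of them sharpens by one unit into the inequality
    needed for inclusion. *)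
Lemma descendant_nested Q P P' : dyadic_descendant Q P -> dyadic_descendant Q P' ->
  (exists x, cube_set P x /\ cube_set P' x) ->
  cube_set P `<=` cube_set P' \/ cube_set P' `<=` cube_set P.
Proof.
wlog : P P' / side P' <= side P.
  move=> H dP dP' [x [Px P'x]]; case/orP: (le_total (side P') (side P)) => h.
    by apply: H => //; exists x.
  by apply/or_comm; apply: H => //; exists x.
move=> sPP' [k [v [sE cE]]] [k' [v' [sE' cE']]] [x [Px P'x]]; right.
have Q0 := side_gt0 Q.
have kk' : (k <= k')%N.
  move: sPP'; rewrite sE sE' ler_pM2l// lef_pV2 ?posrE ?exprn_gt0//.
  by rewrite ler_eXn2l// ltr1n.
have [d kE] : exists d, k' = (k + d)%N by exists (k' - k)%N; rewrite subnKC.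
have PE : side P = (2 ^ d)%:R * side P'.
  by rewrite sE sE' kE exprD natrX; field; rewrite !expf_neq0.
have s0 := side_gt0 P'.
move=> y P'y i; have := P'y i; have := Px i; have := P'x i.
rewrite cE cE' PE => /andP[h1 h2] /andP[h3 h4] /andP[h5 h6].
have l1 : (v i * 2 ^ d < v' i + 1)%N.
  rewrite -(ltr_nat R) natrM natrD -(ltr_pM2r s0); lra.
have l2 : (v' i < (v i + 1) * 2 ^ d)%N.
  rewrite -(ltr_nat R) natrM natrD -(ltr_pM2r s0); lra.
have : ((v i)%:R * (2 ^ d)%:R <= (v' i)%:R :> R).
  by rewrite -natrM ler_nat -ltnS -[X in (_ < X)%N]addn1.
have : ((v' i)%:R + 1 <= ((v i)%:R + 1) * (2 ^ d)%:R :> R).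
  by rewrite !natr1 -natrM ler_nat -[X in (_ < X * _)%N]addn1.
move=> /(ler_wpM2r (ltW s0)) g1 /(ler_wpM2r (ltW s0)) g2; apply/andP; split; lra.
Qed.

(** A half-open cube contains its corner as coordinatewise minimum, and its volume determines its
    side. In dimension 0 all cubes are the same point. *)
Lemma cube_set_inj : (0 < n)%N -> injective (@cube_set R n).
Proof.
move=> n0 P Q PQ.
have cE : corner P = corner Q.
  apply/rowP => i; apply/eqP; rewrite eq_le.
  have := corner_in_cube P; rewrite PQ => /(_ i) /andP[-> _].
  by have := corner_in_cube Q; rewrite -PQ => /(_ i) /andP[-> _].
have := lebesgue_cube P; rewrite PQ lebesgue_cube => -[] /eqP.
rewrite eqrXn2// ?ltW ?side_gt0// => /eqP sE.
case: P Q cE sE {PQ} => [p s] [q r]; rewrite /corner /side /= => -> rs.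
by congr pair; apply/val_inj => /=.
Qed.

Lemma subset_side (P Q : cube R n) : (0 < n)%N ->
  cube_set P `<=` cube_set Q -> side P <= side Q.
Proof.
move=> n0 PQ; have : (mu (cube_set P) <= mu (cube_set Q))%E.
  by apply: le_measure => //; rewrite inE; exact: measurable_cube.
by rewrite !lebesgue_cube lee_fin ler_pXn2r// nnegrE ltW// side_gt0.
Qed.

End cube_geometry.

Lemma measure_bigsetU_fin d (T : measurableType d) (R : realType)
    (mu : {measure set T -> \bar R}) (I : finType) (F : I -> set T) :
  (forall i, measurable (F i)) -> trivIset setT F ->
  (mu (\big[setU/set0]_i F i) = \sum_i mu (F i))%E.
Proof.
move=> mF tF; rewrite -bigcup_seq.
rewrite measure_fin_bigcup//; last exact: sub_trivIset tF.
by rewrite -fsbig_seq// index_enum_uniq.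
Qed.

(** * Approximation of measurable sets by finite unions of dyadic subcubes *)

Section dyadic_approximation.
Variables (R : realType) (n : nat).
Notation Rn := (euclid R n).
Notation mu := (@lebesgue R n).
Notation path := (seq {ffun 'I_n -> bool}).
Implicit Types (P Q : cube R n) (T : set path).

Definition grid Q k T : set Rn :=
  [set x | exists t, [/\ size t = k, T t & cube_set (subcube Q t) x]].

Lemma grid_subset Q k T : grid Q k T `<=` cube_set Q.
Proof. by move=> x [t [_ _]]; exact: subcube_subset. Qed.

Lemma grid0 Q T : grid Q 0 T = if `[< T [::] >] then cube_set Q else set0.
Proof.
case: asboolP => T0; apply/seteqP; split => x //=.
- by move=> [t [/size0nil ->]].
- by exists [::].
- by move=> [t [/size0nil ->]].
Qed.

Lemma gridS Q k T : grid Q k.+1 T =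
  \big[setU/set0]_c grid (child Q c) k [set t | T (c :: t)].
Proof.
rewrite -bigcup_seq; apply/seteqP; split => x.
  move=> [[|c t] [//= [tk] Tt xt]]; exists c; first by rewrite /= mem_index_enum.
  by exists t.
by move=> [c _] [t [tk Tt xt]]; exists (c :: t); split => //=; rewrite tk.
Qed.

Lemma measurable_tuple_grid Q k T : measurable (@row_of_tuple R n @^-1` grid Q k T).
Proof.
elim: k Q T => [|k IH] Q T.
  rewrite grid0; case: ifP => _; first exact: measurable_tuple_cube.
  by rewrite preimage_set0.
rewrite gridS -bigcup_seq preimage_bigcup; apply: fin_bigcup_measurable => //.
Qed.

Lemma measurable_grid Q k T : measurable (grid Q k T).
Proof. by apply: measurable_euclid; exact: measurable_tuple_grid. Qed.

Lemma grid_setC Q k T : cube_set Q `\` grid Q k T = grid Q k (~` T).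
Proof.
apply/seteqP; split => x.
  move=> [Qx nx]; have [t tk xt] := subcube_cover k Qx.
  by exists t; split => // Tt; apply: nx; exists t.
move=> [t [tk nT xt]]; split; first exact: (subcube_subset xt).
move=> [t' [tk' Tt' xt']]; apply: nT; rewrite (subcube_inj _ xt xt')//.
by rewrite tk tk'.
Qed.

Lemma grid_refine Q k j T : grid Q k T = grid Q (k + j) [set t | T (take k t)].
Proof.
apply/seteqP; split => x.
  move=> [t [tk Tt xt]]; have [t' tj xt'] := subcube_cover j xt.
  exists (t ++ t'); split; first by rewrite size_cat tk tj.
    by rewrite /= take_size_cat.
  by rewrite /subcube foldl_cat.
move=> [t [tk Tt xt]]; exists (take k t); split => //.
  by rewrite size_take tk; case: ltnP => //; rewrite -[X in (_ <= X)%N]addn0 leq_add2l leqn0 => /eqP ->; rewrite addn0.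
by move: xt; rewrite -{1}(cat_take_drop k t) /subcube foldl_cat; exact: subcube_subset.
Qed.

Lemma grid_setU Q k1 k2 T1 T2 :
  exists k T, grid Q k1 T1 `|` grid Q k2 T2 = grid Q k T.
Proof.
exists (k1 + k2)%N, ([set t | T1 (take k1 t)] `|` [set t | T2 (take k2 t)]).
rewrite (grid_refine Q k1 k2 T1) (grid_refine Q k2 k1 T2) (addnC k2).
apply/seteqP; split => x.
  by case=> -[t [h1 h2 h3]]; exists t; split => //; [left|right].
by case=> t [h1 [] h2 h3]; [left|right]; exists t.
Qed.

(** The two halves of the symmetric difference are kept apart, so that passing to complements merely
    exchanges them. *)
Definition approx Q (E : set Rn) := forall e : R, 0 < e -> exists k T,
  (mu ((cube_set Q `&` E) `\` grid Q k T) <= e%:E)%E /\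
  (mu (grid Q k T `\` E) <= e%:E)%E.

Lemma approxC Q E : approx Q E -> approx Q (~` E).
Proof.
move=> aE e /aE[k [T [h1 h2]]]; exists k, (~` T); rewrite -grid_setC; split.
  apply: le_trans h2; apply: le_outer_measure => x [[Qx nE] h].
  by split => //; apply: contrapT => nx; apply: h; split.
apply: le_trans h1; apply: le_outer_measure => x [[Qx h] nE].
by split => //; split => //; exact: contrapT.
Qed.

Lemma approxU Q E F : approx Q E -> approx Q F -> approx Q (E `|` F).
Proof.
move=> aE aF e e0; have e20 : 0 < e / 2 by rewrite divr_gt0.
have [k1 [T1 [h1 h1']]] := aE _ e20; have [k2 [T2 [h2 h2']]] := aF _ e20.
have [k [T TE]] := grid_setU Q k1 k2 T1 T2.
exists k, T; rewrite -TE (splitr e) EFinD; split.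
  apply: le_trans (leeD h1 h2); apply: le_trans (outer_measureU2 _ _ _).
  apply: le_outer_measure => x [[Qx [Ex|Fx]] h]; [left|right]; split => // gx; apply: h;
   by [left|right].
apply: le_trans (leeD h1' h2'); apply: le_trans (outer_measureU2 _ _ _).
apply: le_outer_measure => x [[gx|gx] h]; [left|right]; split => // Ex; apply: h;
   by [left|right].
Qed.

Lemma approx_grid Q k T : approx Q (grid Q k T).
Proof.
move=> e e0; exists k, T; have e0' : (0 <= e%:E)%E by rewrite lee_fin ltW.
split; apply: le_trans e0'; last by rewrite setDv measure0.
rewrite (_ : _ `\` _ = set0); first by rewrite measure0.
by apply/seteqP; split => // x [[_ ?]].
Qed.

Lemma approx_local Q E F : cube_set Q `&` E = cube_set Q `&` F ->
  approx Q E -> approx Q F.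
Proof.
move=> EF aE e /aE[k [T [h1 h2]]]; exists k, T; rewrite -EF; split => //.
apply: le_trans h2; apply: le_outer_measure => x [gx nF]; split => // Ex.
have : (cube_set Q `&` E) x by split => //; exact: (grid_subset gx).
by rewrite EF => -[].
Qed.

Lemma lebesgue_cube_lty Q : (mu (cube_set Q) < +oo)%E.
Proof. by rewrite lebesgue_cube ltry. Qed.

(** Since [Q] has finite measure, continuity from below makes a finite partial union miss at most
    [e / 2]; the finite union is approximated with the other half. *)
Lemma approx_bigcup Q (E : nat -> set Rn) : (forall i, measurable (E i)) ->
  (forall i, approx Q (E i)) -> approx Q (\bigcup_i E i).
Proof.
move=> mE aE e e0; have e20 : 0 < e / 2 by rewrite divr_gt0.
pose F N := \big[setU/set0]_(i < N) E i.
have aF N : approx Q (F N).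
  elim: N => [|N IH]; rewrite /F; last by rewrite big_ord_recr /=; exact: approxU.
  rewrite big_ord0; apply: (@approx_local _ (grid Q 0 set0)); last exact: approx_grid.
  by rewrite grid0 asboolF.
have mQ := measurable_cube Q.
have mF N : measurable (F N) by exact: bigsetU_measurable.
have cv : mu (cube_set Q `&` F N) @[N --> \oo] --> mu (cube_set Q `&` \bigcup_i E i).
  rewrite (_ : cube_set Q `&` \bigcup_i E i = \bigcup_N (cube_set Q `&` F N)).
    apply: nondecreasing_cvg_mu.
    - by move=> N; exact: measurableI.
    - by apply: bigcup_measurable => N _; exact: measurableI.
    - move=> N M NM; apply/subsetPset => x [Qx Fx]; split => //.
      exact: (subset_bigsetU NM).
  apply/seteqP; split => x.
    move=> [Qx [i _ Ei]]; exists i.+1 => //; split => //.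
    by rewrite /F big_ord_recr /=; right.
  by move=> [N _ [Qx Fx]]; split => //; exact: (bigsetU_bigcup Fx).
have mui A : (mu (cube_set Q `&` A) < +oo)%E.
  by apply: le_lt_trans (lebesgue_cube_lty Q); apply: le_outer_measure; exact: subIsetl.
have fin_mui A : mu (cube_set Q `&` A) \is a fin_num.
  by rewrite ge0_fin_numE// outer_measure_ge0.
have [N FN] : exists N, (mu ((cube_set Q `&` \bigcup_i E i) `\` F N) <= (e / 2)%:E)%E.
  have /fine_cvgP[_ /cvgrPdist_lt /(_ _ e20)[N _ /(_ N (leqnn N))] /= h] : mu (cube_set Q `&` F N) @[N --> \oo] --> (fine (mu (cube_set Q `&` \bigcup_i E i)))%:E.
    by rewrite fineK.
  exists N.
  have mD : measurable (cube_set Q `&` \bigcup_i E i).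
    by apply: measurableI => //; exact: bigcup_measurable.
  rewrite measureD//; last exact: mui.
  rewrite (_ : cube_set Q `&` _ `&` F N = cube_set Q `&` F N); last first.
    rewrite -setIA; congr (_ `&` _); apply/setIidPr.
    exact: bigsetU_bigcup.
  rewrite -[X in (X - _ <= _)%E](fineK (fin_mui (\bigcup_i E i))).
  rewrite -[X in (_ - X <= _)%E](fineK (fin_mui (F N))) -EFinB lee_fin.
  by apply: le_trans (ler_norm _) (ltW h).
have [k [T [h1 h2]]] := aF N _ e20.
exists k, T; split; last first.
  apply: (@le_trans _ _ (e / 2)%:E); last by rewrite lee_fin; lra.
  apply: le_trans h2; apply: le_outer_measure => x [gx nE]; split => // Fx; apply: nE.
  exact: (bigsetU_bigcup Fx).
rewrite (splitr e) EFinD; apply: le_trans (leeD FN h1).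
apply: le_trans (outer_measureU2 _ _ _); apply: le_outer_measure => x [[Qx Ex] ng].
by have [Fx|Fx] := pselect (F N x); [right|left].
Qed.

(** Inside [Q] the half-space is the countable union of the dyadic subcubes that it contains: being
    open in direction [i], it contains every small enough subcube around each of its points. *)
Lemma approx_halfspace Q i (a : R) : approx Q [set x : Rn | (x : 'rV[R]_n) 0 i < a].
Proof.
pose T := [set t | cube_set (subcube Q t) `<=` [set x : Rn | (x : 'rV[R]_n) 0 i < a]].
apply: (@approx_local _ (\bigcup_k grid Q k T)); last first.
  apply: approx_bigcup => k; [exact: measurable_grid|exact: approx_grid].
apply/seteqP; split => x [Qx].
  by move=> [k _ [t [tk Tt xt]]]; split => //; exact: Tt.
move=> xa; split => //.
have [k hk] : exists k, side Q / 2 ^+ k < a - (x : 'rV[R]_n) 0 i.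
  have d0 : 0 < a - (x : 'rV[R]_n) 0 i by rewrite subr_gt0.
  (* This [k] exceeds [side Q / (a - x i)], and [k < 2 ^ k]. *)
  exists (Num.bound (side Q / (a - (x : 'rV[R]_n) 0 i))).
  rewrite ltr_pdivrMr ?exprn_gt0// mulrC -ltr_pdivrMr//.
  apply: (lt_le_trans (archi_boundP _)); first by rewrite divr_ge0 ?ltW// side_gt0.
  by rewrite -natrX ler_nat ltnW// ltn_expl.
have [t tk xt] := subcube_cover k Qx.
exists k => //; exists t; split => // y yt /=.
have := xt i; have := yt i; rewrite side_subcube tk; lra.
Qed.

(** The sets that can be approximated form a sigma-algebra which contains the coordinate
    half-spaces. *)
Lemma approx_measurable Q (E : set Rn) :
  measurable (@row_of_tuple R n @^-1` E) -> approx Q E.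
Proof.
pose toRn (A : set (n.-tuple (measurableTypeR R))) : set Rn :=
  (fun x : 'rV[R]_n => [tuple x 0 i | i < n]) @^-1` A.
have toRnK A : @row_of_tuple R n @^-1` toRn A = A by exact: preimage_tuple_of_row.
pose C := [set A | measurable A /\ approx Q (toRn A)].
have C0 : C set0.
  split => //; apply: (@approx_local _ (grid Q 0 set0)); last exact: approx_grid.
  by rewrite grid0 asboolF.
have CC A : C A -> C (~` A).
  by move=> [mA aA]; split; [exact: measurableC|exact: approxC].
have CU (A : nat -> set (n.-tuple (measurableTypeR R))) : (forall k, C (A k)) -> C (\bigcup_k A k).
  move=> CA; have mA k : measurable (A k) by exact: (CA k).1.
  split; first exact: bigcupT_measurable.
  rewrite /toRn preimage_bigcup; apply: approx_bigcup => k; last exact: (CA k).2.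
  by apply: measurable_euclid; rewrite toRnK; exact: (CA k).1.
have half i (a : R) : C ((fun t => tnth t i) @^-1` `]-oo, a[).
  split; first by rewrite -[X in measurable X]setTI; exact: (measurable_tnth i).
  apply: approx_local (@approx_halfspace Q i a); congr (_ `&` _).
  by apply/seteqP; split => x; rewrite /toRn /= in_itv /= tnth_mktuple.
suff H : (measurable : set (set (n.-tuple (measurableTypeR R)))) `<=` C.
  by move=> /H[_]; rewrite /toRn -comp_preimage => aE;
    apply: approx_local aE; congr (_ `&` _);
    apply/seteqP; split => x /=; rewrite row_of_tupleK.
(* Two generation arguments are nested: the sigma-algebra of tuples is generated by coordinate
   preimages of Borel sets of reals, and these are generated by open rays. *)
apply: smallest_sub; first by split => //; move=> A; rewrite setTD; exact: CC.
move=> A; rewrite -bigcup_seq => -[i _] [B mB <-]; rewrite setTI.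
have {mB} : (@measurable_realfun.RGenInftyO.G R).-sigma.-measurable B by rewrite -measurable_realfun.RGenInftyO.measurableE.
pose D := [set B : set R | C ((fun t => tnth t i) @^-1` B)].
suff: <<s @measurable_realfun.RGenInftyO.G R >> `<=` D by move=> h /h.
apply: smallest_sub; last by move=> _ [a ->]; exact: half.
split.
- by rewrite /D /= preimage_set0.
- by move=> B'; rewrite setTD /D /= preimage_setC; exact: CC.
- by move=> F DF; rewrite /D /= preimage_bigcup; exact: CU.
Qed.

(* A Lebesgue density theorem in disguise: [mu] is determined by the cubes. *)
Lemma null_of_small_density Q (E : set Rn) (r : R) : measurable E -> E `<=` cube_set Q ->
  0 <= r -> r < 1 ->
  (forall t, (mu (E `&` cube_set (subcube Q t)) <= r%:E * mu (cube_set (subcube Q t)))%E) ->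
  mu E = 0%E.
Proof.
move=> mE EQ r0 r1 dens.
(* The density bound on single subcubes adds up to the same bound on every finite union of them. *)
have Egrid k T : (mu (E `&` grid Q k T) <= r%:E * mu (grid Q k T))%E.
  elim: k Q T dens {EQ} => [|k IH] Q' T dens.
    rewrite grid0; case: ifP => _; first exact: (dens [::]).
    by rewrite setI0 measure0 mule0.
  rewrite gridS big_distrr /=.
  have gc c : grid (child Q' c) k [set t | T (c :: t)] `<=` cube_set (child Q' c).
    exact: grid_subset.
  rewrite [X in (X <= _)%E]measure_bigsetU_fin; last 2 first.
  - by move=> c; apply: measurableI => //; exact: measurable_grid.
  - by apply: (@trivIset_child _ _ Q') => c x [_ /gc].
  rewrite [X in (_ <= _ * X)%E]measure_bigsetU_fin; last 2 first.
  - by move=> c; exact: measurable_grid.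
  - exact: trivIset_child gc.
  rewrite (@ge0_sume_distrr R _ (index_enum _) r%:E xpredT
     (fun c => mu (grid (child Q' c) k [set t | T (c :: t)])))//.
  by apply: lee_sum => c _; apply: IH => t; exact: (dens (c :: t)).
have Eoo : (mu E < +oo)%E.
  apply: le_lt_trans (lebesgue_cube_lty Q); exact: le_outer_measure.
(* [E] is only Lebesgue measurable, so the approximation is made for a Borel set [B] containing it,
   with excess at most [e / 2]. *)
have aE : approx Q E.
  move=> e e0; have e20 : 0 < e / 2 by rewrite divr_gt0.
  have [B [mB EB BE]] := lebesgue_outerP e20 Eoo.
  have mB' := measurable_euclid mB.
  have [k [T [h1 h2]]] := approx_measurable Q mB e20.
  exists k, T; split.
    apply: (@le_trans _ _ (e / 2)%:E); last by rewrite lee_fin; lra.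
    apply: le_trans h1; apply: le_outer_measure => x [[Qx Ex] ng]; split => //.
    by split => //; exact: EB.
  rewrite (splitr e) EFinD.
  have h3 : (mu (B `\` E) <= (e / 2)%:E)%E.
    rewrite measureD//; last by apply: (le_lt_trans BE); rewrite lte_add_pinfty// ltry.
    rewrite (setIidr EB) leeBlDr ?ge0_fin_numE ?outer_measure_ge0//.
    by rewrite addeC.
  apply: le_trans (leeD h2 h3); apply: le_trans (outer_measureU2 _ _ _).
  apply: le_outer_measure => x [gx nE].
  by have [Bx|Bx] := pselect (B x); [right|left].
have Efin : mu E \is a fin_num by rewrite ge0_fin_numE// outer_measure_ge0.
apply/eqP; rewrite eq_le outer_measure_ge0 andbT.
rewrite -(fineK Efin) lee_fin; apply/ler_addgt0Pl => e e0; rewrite addr0.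
(* With [d = (1 - r) * e / 2] one gets [|E| <= r * |G| + d <= r * (|E| + d) + d], hence
   [(1 - r) * |E| <= 2 * d = (1 - r) * e]. *)
have d0 : 0 < (1 - r) * e / 2 by rewrite divr_gt0// mulr_gt0// subr_gt0.
have [k [T [h1 h2]]] := aE _ d0.
have h5 := Egrid k T; set G := grid Q k T in h1 h2 h5 *.
have Gle : (mu G <= mu E + ((1 - r) * e / 2)%:E)%E.
  apply: le_trans (leeD (lexx _) h2); apply: le_trans (outer_measureU2 _ _ _).
  by apply: le_outer_measure => x Gx; have [Ex|Ex] := pselect (E x); [left|right].
have Ele : (mu E <= mu (E `&` G) + ((1 - r) * e / 2)%:E)%E.
  apply: le_trans (leeD (lexx _) h1); apply: le_trans (outer_measureU2 _ _ _).
  apply: le_outer_measure => x Ex; have [Gx|Gx] := pselect (G x); [left|right] => //.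
  by split => //; split => //; exact: EQ.
have Gfin : mu G \is a fin_num.
  rewrite ge0_fin_numE ?outer_measure_ge0//; apply: (le_lt_trans Gle).
  by rewrite lte_add_pinfty// ltry.
have EGfin : mu (E `&` G) \is a fin_num.
  rewrite ge0_fin_numE ?outer_measure_ge0//; apply: le_lt_trans Eoo.
  by apply: le_outer_measure; exact: subIsetl.
have [x [g [y [xE gE yE]]]] : exists x g y : R, [/\ mu E = x%:E, mu G = g%:E & mu (E `&` G) = y%:E].
  by exists (fine (mu E)), (fine (mu G)), (fine (mu (E `&` G))); rewrite !fineK.
have := outer_measure_ge0 mu E; have := outer_measure_ge0 mu G.
move: Gle Ele h5; rewrite xE gE yE -!EFinD -!EFinM !lee_fin /= => h1' h2' h3' h4 h5.
rewrite -(ler_pM2l (_ : 0 < 1 - r)); nra.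
Qed.

End dyadic_approximation.

(** * Finite laminar and sparse families *)

Section integral_facts.
Context d (T : measurableType d) (R : realType) (mu : {measure set T -> \bar R}).
Local Open Scope ereal_scope.

(** The integral of a nonnegative function is a supremum over the simple functions below it, so
    monotonicity holds for arbitrary functions. This is how maximal functions are handled under the
    integral sign. *)
Lemma le_integral_ge0 (D E : set T) (f g : T -> \bar R) :
  (forall x, D x -> 0 <= f x) -> (forall x, E x -> 0 <= g x) ->
  (forall x, D x -> E x /\ f x <= g x) ->
  \int[mu]_(x in D) f x <= \int[mu]_(x in E) g x.
Proof.
move=> f0 g0 fg; rewrite !ge0_integralE//; apply: le_ereal_sup => _ [h /= hf <-].
exists h => // x; apply: (le_trans (hf x)).
rewrite !patchE; case: ifPn => [|_].
  rewrite inE => Dx; have [Ex le] := fg _ Dx; by rewrite mem_set.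
by case: ifPn => //; rewrite inE => Ex; exact: g0.
Qed.

Lemma ge0_integral_sum_cond (I : Type) (D : set T) (s : seq I) (P : pred I)
    (f : I -> T -> \bar R) : measurable D ->
  (forall i, measurable_fun D (f i)) -> (forall i x, D x -> 0 <= f i x) ->
  \int[mu]_(x in D) (\sum_(i <- s | P i) f i x) =
  \sum_(i <- s | P i) \int[mu]_(x in D) f i x.
Proof.
move=> mD mf f0; rewrite -[RHS]big_filter -ge0_integral_sum//.
by apply: eq_integral => x _; rewrite big_filter.
Qed.

Lemma integral_indicM (D E : set T) (f : T -> \bar R) : E `<=` D ->
  \int[mu]_(x in D) ((\1_E x)%:E * f x) = \int[mu]_(x in E) f x.
Proof.
move=> ED; rewrite -[in RHS](setIidr ED) integral_mkcondr; apply: eq_integral => x _.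
by rewrite patchE indicE; case: ifPn => _; rewrite ?mul1e ?mul0e.
Qed.

End integral_facts.

(** * Counting along chains of nested cubes *)

Section rank_sum.
Variables (R : realDomainType) (V : zmodType).

(** Once the list is sorted, the rank of an entry is its position; the induction removes the largest
    entry. *)
Lemma rank_sum (s : seq R) (g : nat -> V) : uniq s ->
  \sum_(a <- s) g (count (fun b => b <= a) s) = \sum_(i < size s) g i.+1.
Proof.
move=> us; have ps : perm_eq (sort <=%R s) s by rewrite perm_sort.
rewrite -(size_sort (<=%R) s) -(perm_big _ ps) /=.
under eq_bigr do rewrite -(permP ps).
rewrite /=.
have : sorted <%R (sort <=%R s).
  by rewrite lt_sorted_uniq_le sort_uniq us; apply: sort_sorted; exact: le_total.
elim/last_ind: (sort _ _) => {s us ps} [|s a IH] sa.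
  by rewrite big_nil big_ord0.
rewrite size_rcons big_ord_recr/= -cats1 big_cat big_seq1/= count_cat /= lexx addn0.
have sa' : all (fun b => b < a) s.
  move: sa; rewrite sorted_pairwise; last exact: lt_trans.
  by rewrite pairwise_rcons => /andP[].
rewrite (eq_in_count (a2 := predT)) ?count_predT; last first.
  by move=> b /(allP sa') /ltW ->.
rewrite addn1; congr (_ + _); rewrite -IH.
  rewrite big_seq [RHS]big_seq; apply: eq_bigr => b bs.
  by rewrite count_cat /= leNgt (allP sa' _ bs) /= !addn0.
move: sa; rewrite !sorted_pairwise; try exact: lt_trans.
by rewrite pairwise_rcons => /andP[].
Qed.

End rank_sum.

(** Discrete form of [N ^ (k+1) = (k+1) * int_0^N t ^ k dt]. The inductive step is [(x + 1) ^ (k+1)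
    <= x ^ (k+1) + (k+1) * (x + 1) ^ k], itself proved by induction on [k]. *)
Lemma powS_le_sum (R : realFieldType) (N k : nat) :
  N%:R ^+ k.+1 <= k.+1%:R * \sum_(i < N) i.+1%:R ^+ k :> R.
Proof.
elim: N => [|N IH]; first by rewrite big_ord0 mulr0 expr0n.
rewrite big_ord_recr/= mulrDr; apply: (le_trans _ (lerD IH (lexx _))).
have x0 : 0 <= N%:R :> R by []; rewrite -natr1; move: (N%:R) x0 => x x0.
elim: k {IH} => [|k IH]; first by rewrite !expr1 expr0 mulr1.
have x10 : 0 <= x + 1 by rewrite addr_ge0.
rewrite exprS; apply: (le_trans (ler_wpM2l x10 IH)).
have : x ^+ k.+1 <= (x + 1) ^+ k.+1 by rewrite lerXn2r// ?nnegrE// lerDl.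
rewrite (exprS x k.+1) !(exprS (x + 1)) -(natr1 k.+1); lra.
Qed.

Section laminar_families.
Variables (R : realType) (n : nat).
Hypothesis n_gt0 : (0 < n)%N.
Notation Rn := (euclid R n).
Notation mu := (@lebesgue R n).
Implicit Types (P Q : cube R n) (F : seq (cube R n)) (A : set Rn).

Definition laminar F := forall P Q, P \in F -> Q \in F ->
  (exists x, cube_set P x /\ cube_set Q x) ->
  cube_set P `<=` cube_set Q \/ cube_set Q `<=` cube_set P.

Definition depth F A (x : Rn) : nat :=
  count (fun P => `[< cube_set P `<=` A /\ cube_set P x >]) F.


Lemma subset_eq_side P Q : cube_set P `<=` cube_set Q -> side P = side Q -> P = Q.
Proof.
move=> PQ sPQ; suff cPQ : corner P = corner Q.
  case: P Q cPQ sPQ {PQ} => [p s] [q r]; rewrite /corner /side /= => -> rs.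
  by congr pair; apply/val_inj.
have s0 := side_gt0 Q; apply/rowP => i; apply/eqP.
have /andP[le _] := PQ _ (corner_in_cube P) i.
rewrite eq_le le andbT leNgt; apply/negP => lt.
(* If the corners differ in coordinate [i], then pushing that coordinate of the corner of [P] up to
   the upper face of [Q] stays in [P] and leaves [Q]. *)
pose y : 'rV[R]_n := \row_j if j == i then Num.max (corner P 0 i) (corner Q 0 i + side Q)
                            else corner P 0 j.
have Py : cube_set P y.
  move=> j; rewrite mxE; case: eqP => [->|_]; last by rewrite lexx ltrDl side_gt0.
  by rewrite le_max lexx /= gt_max ltrDl side_gt0 sPQ ltrD2r.
have := PQ _ Py i; rewrite mxE eqxx => /andP[_].
by rewrite gt_max ltxx andbF.
Qed.

(** Two cubes of [F] through [x] are nested, so inclusion between them is comparison of sides;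
    depths become ranks in a list of reals. *)
Lemma depth_nest F A P x : laminar F -> uniq F -> P \in F -> cube_set P `<=` A ->
  cube_set P x -> depth F (cube_set P) x =
  count (fun a => a <= side P) [seq side Q | Q <- F & `[< cube_set Q `<=` A /\ cube_set Q x >]].
Proof.
move=> lF uF PF PA Px; rewrite count_map count_filter; apply: eq_in_count => Q QF /=.
apply/asboolP/andP => [[QP Qx]|[sQP /asboolP[QA Qx]]].
  by split; [exact: subset_side|apply/asboolP; split => //; exact: subset_trans PA].
split=> //; have [//|PQ] : cube_set Q `<=` cube_set P \/ cube_set P `<=` cube_set Q.
  by apply: lF => //; exists x.
rewrite (@subset_eq_side P Q)//; apply/eqP; rewrite eq_le sQP andbT.
exact: subset_side.
Qed.

(** The cubes through [x] have distinct sides, so by [depth_nest] their depths take each of the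
    values 1, 2, ... exactly once. *)
Lemma chain_sum F A x (V : zmodType) (g : nat -> V) : uniq F -> laminar F ->
  \sum_(P <- F | `[< cube_set P `<=` A /\ cube_set P x >]) g (depth F (cube_set P) x) =
  \sum_(i < depth F A x) g i.+1.
Proof.
move=> uF lF; pose p P := `[< cube_set P `<=` A /\ cube_set P x >]; rewrite (eq_bigl p)//.
have side_inj : {in [seq P <- F | p P] &, injective (@side R n)}.
  move=> P Q; rewrite !mem_filter => /andP[/asboolP[_ Px] PF] /andP[/asboolP[_ Qx] QF] sPQ.
  have [PQ|QP] : cube_set P `<=` cube_set Q \/ cube_set Q `<=` cube_set P.
  - by apply: lF => //; exists x.
  - exact: subset_eq_side.
  - by apply/esym; exact: subset_eq_side.
rewrite -big_filter big_seq.
rewrite (eq_bigr (fun P => g (count (fun a => a <= side P) [seq side Q | Q <- F & p Q]))); last first.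
  by move=> P; rewrite mem_filter => /andP[/asboolP[PA Px] PF]; rewrite (@depth_nest F A).
rewrite -big_seq -(big_map (@side R n) xpredT (fun a => g (count (fun b => b <= a) _))).
rewrite rank_sum; last by rewrite map_inj_in_uniq// filter_uniq.
by rewrite size_map size_filter.
Qed.

Lemma depthE F A x : ((depth F A x)%:R : R) =
  \sum_(P <- F | `[< cube_set P `<=` A >]) \1_(cube_set P) x.
Proof.
rewrite /depth; elim: F => [|P F IH] /=; first by rewrite big_nil.
rewrite big_cons natrD IH asbool_and; case: asboolP => [PA|nPA] /=; last by rewrite add0r.
by rewrite indicE; congr ((nat_of_bool _)%:R + _); apply/asboolP/idP; rewrite inE.
Qed.

Lemma measurable_depth F A : measurable_fun [set: Rn] (fun x => (depth F A x)%:R : R).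
Proof.
rewrite (_ : (fun x => _) = (fun x : Rn =>
    \sum_(P <- [seq P <- F | `[< cube_set P `<=` A >]]) \1_(cube_set P) x)); last first.
  by apply/funext => x; rewrite depthE big_filter.
by apply: measurable_sum => P; exact: measurable_indic (measurable_cube P).
Qed.

End laminar_families.

(** * Depth moments and Carleson embedding for sparse families *)

Section sparse_families.
Variables (R : realType) (n : nat).
Hypothesis n_gt0 : (0 < n)%N.
Notation Rn := (euclid R n).
Notation mu := (@lebesgue R n).
Implicit Types (P Q : cube R n) (F : seq (cube R n)) (A : set Rn).
Local Open Scope ereal_scope.

(* Induction on [k]: [N^k] is at most [k] times the sum along the chain of the [(k-1)]-st powers of the
   depths, so each power of the depth costs one application of the packing hypothesis. *)
Lemma depth_moment F (w : Rn -> R) (W : nat -> cube R n -> \bar R) (a : R) :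
  uniq F -> laminar F -> (0 <= a)%R ->
  (forall x, 0 <= w x)%R -> measurable_fun setT w ->
  (forall j P, 0 <= W j P) ->
  (forall P, P \in F -> \int[mu]_(x in cube_set P) (w x)%:E <= W 0%N P) ->
  (forall j P, P \in F ->
    \sum_(Q <- F | `[< cube_set Q `<=` cube_set P >]) W j Q <= a%:E * W j.+1 P) ->
  forall k P, P \in F ->
    \int[mu]_(x in cube_set P) ((depth F (cube_set P) x)%:R ^+ k * w x)%:E <=
    (k`!%:R * a ^+ k)%:E * W k P.
Proof.
move=> uF lF a0 w0 mw W0 wW WS; elim=> [|k IH] P PF.
  rewrite fact0 expr0 mulr1 mul1e; under eq_integral do rewrite expr0 mul1r.
  exact: wW.
have mdw Q j : measurable_fun (cube_set P) (fun x : Rn => ((depth F (cube_set Q) x)%:R ^+ j * w x)%:E).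
  apply/measurable_EFinP; apply: measurable_funTS; apply: (measurable_funM _ mw).
  by apply: measurable_funX; exact: measurable_depth.
pose h Q (x : Rn) := (k.+1%:R%:E * ((\1_(cube_set Q) x)%:E * ((depth F (cube_set Q) x)%:R ^+ k * w x)%:E)).
have h0 Q x : 0 <= h Q x.
  by rewrite /h !mule_ge0 ?lee_fin// mulr_ge0// exprn_ge0.
have mh Q : measurable_fun (cube_set P) (h Q).
  apply: emeasurable_funM; first exact: measurable_cst.
  apply: emeasurable_funM; last exact: mdw.
  apply/measurable_EFinP; apply: measurable_funTS; exact: measurable_indic (measurable_cube Q).
apply: (@le_trans _ _ (\int[mu]_(x in cube_set P)
    \sum_(Q <- F | `[< cube_set Q `<=` cube_set P >]) h Q x)).
  apply: le_integral_ge0.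
  - by move=> x _; rewrite lee_fin mulr_ge0// exprn_ge0.
  - by move=> x _; exact: sume_ge0.
  - move=> x Px; split=> //.
    have -> : \sum_(Q <- F | `[< cube_set Q `<=` cube_set P >]) h Q x =
        (k.+1%:R * (\sum_(Q <- F | `[< cube_set Q `<=` cube_set P /\ cube_set Q x >])
           (depth F (cube_set Q) x)%:R ^+ k) * w x)%:E.
      rewrite big_distrr big_distrl /= -sumEFin.
      rewrite [LHS]big_mkcond [RHS]big_mkcond/=; apply: eq_bigr => Q _.
      rewrite asbool_and; case: ifP => //= QP; rewrite /h indicE.
      have -> : `[< cube_set Q x >] = (x \in cube_set Q) by apply/asboolP/idP; rewrite inE.
      by case: ifP => _; rewrite ?mul1e ?mul0e ?mule0 -?EFinM ?mulrA.
    rewrite (chain_sum n_gt0 _ _ (fun j => (j%:R ^+ k)%R : R))//.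
    by rewrite lee_fin ler_wpM2r// powS_le_sum.
rewrite ge0_integral_sum_cond//; last exact: measurable_cube.
apply: (@le_trans _ _ (\sum_(Q <- F | `[< cube_set Q `<=` cube_set P >])
    (k.+1`!%:R * a ^+ k)%:E * W k Q)).
  rewrite big_seq_cond [leRHS]big_seq_cond; apply: lee_sum => Q /andP[QF /asboolP QP].
  rewrite /h ge0_integralZl; last 4 first.
  - exact: measurable_cube.
  - apply: emeasurable_funM; last exact: mdw.
    apply/measurable_EFinP; apply: measurable_funTS; exact: measurable_indic (measurable_cube Q).
  - by move=> x _; rewrite mule_ge0 ?lee_fin// mulr_ge0// exprn_ge0.
  - by rewrite lee_fin.
  - rewrite integral_indicM// factS natrM -mulrA EFinM -muleA.
    by apply: lee_wpmul2l; [rewrite lee_fin|exact: IH].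
rewrite -ge0_sume_distrr//.
have -> : (k.+1`!%:R * a ^+ k.+1)%:E = (k.+1`!%:R * a ^+ k)%:E * a%:E.
  by rewrite -EFinM exprSr mulrA.
by rewrite -muleA; apply: lee_wpmul2l; [rewrite lee_fin mulr_ge0// exprn_ge0|exact: WS].
Qed.

Definition strictly_below F P : set Rn :=
  \bigcup_(Q in [set Q | Q \in F /\ cube_set Q `<` cube_set P]) cube_set Q.

Definition sparse_seq (eta : R) F := forall P, P \in F ->
  mu (strictly_below F P) <= (1 - eta)%:E * mu (cube_set P).

(** The major subset of a sparse cube, usually written [E_P]; these sets are pairwise disjoint by
    [core_inj]. *)
Definition core F P : set Rn := cube_set P `\` strictly_below F P.

Lemma measurable_below F P : measurable (strictly_below F P).
Proof.
apply: fin_bigcup_measurable => [|Q _]; last exact: measurable_cube.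
apply: (@sub_finite_set _ _ [set` F]); first by move=> Q [].
exact: finite_seq.
Qed.

Lemma measurable_core F P : measurable (core F P).
Proof. by apply: measurableD; [exact: measurable_cube|exact: measurable_below]. Qed.

Lemma core_ge F P (eta : R) : sparse_seq eta F -> P \in F ->
  eta%:E * mu (cube_set P) <= mu (core F P).
Proof.
move=> sF PF; rewrite /core.
have bP : strictly_below F P `<=` cube_set P by apply: bigcup_sub => Q [_ [QP _]].
have fP : mu (cube_set P) \is a fin_num by rewrite lebesgue_cube.
rewrite measureD; [|exact: measurable_cube|exact: measurable_below|]; last first.
  by rewrite -ge0_fin_numE.
rewrite (setIidr bP) leeBrDr; last first.
  rewrite ge0_fin_numE//; apply: le_lt_trans (lebesgue_cube_lty P).
  by apply: le_measure => //; rewrite inE; [exact: measurable_below|exact: measurable_cube].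
apply: (le_trans (leeD (lexx _) (sF _ PF))).
by rewrite [leRHS]lebesgue_cube lebesgue_cube -!EFinM -EFinD lee_fin; lra.
Qed.

Lemma core_inj F P Q x : laminar F -> P \in F -> Q \in F ->
  core F P x -> core F Q x -> P = Q.
Proof.
move=> lF PF QF [Px nP] [Qx nQ].
wlog PQ : P Q PF QF Px nP Qx nQ / cube_set P `<=` cube_set Q.
  move=> H; have [PQ|QP] : cube_set P `<=` cube_set Q \/ cube_set Q `<=` cube_set P.
    by apply: lF => //; exists x.
  - exact: H.
  - by apply/esym; exact: H.
apply: contrapT => nPQ; apply: nQ; exists P => //=; split => //; split => //.
by move=> QP; apply/nPQ/(cube_set_inj n_gt0)/seteqP.
Qed.

(** Sparsity replaces [eta * |P|] by the measure of the core of [P]. The cores are disjoint, so at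
    each point at most one [a P] survives, and it is at most [v] there. *)
Lemma carleson_sum F A (eta : R) (a : cube R n -> R) (v : Rn -> \bar R) :
  uniq F -> laminar F -> sparse_seq eta F -> measurable A ->
  (forall P, 0 <= a P)%R -> (forall x, A x -> 0 <= v x) ->
  (forall P x, P \in F -> cube_set P `<=` A -> cube_set P x -> (a P)%:E <= v x) ->
  \sum_(P <- F | `[< cube_set P `<=` A >]) (eta * a P)%:E * mu (cube_set P) <=
  \int[mu]_(x in A) v x.
Proof.
move=> uF lF sF mA a0 v0 av.
apply: (@le_trans _ _ (\sum_(P <- F | `[< cube_set P `<=` A >]) (a P)%:E * mu (core F P))).
  rewrite big_seq_cond [leRHS]big_seq_cond; apply: lee_sum => P /andP[PF _].
  rewrite mulrC EFinM -muleA; apply: lee_wpmul2l; first by rewrite lee_fin.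
  exact: core_ge.
have mc P : measurable_fun A (fun x : Rn => (a P)%:E * (\1_(core F P) x)%:E).
  apply: emeasurable_funM; first exact: measurable_cst.
  apply/measurable_EFinP; apply: measurable_funTS; exact: measurable_indic (measurable_core F P).
apply: (@le_trans _ _ (\int[mu]_(x in A)
   \sum_(P <- F | `[< cube_set P `<=` A >]) (a P)%:E * (\1_(core F P) x)%:E)).
  rewrite ge0_integral_sum_cond//; last first.
    by move=> P x _; rewrite mule_ge0 ?lee_fin.
  apply: lee_sum => P /asboolP PA.
  rewrite ge0_integralZl; last 4 first.
  - exact: mA.
  - apply/measurable_EFinP; apply: measurable_funTS; exact: measurable_indic (measurable_core F P).
  - by move=> x _; rewrite lee_fin.
  - by rewrite lee_fin.
  rewrite integral_indic//; last exact: measurable_core.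
  by rewrite setIidl// => x [/PA].
apply: le_integral_ge0 => //.
  by move=> x _; apply: sume_ge0 => P _; rewrite mule_ge0 ?lee_fin.
move=> x Ax; split => //.
have [[P [PF PA Px]]|nP] := pselect (exists P, [/\ P \in F, cube_set P `<=` A & core F P x]).
  rewrite -big_filter (bigD1_seq P) ?filter_uniq ?mem_filter ?PF ?andbT//=; last exact/asboolP.
  rewrite big_seq_cond big1 ?adde0; last first.
    move=> Q /andP[]; rewrite mem_filter => /andP[_ QF] QP.
    rewrite indicE memNset ?mule0// => Qx.
    by move/eqP: QP; apply; exact: (core_inj lF QF PF Qx Px).
  rewrite indicE mem_set// mule1; apply: av => //; exact: Px.1.
rewrite big_seq_cond big1; first exact: v0.
move=> P /andP[PF /asboolP PA]; rewrite indicE memNset ?mule0// => Px.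
by apply: nP; exists P.
Qed.

End sparse_families.

(** * The John-Nirenberg inequality by stopping cubes *)

Lemma uniq_flatten_map (S T : eqType) (s : seq S) (f : S -> seq T) : uniq s ->
  (forall a, a \in s -> uniq (f a)) ->
  (forall a b z, a \in s -> b \in s -> z \in f a -> z \in f b -> a = b) ->
  uniq (flatten (map f s)).
Proof.
elim: s => [|a s IH] //= /andP[as_ us] uf dis; rewrite cat_uniq uf ?mem_head//=.
apply/andP; split; last first.
  apply: IH => // [b bs|b c z bs cs]; first by apply: uf; rewrite inE bs orbT.
  by apply: dis; rewrite inE ?bs ?cs orbT.
apply/hasPn => z /flattenP[_ /mapP[b bs ->] zb]; apply/negP => za.
have ab : a = b by apply: (dis a b z); rewrite ?inE ?eqxx ?bs ?orbT.
by move: as_; rewrite ab bs.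
Qed.

Section stopping_tree.
Variables (R : realType) (n : nat).
Hypothesis n_gt0 : (0 < n)%N.
Notation Rn := (euclid R n).
Notation mu := (@lebesgue R n).
Implicit Types (P Q : cube R n) (F : seq (cube R n)) (A : set Rn).
Local Open Scope ereal_scope.

Variables (b : Rn -> R) (c : cube R n -> R) (beta : R).
Hypothesis mb : measurable_fun setT b.
Hypothesis beta_gt0 : (0 < beta)%R.

(** [c P] stands for the average of [b] over [P]; it enters the argument through the bound
    [osc_le]. *)
Definition osc P A := \int[mu]_(x in A) `|b x - c P|%:E.

Hypothesis osc_le : forall Q, osc Q (cube_set Q) <= beta%:E * mu (cube_set Q).

Lemma measurable_osc P A : measurable_fun A (fun x => `|b x - c P|%:E).
Proof.
apply/measurable_EFinP; apply: measurable_funTS; apply: (measurableT_comp (@normr_measurable R setT)).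
by apply: measurable_funB; [exact: mb|exact: measurable_cst].
Qed.

Definition stops P Q := (2 * beta)%:E * mu (cube_set Q) < osc P (cube_set Q).

(* [tree k P S]: the stopping cubes of generation at most [k] strictly inside [S], where
   [P] is the last stopping cube above [S]. *)
Fixpoint tree k P S : seq (cube R n) :=
  if k is k'.+1 then
    flatten [seq (if stops P (child S e) then child S e :: tree k' (child S e) (child S e)
                  else tree k' P (child S e)) | e <- enum {ffun 'I_n -> bool}]
  else [::].

Definition branch k P S e :=
  if stops P (child S e) then child S e :: tree k (child S e) (child S e)
  else tree k P (child S e).

Lemma treeS k P S : tree k.+1 P S = flatten [seq branch k P S e | e <- enum {ffun 'I_n -> bool}].
Proof. by []. Qed.

Lemma mem_treeS k P S T : reflect (exists e, T \in branch k P S e) (T \in tree k.+1 P S).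
Proof.
apply: (iffP flattenP) => [[_ /mapP[e _ ->] h]|[e h]]; first by exists e.
by exists (branch k P S e) => //; apply/mapP; exists e; rewrite // mem_enum.
Qed.

Lemma tree_subcube k P S T : T \in tree k P S ->
  exists e t, T = subcube S (e :: t).
Proof.
elim: k P S => [//|k IH] P S /mem_treeS[e]; rewrite /branch; case: ifP => _.
  rewrite inE => /orP[/eqP ->|]; first by exists e, [::].
  by move=> /IH[e' [t ->]]; exists e, (e' :: t).
by move=> /IH[e' [t ->]]; exists e, (e' :: t).
Qed.

Lemma branch_subcube k P S e T : T \in branch k P S e -> exists t, T = subcube (child S e) t.
Proof.
rewrite /branch; case: ifP => _; first rewrite inE => /orP[/eqP ->|]; first by exists [::].
- by move=> /tree_subcube[e' [t ->]]; exists (e' :: t).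
- by move=> /tree_subcube[e' [t ->]]; exists (e' :: t).
Qed.

Lemma tree_proper k P S T : T \in tree k P S -> (side T < side S)%R.
Proof.
move=> /tree_subcube[e [t ->]]; rewrite side_subcube ltr_pdivrMr ?exprn_gt0//.
rewrite ltr_pMr ?side_gt0//; by rewrite exprn_egt1 ?ltr1n.
Qed.

Lemma tree_subset k P S T : T \in tree k P S -> cube_set T `<=` cube_set S.
Proof. by move=> /tree_subcube[e [t ->]]; exact: subcube_subset. Qed.

Lemma branch_subset k P S e T : T \in branch k P S e -> cube_set T `<=` cube_set (child S e).
Proof. by move=> /branch_subcube[t ->]; exact: subcube_subset. Qed.

Lemma branch_disjoint k P S e e' T T' x : T \in branch k P S e -> T' \in branch k P S e' ->
  cube_set T x -> cube_set T' x -> e = e'.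
Proof.
move=> /branch_subset TS /branch_subset TS' Tx Tx'.
by apply: (@child_inj _ _ S x); [exact: TS|exact: TS'].
Qed.

Lemma tree_uniq k P S : uniq (tree k P S).
Proof.
elim: k P S => [//|k IH] P S; rewrite treeS; apply: uniq_flatten_map.
- exact: enum_uniq.
- move=> e _; rewrite /branch; case: ifP => _ //=; rewrite IH andbT.
  by apply/negP => /tree_proper; rewrite ltxx.
- move=> e e' T _ _ h h'; apply: (branch_disjoint h h' (x := corner T)) => //;
  exact: corner_in_cube.
Qed.

Lemma tree_laminar k Q : laminar (Q :: tree k Q Q).
Proof.
move=> P P' h h'; apply: (@descendant_nested _ _ Q).
  move: h; rewrite inE => /orP[/eqP ->|/tree_subcube[e [t ->]]].
    exact: (dyadic_descendant_subcube Q [::]).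
  exact: dyadic_descendant_subcube.
move: h'; rewrite inE => /orP[/eqP ->|/tree_subcube[e [t ->]]].
  exact: (dyadic_descendant_subcube Q [::]).
exact: dyadic_descendant_subcube.
Qed.

Definition cover (s : seq (cube R n)) : set Rn := \bigcup_(T in [set` s]) cube_set T.

Lemma measurable_cover s : measurable (cover s).
Proof.
apply: fin_bigcup_measurable => [|Q _]; last exact: measurable_cube.
exact: finite_seq.
Qed.

Lemma cover_treeS k P S : cover (tree k.+1 P S) = \big[setU/set0]_e cover (branch k P S e).
Proof.
rewrite -bigcup_seq; apply/seteqP; split => x.
  by move=> [T /= /mem_treeS[e Te] Tx]; exists e; [rewrite /= mem_index_enum|exists T].
by move=> [e _ [T Te Tx]]; exists T => //=; apply/mem_treeS; exists e.
Qed.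

Lemma integral_cube_children S (f : Rn -> \bar R) : measurable_fun setT f ->
  (forall x, 0 <= f x) ->
  \int[mu]_(x in cube_set S) f x = \sum_e \int[mu]_(x in cube_set (child S e)) f x.
Proof.
move=> mf f0; rewrite cube_setE ge0_integral_bigsetU//.
- by move=> e; exact: measurable_cube.
- exact: index_enum_uniq.
- exact: (@trivIset_child _ _ S _ _ (fun e => @subset_refl _ _)).
- by rewrite -cube_setE; exact: (measurable_funTS mf).
Qed.

(** Chebyshev's inequality summed over the maximal stopping cubes: these are disjoint, and all later
    stopping cubes lie inside them. *)
Lemma cover_tree_le k P S :
  (2 * beta)%:E * mu (cover (tree k P S)) <= osc P (cube_set S).
Proof.
elim: k P S => [|k IH] P S.
  rewrite /cover (_ : [set` _] = set0) ?bigcup_set0 ?measure0 ?mule0.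
    by apply: integral_ge0 => x _; rewrite lee_fin.
  by apply/seteqP; split.
rewrite cover_treeS measure_bigsetU_fin; last 2 first.
- by move=> e; exact: measurable_cover.
- apply: (@trivIset_child _ _ S) => e; apply: bigcup_sub => T; exact: branch_subset.
rewrite ge0_sume_distrr//.
rewrite /osc integral_cube_children; last 2 first.
- exact: measurable_osc.
- by move=> x; rewrite lee_fin.
apply: lee_sum => e _; rewrite /branch; case: ifP => [st|_]; last exact: IH.
rewrite (_ : cover _ = cube_set (child S e)); first exact: ltW st.
apply/seteqP; split; last by move=> x Sx; exists (child S e) => //=; rewrite mem_head.
apply: bigcup_sub => T /=; rewrite inE => /orP[/eqP -> //|]; exact: tree_subset.
Qed.

(** The threshold [2 * beta] is twice the mean oscillation bound on [Q], so the stopping cubes fill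
    at most half of [Q]. This is the source of the sparsity constant 1/2. *)
Lemma below_cover k Q : mu (cover (tree k Q Q)) <= (1 - 2^-1)%:E * mu (cube_set Q).
Proof.
have := le_trans (cover_tree_le k Q Q) (osc_le Q).
have -> : (1 - 2^-1 = 2^-1 :> R)%R by lra.
have -> : beta%:E * mu (cube_set Q) = (2 * beta)%:E * ((2^-1)%:E * mu (cube_set Q)).
  by rewrite muleA -EFinM; congr (_%:E * _); field.
by rewrite lee_pmul2l// lte_fin mulr_gt0.
Qed.

(** The cubes strictly inside a stopping cube [T] all belong to the branch of [T], since distinct
    branches are disjoint, and within the subtree rooted at [T] they are bounded by
    [below_cover]. *)
Lemma tree_sparse k P S : sparse_seq 2^-1 (tree k P S).
Proof.
elim: k P S => [//|k IH] P S T /mem_treeS[e Te].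
have below_branch : strictly_below (tree k.+1 P S) T `<=` strictly_below (branch k P S e) T.
  move=> x [T' [/mem_treeS[e' Te'] TT'] Tx']; exists T' => //; split => //.
  by rewrite (branch_disjoint Te Te' (TT'.1 _ Tx') Tx').
have mbelow : mu (strictly_below (tree k.+1 P S) T) <= mu (strictly_below (branch k P S e) T).
  by apply: le_measure => //; rewrite inE; exact: measurable_below.
apply: (le_trans mbelow); move: Te; rewrite /branch; case: ifP => _; last exact: IH.
set S' := child S e; rewrite inE => /orP[/eqP ->|Te].
  apply: le_trans (below_cover k S'); apply: le_measure; rewrite ?inE.
  - exact: measurable_below.
  - exact: measurable_cover.
  - move=> x [T' []]; rewrite inE => /orP[/eqP -> [_ /(_ (@subset_refl _ _))] //|h _ Tx'].
    by exists T'.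
apply: le_trans (IH _ _ _ Te); apply: le_measure; rewrite ?inE; try exact: measurable_below.
move=> x [T' []]; rewrite inE => /orP[/eqP -> [_ h] _|h h' Tx']; last by exists T'.
by exfalso; apply: h; exact: tree_subset Te.
Qed.

Lemma tree_sparse_cons k Q : sparse_seq 2^-1 (Q :: tree k Q Q).
Proof.
move=> T; rewrite inE => /orP[/eqP ->|Te].
  apply: le_trans (below_cover k Q); apply: le_measure; rewrite ?inE.
  - exact: measurable_below.
  - exact: measurable_cover.
  - move=> x [T' []]; rewrite inE => /orP[/eqP -> [_ /(_ (@subset_refl _ _))] //|h _ Tx'].
    by exists T'.
apply: le_trans (tree_sparse Te); apply: le_measure; rewrite ?inE; try exact: measurable_below.
move=> x [T' []]; rewrite inE => /orP[/eqP -> [_ h] _|h h' Tx']; last by exists T'.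
by exfalso; apply: h; exact: tree_subset Te.
Qed.

Lemma tree_cons_uniq k Q : uniq (Q :: tree k Q Q).
Proof.
by rewrite /= tree_uniq andbT; apply/negP => /tree_proper; rewrite ltxx.
Qed.

End stopping_tree.

(** Monotone convergence for the [g k], in a form that tolerates a null exceptional set and an
    arbitrary nonnegative [f]. *)
Lemma integral_le_of_limn d (T : measurableType d) (R : realType)
    (mu : {measure set T -> \bar R}) (D N : set T) (f : T -> \bar R)
    (g : nat -> T -> \bar R) (B : \bar R) :
  measurable D -> measurable N -> mu N = 0%E ->
  (forall x, D x -> 0 <= f x)%E ->
  (forall k, measurable_fun D (g k)) -> (forall k x, D x -> 0 <= g k x)%E ->
  (forall x, D x -> nondecreasing_seq (g ^~ x)) ->
  (forall x, D x -> ~ N x -> f x <= limn (g ^~ x))%E ->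
  (forall k, \int[mu]_(x in D) g k x <= B)%E ->
  (\int[mu]_(x in D) f x <= B)%E.
Proof.
move=> mD mN N0 f0 mg g0 ndg fg gB.
have g_lim x k : D x -> (g k x <= limn (g ^~ x))%E.
  move=> Dx; rewrite (cvg_lim _ (ereal_nondecreasing_cvgn (ndg _ Dx)))//.
  by apply: ereal_sup_ubound; exists k.
have lim0 x : D x -> (0 <= limn (g ^~ x))%E.
  by move=> Dx; exact: le_trans (g0 0%N _ Dx) (g_lim _ _ Dx).
have mlim : measurable_fun D (fun x => limn (g ^~ x)).
  apply: emeasurable_fun_cvg mg _ => x Dx.
  by apply: ereal_nondecreasing_is_cvgn; exact: ndg.
have mind : measurable_fun D (fun x => (\1_N x)%:E : \bar R).
  by apply/measurable_EFinP; apply: measurable_funTS; exact: measurable_indic.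
have mind' : measurable_fun D (fun x => +oo * (\1_N x)%:E : \bar R)%E.
  by apply: emeasurable_funM; [exact: measurable_cst|exact: mind].
(* Adding [+oo] on [N] makes the domination hold everywhere and does not change the integral. *)
apply: (@le_trans _ _ (\int[mu]_(x in D) (limn (g ^~ x) + +oo * (\1_N x)%:E))%E).
  apply: le_integral_ge0.
  - exact: f0.
  - by move=> x Dx; rewrite adde_ge0 ?lim0// mule_ge0// lee_fin.
  move=> x Dx; split=> //; rewrite indicE.
  case: (boolP (x \in N)) => [_|]; last first.
    by rewrite notin_setE mule0 adde0; exact: fg.
  by rewrite mule1 addey ?leey// gt_eqF// (lt_le_trans _ (lim0 _ Dx))// ltNy0.
rewrite ge0_integralD; last 5 first.
- exact: mD.
- exact: lim0.
- exact: mlim.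
- by move=> x Dx; rewrite mule_ge0// lee_fin.
- exact: mind'.
rewrite [X in (_ + X)%E](_ : _ = 0%E); last first.
  rewrite ge0_integralZl//.
  rewrite integral_indic// (_ : mu (N `&` D) = 0%E) ?mule0//.
  by apply/eqP; rewrite -measure_le0 -N0; apply: measureIl.
rewrite adde0 monotone_convergence//.
apply: lime_le; last by apply: nearW => k; exact: gB.
apply: ereal_nondecreasing_is_cvgn => i j ij; apply: le_integral_ge0.
- by move=> x Dx; exact: g0.
- by move=> x Dx; exact: g0.
- by move=> x Dx; split => //; exact: ndg.
Qed.

(** * Pointwise control by the number of stopping cubes, and moments of the oscillation *)

Section john_nirenberg.
Variables (R : realType) (n : nat).
Hypothesis n_gt0 : (0 < n)%N.
Notation Rn := (euclid R n).
Notation mu := (@lebesgue R n).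
Implicit Types (P Q : cube R n) (F : seq (cube R n)) (A : set Rn).
Local Open Scope ereal_scope.

Variables (b : Rn -> R) (c : cube R n -> R) (beta : R).
Hypothesis mb : measurable_fun setT b.
Hypothesis beta_gt0 : (0 < beta)%R.
Hypothesis osc_le : forall Q, osc b c Q (cube_set Q) <= beta%:E * mu (cube_set Q).
Local Notation tree := (tree b c beta).
Local Notation branch := (branch b c beta).
Local Notation osc := (osc b c).

Definition hits k P S (x : Rn) := count (fun T => `[< cube_set T x >]) (tree k P S).

Lemma hitsS k P S x : hits k.+1 P S x =
  (\sum_e count (fun T => `[< cube_set T x >]) (branch k P S e))%N.
Proof. by rewrite /hits treeS count_flatten -map_comp sumnE big_map big_enum. Qed.

Lemma hits_leS k P S x : (hits k P S x <= hits k.+1 P S x)%N.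
Proof.
elim: k P S => [//|k IH] P S; rewrite hitsS [leqRHS]hitsS.
apply: leq_sum => e _; rewrite /branch; case: ifP => _ /=; last exact: IH.
by rewrite leq_add2l; exact: IH.
Qed.

Lemma osc_diff P P' A : measurable A ->
  (`|c P - c P'|)%:E * mu A <= osc P A + osc P' A.
Proof.
move=> mA; rewrite -integral_cst//.
rewrite /osc -ge0_integralD; last 5 first.
- exact: mA.
- by move=> x _; rewrite lee_fin.
- exact: measurable_osc.
- by move=> x _; rewrite lee_fin.
- exact: measurable_osc.
apply: le_integral_ge0.
- by move=> x _; rewrite /= lee_fin.
- by move=> x _; rewrite adde_ge0 ?lee_fin.
- move=> x Ax; split => //; rewrite -EFinD lee_fin.
  by rewrite (distrC (b x) (c P)) /=; exact: ler_distD.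
Qed.

Lemma osc_le2 Q : osc Q (cube_set Q) <= (2 * beta)%:E * mu (cube_set Q).
Proof.
apply: le_trans (osc_le _) _; apply: lee_wpmul2r; first exact: outer_measure_ge0.
by rewrite lee_fin ler_peMl ?ltW// ltr1n.
Qed.

(* The averages at a stopping cube and at the previous one differ by at most [jump * beta]: the parent of
   the stopping cube does not stop, which gives [2 * 2 ^ n], and [osc_le] gives the remaining [1]. *)
Definition jump : R := (1 + 2 * 2 ^+ n)%R.

Lemma jump_ge0 : (0 <= jump)%R.
Proof. by rewrite /jump addr_ge0// mulr_ge0// exprn_ge0. Qed.

Lemma osc_subset P A B : A `<=` B -> osc P A <= osc P B.
Proof. by move=> AB; apply: le_integral_ge0 => // x /AB. Qed.

Lemma stop_jump P S e : osc P (cube_set S) <= (2 * beta)%:E * mu (cube_set S) ->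
  (`|c (child S e) - c P| <= jump * beta)%R.
Proof.
move=> h; set S' := child S e.
have mS' := measurable_cube S'.
have h1 := osc_diff S' P mS'.
have h2 : osc P (cube_set S') <= (2 * beta)%:E * ((2 ^+ n)%:E * mu (cube_set S')).
  rewrite -lebesgue_child; apply: le_trans h; apply: osc_subset; exact: child_subset.
have := le_trans h1 (leeD (osc_le S') h2).
rewrite lebesgue_cube -!EFinM -EFinD lee_fin /jump.
have : (0 < side S' ^+ n)%R by rewrite exprn_gt0// side_gt0.
move: (side S' ^+ n)%R (2 ^+ n)%R => s t s0 h3.
by rewrite -(ler_pM2r s0); lra.
Qed.

(** [T] is the last stopping cube on the path from [S] to [subcube S t]. The assumption on [S] says
    that [S] has not stopped relative to [P]; it is preserved along the path, after a stop by
    [osc_le2], and each stop costs one jump and one hit. *)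
Lemma tree_control k P S t : size t = k ->
  osc P (cube_set S) <= (2 * beta)%:E * mu (cube_set S) ->
  exists T, osc T (cube_set (subcube S t)) <= (2 * beta)%:E * mu (cube_set (subcube S t)) /\
    forall x, cube_set (subcube S t) x -> (`|c T - c P| <= jump * beta * (hits k P S x)%:R)%R.
Proof.
have jb0 : (0 <= jump * beta)%R by exact: mulr_ge0 jump_ge0 (ltW beta_gt0).
elim: k P S t => [|k IH] P S [|e t] //= => [_ h|[tk] h].
  by exists P; split => // x _; rewrite subrr normr0 mulr0.
have hitse x : (count (fun T => `[< cube_set T x >]) (branch k P S e) <= hits k.+1 P S x)%N.
  by rewrite hitsS (bigD1 e)//= leq_addr.
have [st|nst] := boolP (stops b c beta P (child S e)).
  have oS : osc (child S e) (cube_set (child S e)) <= (2 * beta)%:E * mu (cube_set (child S e)).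
    exact: osc_le2.
  have [T [hT1 hT2]] := IH _ _ _ tk oS; exists T; split => // x xt.
  apply: le_trans (ler_distD (c (child S e)) _ _) _.
  apply: le_trans (lerD (hT2 _ xt) (stop_jump e h)) _.
  rewrite -[X in (_ + X <= _)%R]mulr1 -mulrDr ler_wpM2l//.
  apply: (@le_trans _ _ (count (fun T => `[< cube_set T x >]) (branch k P S e))%:R); last first.
    by rewrite ler_nat.
  have -> : count (fun T => `[< cube_set T x >]) (branch k P S e) =
      (hits k (child S e) (child S e) x).+1.
    rewrite /branch st [LHS]/= asboolT ?add1n//; exact: subcube_subset xt.
  by rewrite -natr1.
have oS : osc P (cube_set (child S e)) <= (2 * beta)%:E * mu (cube_set (child S e)).
  by rewrite leNgt.
have [T [hT1 hT2]] := IH _ _ _ tk oS; exists T; split => // x xt.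
apply: (le_trans (hT2 _ xt)); rewrite ler_wpM2l// ler_nat.
by apply: leq_trans (hitse x); rewrite /branch (negbTE nst).
Qed.

Lemma depth_tree k Q x : cube_set Q x ->
  depth (Q :: tree k Q Q) (cube_set Q) x = (hits k Q Q x).+1.
Proof.
move=> Qx; have -> : depth (Q :: tree k Q Q) (cube_set Q) x =
    (`[< cube_set Q `<=` cube_set Q /\ cube_set Q x >] + depth (tree k Q Q) (cube_set Q) x)%N by [].
rewrite asboolT; last by split.
rewrite -[RHS]add1n; congr (_ + _)%N; apply: eq_in_count => T Tt.
by apply/asboolP/asboolP => [[]//|Tx]; split => //; exact: tree_subset Tt.
Qed.

Definition uncovered Q : set Rn := cube_set Q `&`
  \bigcap_k [set x | (jump * beta * (depth (Q :: tree k Q Q) (cube_set Q) x)%:R)%:E < `|b x - c Q|%:E].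

Lemma measurable_uncovered Q : measurable (uncovered Q).
Proof.
apply: measurableI; first exact: measurable_cube.
apply: bigcapT_measurable => k; rewrite -[X in measurable X]setTI.
apply: measurable_lte; [exact: measurableT| |exact: measurable_osc].
apply/measurable_EFinP; apply: measurable_funM; first exact: measurable_cst.
exact: measurable_depth.
Qed.

(** In a subcube of generation [k] whose last stopping cube is [T], the depth exceeds the number of
    hits by one, so [|b - c Q|] beats [|c T - c Q|] by more than [jump * beta >= 3 * beta]. Thus
    [|b - c T| > 3 * beta] on the exceptional set, while the mean of [|b - c T|] over the subcube is
    at most [2 * beta]: by Chebyshev the density is at most 2/3 in every subcube. *)
Lemma lebesgue_uncovered Q : mu (uncovered Q) = 0.
Proof.
apply: (@null_of_small_density _ _ Q _ (2 / 3)%R); try lra.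
- exact: measurable_uncovered.
- by move=> x [].
move=> t; set k := size t; have mt := measurable_cube (subcube Q t).
have oQ : osc Q (cube_set Q) <= (2 * beta)%:E * mu (cube_set Q).
  exact: osc_le2.
have [T [oT cT]] := tree_control (erefl (size t)) oQ.
have mE : measurable (uncovered Q `&` cube_set (subcube Q t)).
  by apply: measurableI => //; exact: measurable_uncovered.
have : (3 * beta)%:E * mu (uncovered Q `&` cube_set (subcube Q t)) <=
    (2 * beta)%:E * mu (cube_set (subcube Q t)).
  apply: le_trans oT; rewrite -integral_cst//; apply: le_integral_ge0 => //.
    by move=> x _; rewrite /= lee_fin mulr_ge0// ltW.
  move=> x [[Qx ux] xt]; split => //.
  have : (jump * beta * (depth (Q :: tree k Q Q) (cube_set Q) x)%:R)%:E < `|b x - c Q|%:E.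
    exact: (ux k Logic.I).
  rewrite depth_tree// lte_fin => lt.
  rewrite lee_fin; have := cT _ xt; rewrite -/k.
  have : (`|b x - c Q| <= `|b x - c T| + `|c T - c Q|)%R by exact: ler_distD.
  have : (3 * beta <= jump * beta)%R.
    apply: (ler_wpM2r (ltW beta_gt0)); rewrite /jump; have : (1 <= 2 ^+ n :> R)%R by rewrite exprn_ege1// ler1n.
    lra.
  by move: lt; rewrite -natr1 mulrDr mulr1; lra.
have b30 : 0 < (3 * beta)%:E by rewrite lte_fin mulr_gt0.
have -> : (2 * beta)%:E * mu (cube_set (subcube Q t)) =
    (3 * beta)%:E * ((2 / 3)%:E * mu (cube_set (subcube Q t))).
  by rewrite muleA -EFinM; congr (_%:E * _); field.
by rewrite lee_pmul2l.
Qed.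

(** [W] is kept abstract so that one proof serves both Lebesgue measure, where [W j P = |P|], and
    weights, where [W j] sees the [j]-th dilate and each packing step moves from [j] to [j.+1]. *)
Lemma john_nirenberg Q (w : Rn -> R) (W : nat -> cube R n -> \bar R) (a : R) :
  (0 <= a)%R -> (forall x, 0 <= w x)%R -> measurable_fun setT w ->
  (forall j P, 0 <= W j P) ->
  (forall P, \int[mu]_(x in cube_set P) (w x)%:E <= W 0%N P) ->
  (forall F, uniq F -> laminar F -> sparse_seq 2^-1 F -> forall j P, P \in F ->
    \sum_(S <- F | `[< cube_set S `<=` cube_set P >]) W j S <= a%:E * W j.+1 P) ->
  forall k, \int[mu]_(x in cube_set Q) (`|b x - c Q| ^+ k * w x)%:E <=
    ((jump * beta) ^+ k * (k`!%:R * a ^+ k))%:E * W k Q.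
Proof.
move=> a0 w0 mw W0 wW WS k.
have jb0 : (0 <= jump * beta)%R by exact: mulr_ge0 jump_ge0 (ltW beta_gt0).
pose F i := Q :: tree i Q Q.
pose g i (x : Rn) := (((jump * beta) ^+ k)%:E *
  ((depth (F i) (cube_set Q) x)%:R ^+ k * w x)%:E).
have mdw i : measurable_fun (cube_set Q) (fun x : Rn => ((depth (F i) (cube_set Q) x)%:R ^+ k * w x)%:E).
  apply/measurable_EFinP; apply: measurable_funTS; apply: (measurable_funM _ mw).
  by apply: measurable_funX; exact: measurable_depth.
have ndg x : cube_set Q x -> nondecreasing_seq (g ^~ x).
  move=> Qx; apply/nondecreasing_seqP => i; rewrite /g -!EFinM lee_fin.
  rewrite ler_wpM2l ?exprn_ge0// ler_wpM2r// lerXn2r ?nnegrE//.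
  by rewrite !depth_tree// ler_nat ltnS hits_leS.
apply: (@integral_le_of_limn _ _ _ mu (cube_set Q) (uncovered Q) _ g).
- exact: measurable_cube.
- exact: measurable_uncovered.
- exact: lebesgue_uncovered.
- by move=> x _; rewrite lee_fin mulr_ge0// exprn_ge0.
- by move=> i; apply: emeasurable_funM; [exact: measurable_cst|exact: mdw].
- by move=> i x _; rewrite mule_ge0// lee_fin ?exprn_ge0// mulr_ge0// exprn_ge0.
- exact: ndg.
- move=> x Qx nux.
  have [i hi] : exists i, (`|b x - c Q| <= jump * beta * (depth (F i) (cube_set Q) x)%:R)%R.
    apply: contrapT => h; apply: nux; split => // i _ /=; rewrite lte_fin ltNge.
    by apply/negP => le; apply: h; exists i.
  apply: (@le_trans _ _ (g i x)); last first.
    rewrite (cvg_lim _ (ereal_nondecreasing_cvgn (ndg _ Qx)))//.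
    by apply: ereal_sup_ubound; exists i.
  rewrite /g -EFinM lee_fin mulrA -exprMn ler_wpM2r// lerXn2r ?nnegrE//.
  by rewrite mulr_ge0.
move=> i; rewrite /g ge0_integralZl; last 4 first.
- exact: measurable_cube.
- exact: mdw.
- by move=> x _; rewrite lee_fin mulr_ge0// exprn_ge0.
- by rewrite lee_fin exprn_ge0.
rewrite [in leRHS]EFinM -muleA; apply: lee_wpmul2l; first by rewrite lee_fin exprn_ge0.
have uF : uniq (F i) by exact: tree_cons_uniq.
have lF : laminar (F i) by exact: tree_laminar.
apply: depth_moment => //; last exact: mem_head.
by apply: WS => //; exact: tree_sparse_cons.
Qed.

End john_nirenberg.

(** * Weights and maximal functions *)

Section weights_on_cubes.
Variables (R : realType) (n : nat).
Hypothesis n_gt0 : (0 < n)%N.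
Notation Rn := (euclid R n).
Notation mu := (@lebesgue R n).
Implicit Types (P Q : cube R n) (F : seq (cube R n)) (A : set Rn).
Local Open Scope ereal_scope.

Lemma avgE Q (g : Rn -> \bar R) :
  avg Q g = (\int[mu]_(x in cube_set Q) g x) * ((side Q ^+ n)^-1)%:E.
Proof.
rewrite /avg lebesgue_cube inver gt_eqF//.
by rewrite exprn_gt0// side_gt0.
Qed.

Lemma avg_ge0 Q (g : Rn -> \bar R) : (forall x, 0 <= g x) -> 0 <= avg Q g.
Proof.
move=> g0; rewrite avgE mule_ge0 ?integral_ge0// lee_fin invr_ge0 exprn_ge0//.
exact/ltW/side_gt0.
Qed.

Lemma avgM Q (g : Rn -> \bar R) :
  avg Q g * mu (cube_set Q) = \int[mu]_(x in cube_set Q) g x.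
Proof.
rewrite avgE lebesgue_cube -muleA -EFinM mulVf ?mule1//.
by rewrite expf_neq0// gt_eqF// side_gt0.
Qed.

Lemma integral_cube_lty (f : Rn -> R) Q : locally_integrable_rV f ->
  \int[mu]_(x in cube_set Q) `|f x|%:E < +oo.
Proof.
move=> [_ fK]; pose K := [set v : 'rV[R]_n | forall i, `[corner Q 0%R i, (corner Q 0%R i + side Q)%R]%classic (v ord0 i)].
have cK : compact K.
  by apply: (@rV_compact _ n (fun i => `[corner Q 0%R i, (corner Q 0%R i + side Q)%R]%classic)) => i;
    exact: segment_compact.
apply: le_lt_trans (fK _ cK); apply: le_integral_ge0 => // x Qx; split => // i.
by rewrite /= in_itv/=; have /andP[-> /ltW] := Qx i.
Qed.

Lemma subset_cube P Q : cube_set P `<=` cube_set Q ->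
  forall i, (corner Q 0%R i <= corner P 0%R i /\ corner P 0%R i + side P <= corner Q 0%R i + side Q)%R.
Proof.
move=> PQ i; have /andP[le _] := PQ _ (corner_in_cube P) i; split => //.
rewrite leNgt; apply/negP => lt.
pose y : 'rV[R]_n := \row_j if j == i then Num.max (corner P 0%R i) (corner Q 0%R i + side Q)%R
                            else corner P 0%R j.
have Py : cube_set P y.
  move=> j; rewrite mxE; case: eqP => [->|_]; last by rewrite lexx ltrDl side_gt0.
  by rewrite le_max lexx /= gt_max ltrDl side_gt0 lt.
have := PQ _ Py i; rewrite mxE eqxx => /andP[_].
by rewrite gt_max ltxx andbF.
Qed.

Lemma side_double Q : side (Defs.double Q) = (2 * side Q)%R. Proof. by []. Qed.

Lemma corner_double Q i : corner (Defs.double Q) 0%R i = (corner Q 0%R i - side Q / 2)%R.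
Proof. by rewrite /corner mxE. Qed.

Lemma subset_double Q : cube_set Q `<=` cube_set (Defs.double Q).
Proof.
move=> x Qx i; have := Qx i; rewrite corner_double side_double.
have := side_gt0 Q; lra.
Qed.

Lemma double_mono P Q : cube_set P `<=` cube_set Q ->
  cube_set (Defs.double P) `<=` cube_set (Defs.double Q).
Proof.
move=> PQ x dPx i; have := dPx i; rewrite !corner_double !side_double.
have [] := subset_cube PQ i; have := subset_side n_gt0 PQ; lra.
Qed.

Definition dilate j Q := iter j (@Defs.double R n) Q.

Lemma subset_dilate j Q : cube_set Q `<=` cube_set (dilate j Q).
Proof. by elim: j => [//|j IH] /=; apply: subset_trans IH _; exact: subset_double. Qed.

Lemma dilate_mono j P Q : cube_set P `<=` cube_set Q ->
  cube_set (dilate j P) `<=` cube_set (dilate j Q).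
Proof. by move=> PQ; elim: j => [//|j IH] /=; exact: double_mono. Qed.

Lemma lebesgue_dilate j Q :
  mu (cube_set (dilate j Q)) = (2 ^+ (j * n))%:E * mu (cube_set Q).
Proof.
rewrite !lebesgue_cube -EFinM exprM -exprMn; congr ((_ ^+ _)%:E).
elim: j => [|j IH]; first by rewrite expr0 mul1r.
by rewrite /= side_double IH exprS mulrA.
Qed.

Section one_weight.
Variable w : Rn -> R.
Hypothesis ww : weight w.

Lemma weight_ge0 x : (0 <= w x)%R. Proof. exact: ww.1. Qed.

Lemma measurable_weight : measurable_fun setT w. Proof. exact: ww.2.1. Qed.

Lemma wmeas_ge0 A : 0 <= wmeas w A.
Proof. by apply: integral_ge0 => x _; rewrite lee_fin weight_ge0. Qed.

Lemma wmeas_lty Q : wmeas w (cube_set Q) < +oo.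
Proof.
apply: le_lt_trans (integral_cube_lty Q ww.2); apply: le_integral_ge0 => //.
- by move=> x _; rewrite lee_fin weight_ge0.
- by move=> x Qx; split => //; rewrite lee_fin ler_norm.
Qed.

Lemma wmeas_fin Q : wmeas w (cube_set Q) \is a fin_num.
Proof. by rewrite ge0_fin_numE ?wmeas_ge0// wmeas_lty. Qed.

Lemma wmeas_le A B : A `<=` B -> wmeas w A <= wmeas w B.
Proof.
move=> AB; apply: le_integral_ge0 => [x _|x _|x Ax].
- by rewrite lee_fin weight_ge0.
- by rewrite lee_fin weight_ge0.
- by split => //; exact: AB.
Qed.

Lemma avg_wmeas Q : avg Q (fun y => `|w y|%:E) = wmeas w (cube_set Q) * ((side Q ^+ n)^-1)%:E.
Proof.
by rewrite avgE; congr (_ * _); apply: eq_integral => x _; rewrite ger0_norm ?weight_ge0.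
Qed.

Lemma avg_le_maximal (f : Rn -> R) Q x : cube_set Q x ->
  avg Q (fun y => `|f y|%:E) <= maximal f x.
Proof. by move=> Qx; apply: ereal_sup_ubound; exists Q. Qed.

Definition unit_cube (x : 'rV[R]_n) : cube R n := (x, (1%:pos)%R).

Lemma maximal_ge0 (f : Rn -> R) x : 0 <= maximal f x.
Proof.
apply: le_trans (avg_le_maximal f (corner_in_cube (unit_cube x) : cube_set (unit_cube x) x)).
by apply: avg_ge0 => y; rewrite lee_fin.
Qed.

Lemma maximal_integral_ge0 Q : 0 <= maximal_integral w Q.
Proof. by apply: integral_ge0 => x _; exact: maximal_ge0. Qed.

Lemma le_mul_of_div (x y : \bar R) (a : R) : 0 <= x -> 0 <= y -> y \is a fin_num ->
  x / y <= a%:E -> x <= a%:E * y.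
Proof.
(* If [y = 0], its inverse is [+oo], and a finite bound on the quotient forces [x = 0]. *)
move=> x0; case: y => [y|//|//] y0 _; rewrite inver; case: eqP => [->|/eqP yn0].
  move: x0; rewrite le_eqVlt => /predU1P[<-|x0]; first by rewrite mule0.
  by rewrite gt0_muley// leye_eq.
by rewrite lee_pdivrMr// lt_neqAle eq_sym yn0 -lee_fin.
Qed.

Lemma maximal_integral_le (alpha : R) Q : weak_A_infty_const w <= alpha%:E ->
  maximal_integral w Q <= alpha%:E * wmeas w (cube_set (Defs.double Q)).
Proof.
move=> wa; apply: le_mul_of_div; [exact: maximal_integral_ge0|exact: wmeas_ge0|exact: wmeas_fin|].
by apply: le_trans wa; apply: ereal_sup_ubound; exists Q.
Qed.

Lemma avg_dilate_le_maximal j P Q x : cube_set P `<=` cube_set Q -> cube_set P x ->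
  wmeas w (cube_set (dilate j P)) * ((side (dilate j P) ^+ n)^-1)%:E <=
  maximal (w \* \1_(cube_set (dilate j Q)))%R x.
Proof.
move=> PQ Px; have Px' : cube_set (dilate j P) x by exact: subset_dilate.
apply: le_trans (avg_le_maximal _ Px'); rewrite -avg_wmeas /avg.
apply: lee_wpmul2r; first by rewrite inve_ge0.
apply: le_integral_ge0 => // y dPy; split => //=.
by rewrite indicE mem_set ?mulr1//; exact: (dilate_mono PQ).
Qed.

(** The average of [w] over [dilate j P] is at most the maximal function of [w] truncated to
    [dilate j Q], everywhere on [P]. The Carleson embedding and the weak constant of [dilate j Q]
    give the bound, with one more doubling; [2 ^ (j * n)] is the volume ratio of [dilate j P] to
    [P]. *)
Lemma carleson_dilate F (eta alpha : R) j Q : uniq F -> laminar F -> sparse_seq eta F ->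
  (0 < eta)%R -> weak_A_infty_const w <= alpha%:E ->
  \sum_(P <- F | `[< cube_set P `<=` cube_set Q >]) wmeas w (cube_set (dilate j P)) <=
  (eta^-1 * 2 ^+ (j * n) * alpha)%:E * wmeas w (cube_set (dilate j.+1 Q)).
Proof.
move=> uF lF sF eta0 wa.
pose a P := fine (wmeas w (cube_set (dilate j P)) * ((side (dilate j P) ^+ n)^-1)%:E).
have aE P : (a P)%:E = wmeas w (cube_set (dilate j P)) * ((side (dilate j P) ^+ n)^-1)%:E.
  by rewrite fineK// fin_numM// wmeas_fin.
have := @carleson_sum _ _ n_gt0 F (cube_set Q) eta a
  (maximal (w \* \1_(cube_set (dilate j Q)))%R) uF lF sF (measurable_cube Q).
have a0 P : (0 <= a P)%R.
  by rewrite -lee_fin aE mule_ge0 ?wmeas_ge0// lee_fin invr_ge0 exprn_ge0// ltW// side_gt0.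
move=> /(_ a0 (fun x _ => maximal_ge0 _ x)) h.
have {h} h : \sum_(P <- F | `[< cube_set P `<=` cube_set Q >]) (eta * a P)%:E * mu (cube_set P) <=
     \int[mu]_(x in cube_set Q) maximal (w \* \1_(cube_set (dilate j Q)))%R x.
  by apply: h => P x PF PQ Px; rewrite aE; exact: avg_dilate_le_maximal.
have h2 : \int[mu]_(x in cube_set Q) maximal (w \* \1_(cube_set (dilate j Q)))%R x <=
    alpha%:E * wmeas w (cube_set (dilate j.+1 Q)).
  apply: le_trans (maximal_integral_le (dilate j Q) wa); apply: le_integral_ge0.
  - by move=> x _; exact: maximal_ge0.
  - by move=> x _; exact: maximal_ge0.
  - by move=> x Qx; split => //; exact: subset_dilate.
have -> : \sum_(P <- F | `[< cube_set P `<=` cube_set Q >]) wmeas w (cube_set (dilate j P)) =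
    (eta^-1 * 2 ^+ (j * n))%:E *
    \sum_(P <- F | `[< cube_set P `<=` cube_set Q >]) (eta * a P)%:E * mu (cube_set P).
  rewrite ge0_sume_distrr; last first.
    by move=> P _; rewrite mule_ge0// lee_fin mulr_ge0// ltW.
  apply: eq_bigr => P _.
  have -> : wmeas w (cube_set (dilate j P)) = (a P)%:E * mu (cube_set (dilate j P)).
    rewrite aE lebesgue_cube -muleA -EFinM mulVf ?mule1//.
    by rewrite expf_neq0// gt_eqF// side_gt0.
  rewrite lebesgue_dilate lebesgue_cube -!EFinM; congr (_%:E); field.
  by rewrite gt_eqF.
rewrite [in leRHS]EFinM -muleA; apply: lee_wpmul2l; last exact: le_trans h h2.
by rewrite lee_fin mulr_ge0 ?exprn_ge0// invr_ge0 ltW.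
Qed.

(* The constant [2 ^ (j * n)] of [carleson_dilate] depends on [j]; weighting the [j]-th dilate by [theta j]
   makes the packing constant uniform, as [john_nirenberg] requires. *)
Definition theta j : R := (\prod_(i < j) 2 ^+ (i * n))%R.

Lemma theta_gt0 j : (0 < theta j)%R.
Proof. by apply: prodr_gt0 => i _; rewrite exprn_gt0. Qed.

Definition jnC k : R := (jump R n ^+ k * (k`!%:R * 2 ^+ k) * theta k)%R.

Lemma jnC_ge0 k : (0 <= jnC k)%R.
Proof.
by have t0 := ltW (theta_gt0 k); rewrite /jnC !mulr_ge0 ?exprn_ge0 ?jump_ge0.
Qed.

Variables (b : Rn -> R) (c : cube R n -> R) (beta : R).
Hypothesis mb : measurable_fun setT b.
Hypothesis beta_gt0 : (0 < beta)%R.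
Hypothesis osc_le : forall Q, osc b c Q (cube_set Q) <= beta%:E * mu (cube_set Q).

Lemma john_nirenberg_weight k Q (alpha : R) :
  (0 <= alpha)%R -> weak_A_infty_const w <= alpha%:E ->
  \int[mu]_(x in cube_set Q) (`|b x - c Q| ^+ k * w x)%:E <=
  (jnC k * (beta * alpha) ^+ k)%:E * wmeas w (cube_set (dilate k Q)).
Proof.
move=> alpha0 wa.
have := @john_nirenberg _ _ n_gt0 b c beta mb beta_gt0 osc_le Q w
  (fun j P => (theta j)%:E * wmeas w (cube_set (dilate j P))) (2 * alpha)%R.
move=> H; have {}H := H _ weight_ge0 measurable_weight.
apply: le_trans (H _ _ _ _ k) _.
- by rewrite mulr_ge0.
- by move=> j P; rewrite mule_ge0 ?wmeas_ge0// lee_fin ltW// theta_gt0.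
- by move=> P; rewrite /theta big_ord0 mul1e.
- move=> F uF lF sF j P PF; rewrite -ge0_sume_distrr; last by move=> *; exact: wmeas_ge0.
  have h := carleson_dilate j P uF lF sF _ wa.
  (* [theta j.+1 = theta j * 2 ^ (j * n)] absorbs the loss of [carleson_dilate]; the factor 2 is the
     inverse of the sparsity constant of the stopping tree. *)
  have e : (2 * alpha)%:E * ((theta j.+1)%:E * wmeas w (cube_set (dilate j.+1 P))) =
     (theta j)%:E * ((2^-1^-1 * 2 ^+ (j * n) * alpha)%:E * wmeas w (cube_set (dilate j.+1 P))).
    rewrite /theta big_ord_recr /= !muleA -!EFinM invrK; congr (_%:E * _); ring.
  rewrite e; apply: lee_wpmul2l; last by apply: h.
  by rewrite lee_fin ltW// theta_gt0.
rewrite muleA -EFinM; apply: lee_wpmul2r; first exact: wmeas_ge0.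
by rewrite lee_fin /jnC !exprMn; lra.
Qed.

End one_weight.

Section no_weight.
Variables (b : Rn -> R) (c : cube R n -> R) (beta : R).
Hypothesis mb : measurable_fun setT b.
Hypothesis beta_gt0 : (0 < beta)%R.
Hypothesis osc_le : forall Q, osc b c Q (cube_set Q) <= beta%:E * mu (cube_set Q).

Lemma carleson_cubes F (eta : R) Q : uniq F -> laminar F -> sparse_seq eta F -> (0 < eta)%R ->
  \sum_(P <- F | `[< cube_set P `<=` cube_set Q >]) mu (cube_set P) <= (eta^-1)%:E * mu (cube_set Q).
Proof.
move=> uF lF sF eta0.
have := @carleson_sum _ _ n_gt0 F (cube_set Q) eta (fun=> 1%R) (cst 1)
  uF lF sF (measurable_cube Q) (fun _ => ler01) (fun _ _ => lee01) (fun _ _ _ _ _ => lexx _).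
rewrite integral_cst ?mul1e; last exact: measurable_cube.
move=> h; have -> : \sum_(P <- F | `[< cube_set P `<=` cube_set Q >]) mu (cube_set P) =
   (eta^-1)%:E * \sum_(P <- F | `[< cube_set P `<=` cube_set Q >]) (eta * 1)%:E * mu (cube_set P).
  rewrite ge0_sume_distrr; last by move=> P _; rewrite mule_ge0// lee_fin mulr1 ltW.
  apply: eq_bigr => P _; rewrite muleA -EFinM mulr1 mulVf ?mul1e//.
  by rewrite gt_eqF.
by apply: lee_wpmul2l => //; rewrite lee_fin invr_ge0 ltW.
Qed.

Lemma john_nirenberg_cube k Q :
  \int[mu]_(x in cube_set Q) (`|b x - c Q| ^+ k)%:E <=
  ((jump R n * beta) ^+ k * (k`!%:R * 2 ^+ k))%:E * mu (cube_set Q).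
Proof.
have := @john_nirenberg _ _ n_gt0 b c beta mb beta_gt0 osc_le Q (fun=> 1%R)
  (fun _ P => mu (cube_set P)) 2%R.
move=> H; apply: le_trans (H _ _ _ _ _ _ k).
- under [leRHS]eq_integral do rewrite mulr1.
  exact: lexx.
- by [].
- by [].
- exact: measurable_cst.
- by move=> j P; exact: outer_measure_ge0.
- by move=> P; rewrite -[leRHS]mul1e integral_cst//; exact: measurable_cube.
- move=> F uF lF sF j P PF; have := carleson_cubes P uF lF sF.
  by rewrite invrK; apply.
Qed.

End no_weight.
End weights_on_cubes.

(** * Hoelder and Schur estimates for sparse families *)

(** Weighted arithmetic-geometric mean inequality: after division by the weighted mean [S] it
    follows from [ln y <= y - 1], summed with weights [th i]. *)
Lemma prod_powR_le_sum (R : realType) (I : finType) (a th : I -> R) :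
  (forall i, 0 <= a i) -> (forall i, 0 < th i) -> \sum_i th i = 1 ->
  \prod_i a i `^ th i <= \sum_i th i * a i.
Proof.
move=> a0 th0 th1.
have ta0 i : 0 <= th i * a i by rewrite mulr_ge0// ltW.
have [[i ai0]|an0] := pselect (exists i, a i = 0).
  by rewrite (bigD1 i)//= ai0 powR0 ?mul0r ?gt_eqF// sumr_ge0.
have {}a0 i : 0 < a i.
  by rewrite lt_neqAle a0 andbT eq_sym; apply/eqP => ai0; apply: an0; exists i.
have [i0 _|I0] := pickP I; last first.
  by exfalso; move: th1; rewrite big_pred0// => /esym/eqP; rewrite oner_eq0.
set S := \sum_i th i * a i.
have S0 : 0 < S.
  by rewrite /S (bigD1 i0)//= ltr_pwDl// ?mulr_gt0// sumr_ge0.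
have -> : \prod_i a i `^ th i = S * \prod_i (a i / S) `^ th i.
  under [in RHS]eq_bigr do rewrite powRM ?ltW ?invr_gt0//.
  rewrite big_split/= mulrCA -[LHS]mulr1; congr (_ * _).
  have -> : \prod_i S^-1 `^ th i = S^-1.
    under eq_bigr do rewrite -powR_inv1 ?ltW// -powRrM.
    under eq_bigr do rewrite /powR (gt_eqF S0).
    rewrite -expR_sum -mulr_suml -mulr_sumr th1 mulr1 mulN1r expRN lnK//.
  by rewrite divff// gt_eqF.
apply: ler_piMr; first exact: ltW.
have -> : \prod_i (a i / S) `^ th i = expR (\sum_i th i * ln (a i / S)).
  by rewrite expR_sum; apply: eq_bigr => i _; rewrite /powR gt_eqF// divr_gt0.
rewrite -[leRHS]expR0 ler_expR.
apply: (@le_trans _ _ (\sum_i th i * (a i / S - 1))).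
  apply: ler_sum => i _; apply: ler_wpM2l; first exact: ltW.
  have := @le_ln1Dx R (a i / S - 1); rewrite [1 + _]addrC subrK; apply.
  by rewrite ltrBrDl subrr divr_gt0.
under eq_bigr do rewrite mulrBr mulr1 mulrA.
by rewrite sumrB -mulr_suml th1 divff ?subrr// gt_eqF.
Qed.

Section hoelder_family.
Context d (T : measurableType d) (R : realType) (mu : {measure set T -> \bar R}).
Variables (I : finType) (J : eqType) (X : seq J) (D : J -> set T) (th : I -> R).
Hypothesis mD : forall j, measurable (D j).
Hypothesis th_gt0 : forall i, 0 < th i.
Hypothesis th1 : \sum_i th i = 1.
Local Open Scope ereal_scope.

(** Since [f] vanishes wherever [g] does, [f <= +oo * g] pointwise, and the right side has integral
    [+oo * 0 = 0]. *)
Lemma integral_eq0_dominated (E : set T) (f g : T -> \bar R) : measurable E ->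
  measurable_fun E g -> (forall x, E x -> 0 <= f x) -> (forall x, E x -> 0 <= g x) ->
  (forall x, E x -> g x = 0 -> f x = 0) ->
  \int[mu]_(x in E) g x = 0 -> \int[mu]_(x in E) f x = 0.
Proof.
move=> mE mg f0 g0 gf ig; apply/eqP; rewrite eq_le integral_ge0// andbT.
have <- : \int[mu]_(x in E) (+oo * g x) = 0 by rewrite ge0_integralZl// ig mule0.
apply: le_integral_ge0 => // x Ex; first by rewrite mule_ge0// g0.
split=> //; have := g0 _ Ex; rewrite le_eqVlt => /predU1P[gx|gx].
  by rewrite gf// -?gx ?mule0.
by rewrite gt0_mulye// leey.
Qed.

Lemma prode_eqy (F : I -> \bar R) i : (forall j, 0 < F j) -> F i = +oo ->
  \prod_j F j = +oo.
Proof.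
move=> F0 Fi; rewrite (bigD1 i)//= Fi gt0_mulye//.
by elim/big_ind : _ => // x y; exact: mule_gt0.
Qed.

Lemma prode_eq0 (F : I -> \bar R) i : F i = 0 -> \prod_j F j = 0.
Proof. by move=> Fi; rewrite (bigD1 i)//= Fi mul0e. Qed.

(** Hoelder's inequality for the product of counting measure on [X] with [mu]. If a factor on the
    right is 0 then the left side vanishes; if none is 0 and one is infinite, the right side is
    infinite. *)
Lemma hoelder_family (G : I -> J -> T -> R) :
  (forall i j x, (0 <= G i j x)%R) -> (forall i j, measurable_fun (D j) (G i j)) ->
  \sum_(j <- X) \int[mu]_(x in D j) (\prod_i G i j x `^ th i)%:E <=
  \prod_i (\sum_(j <- X) \int[mu]_(x in D j) (G i j x)%:E) `^ th i.
Proof.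
move=> G0 mG; pose A i := \sum_(j <- X) \int[mu]_(x in D j) (G i j x)%:E.
have iG0 i j : 0 <= \int[mu]_(x in D j) (G i j x)%:E.
  by apply: integral_ge0 => x _; rewrite lee_fin.
have A0 i : 0 <= A i by apply: sume_ge0 => j _; exact: iG0.
have prod0 j x : 0 <= (\prod_i G i j x `^ th i)%:E.
  by rewrite lee_fin prodr_ge0// => i _; exact: powR_ge0.
have mGE i j : measurable_fun (D j) (EFin \o G i j) by exact/measurable_EFinP.
have [[i Ai0]|An0] := pselect (exists i, A i = 0).
  rewrite (@prode_eq0 _ i); last by rewrite -/(A i) Ai0 poweR0r// gt_eqF.
  rewrite big_seq big1// => j jX.
  apply: (@integral_eq0_dominated _ _ (EFin \o G i j)) => //.
  - by move=> x _; rewrite /= lee_fin.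
  - by move=> x _ /= [Gx]; rewrite (bigD1 i)//= Gx powR0 ?mul0r// gt_eqF.
  - apply/eqP; rewrite eq_le; apply/andP; split; last exact: iG0.
    apply: (@le_trans _ _ (A i)); last by rewrite Ai0.
    rewrite /A (big_rem j)//= leeDl//.
    by apply: sume_ge0 => k _; exact: iG0.
have {}A0 i : 0 < A i.
  by rewrite lt_neqAle A0 andbT eq_sym; apply/eqP => Ai0; apply: An0; exists i.
have [[i Aiy]|Any] := pselect (exists i, A i = +oo).
  rewrite (@prode_eqy _ i) ?leey//; last by rewrite -/(A i) Aiy poweRyr// gt_eqF.
  by move=> k; apply: poweR_gt0; exact: A0.
have [r rE] : {r : I -> R | forall i, A i = (r i)%:E}.
  exists (fun i => fine (A i)) => i; rewrite fineK// ge0_fin_numE ?ltW//.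
  by rewrite ltey; apply/eqP => Aiy; apply: Any; exists i.
have r0 i : (0 < r i)%R by rewrite -lte_fin -rE.
have r0' i := ltW (r0 i).
pose c := (\prod_i r i `^ th i)%R.
have c0 : (0 <= c)%R by apply: prodr_ge0 => i _; exact: powR_ge0.
have -> : \prod_i A i `^ th i = c%:E.
  by rewrite -prodEFin; apply: eq_bigr => i _; rewrite rE poweR_EFin.
(* The mean inequality is applied to [G i j x / r i]; after integration slot [i] contributes
   [c * th i], and the [th i] add up to 1. *)
apply: (@le_trans _ _ (\sum_(j <- X) \int[mu]_(x in D j)
    \sum_i (c * (th i / r i))%:E * (G i j x)%:E)).
  apply: lee_sum => j _; apply: le_integral_ge0.
  - by move=> x _; exact: prod0.
  - move=> x _; apply: sume_ge0 => i _; rewrite mule_ge0 ?lee_fin//.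
    by rewrite mulr_ge0// divr_ge0 ?ltW.
  - move=> x Dx; split=> //.
    rewrite [leRHS](_ : _ = (c * \sum_i th i * (G i j x / r i))%:E)%R; last first.
      rewrite mulr_sumr -sumEFin; apply: eq_bigr => i _; rewrite -EFinM; congr EFin.
      by rewrite -!mulrA; congr (_ * (_ * _))%R; exact: mulrC.
    have -> : (\prod_i G i j x `^ th i = c * \prod_i (G i j x / r i) `^ th i)%R.
      rewrite /c -big_split/=; apply: eq_bigr => i _.
      by rewrite -powRM ?divr_ge0// mulrC divfK// gt_eqF.
    rewrite lee_fin ler_wpM2l//.
    by apply: prod_powR_le_sum => // i; rewrite divr_ge0.
have cr0 i : 0 <= (c * (th i / r i))%:E.
  by rewrite lee_fin mulr_ge0// divr_ge0 ?ltW.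
have -> : \sum_(j <- X) \int[mu]_(x in D j) (\sum_i (c * (th i / r i))%:E * (G i j x)%:E) =
    \sum_i (c * (th i / r i))%:E * A i.
  rewrite (eq_bigr (fun j => \sum_i (c * (th i / r i))%:E * \int[mu]_(x in D j) (G i j x)%:E)).
    rewrite exchange_big/=; apply: eq_bigr => i _.
    by rewrite -ge0_sume_distrr// => j _; exact: iG0.
  move=> j _; rewrite ge0_integral_sum_cond//.
  - apply: eq_bigr => i _; rewrite ge0_integralZl//.
    + exact: mGE.
    + by move=> x _; rewrite lee_fin.
  - by move=> i; apply: emeasurable_funM; [exact: measurable_cst|exact: mGE].
  - by move=> i x _; apply: mule_ge0; [exact: cr0|rewrite lee_fin].
rewrite (eq_bigr (fun i => (c * th i)%:E)); last first.
  by move=> i _; rewrite rE -EFinM -!mulrA mulVf ?mulr1// gt_eqF.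
by rewrite sumEFin -mulr_sumr th1 mulr1.
Qed.

End hoelder_family.

Lemma sum_inv_sqr_le2 (R : realFieldType) (N : nat) :
  \sum_(i < N) (i.+1%:R ^+ 2)^-1 <= 2 :> R.
Proof.
case: N => [|N]; first by rewrite big_ord0.
(* The induction needs the stronger telescoping bound [2 - 1 / N]. *)
apply: (@le_trans _ _ (2 - N.+1%:R^-1)); last by rewrite gerBl invr_ge0.
elim: N => [|N IH]; first by rewrite big_ord1 expr1n invr1; lra.
rewrite big_ord_recr/=; apply: (le_trans (lerD IH (lexx _))).
rewrite -addrA lerD2l -subr_ge0.
have x0 : 0 < N.+1%:R :> R by rewrite ltr0n.
rewrite -(natr1 N.+1); move: (N.+1%:R) x0 => x x0.
have -> : - (x + 1)^-1 - (- x^-1 + ((x + 1) ^+ 2)^-1) = (x * (x + 1) ^+ 2)^-1.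
  by field; rewrite !gt_eqF// addr_gt0.
by rewrite invr_ge0 ltW// mulr_gt0// exprn_gt0// addr_gt0.
Qed.

Lemma le_poweR (R : realType) (x y : \bar R) (s : R) : 0 <= s ->
  (0 <= x)%E -> (x <= y)%E -> (x `^ s <= y `^ s)%E.
Proof.
move=> s0 x0 xy; apply: gt0_ler_poweR => //; rewrite in_itv/= leey andbT//.
exact: le_trans xy.
Qed.

(** * Averages over sparse cubes against a majorant of the coefficients *)

Section schur_test.
Variables (R : realType) (n : nat).
Hypothesis n_gt0 : (0 < n)%N.
Notation Rn := (euclid R n).
Notation mu := (@lebesgue R n).
Implicit Types (P Q : cube R n) (F : seq (cube R n)) (A : set Rn).

Variables (q eta a : R) (K : nat).
Hypothesis q_gt1 : 1 < q.
Hypothesis eta_gt0 : 0 < eta.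
Hypothesis a_ge0 : 0 <= a.
Let r := q / (q - 1).
Hypothesis K_ge : 3 * r <= K%:R.

Let q_gt0 : 0 < q. Proof. exact: lt_trans q_gt1. Qed.
Let q1_gt0 : 0 < q - 1. Proof. by rewrite subr_gt0. Qed.
Let r_gt0 : 0 < r. Proof. by rewrite divr_gt0. Qed.

(** Replaces real exponents by one integer moment: the larger of [x] and [y] is at least 1 and can
    carry the whole exponent. It is used with [s = r] and [t = 2 * r / q], whence the requirement
    [3 * r <= K]. *)
Lemma powR_mul_le_max (x y s t : R) : 0 <= x -> 1 <= y -> 0 <= s -> 0 <= t -> s + t <= K%:R ->
  x `^ s * y `^ t <= x ^+ K + y ^+ K.
Proof.
move=> x0 y1 s0 t0 stK; have y0 : 0 <= y by exact: le_trans y1.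
have [xy|/ltW yx] := leP x y.
  apply: (@le_trans _ _ (y ^+ K)); last by rewrite lerDr exprn_ge0.
  rewrite -powR_mulrn//; apply: le_trans (ler_powR y1 stK).
  have yn0 : y != 0 by rewrite gt_eqF// (lt_le_trans ltr01).
  rewrite powRD; last by rewrite yn0 implybT.
  by rewrite ler_wpM2r ?powR_ge0// ge0_ler_powR ?nnegrE.
have x1 : 1 <= x by exact: le_trans yx.
apply: (@le_trans _ _ (x ^+ K)); last by rewrite lerDl exprn_ge0.
rewrite -powR_mulrn//; apply: le_trans (ler_powR x1 stK).
have xn0 : x != 0 by rewrite gt_eqF// (lt_le_trans ltr01).
rewrite powRD; last by rewrite xn0 implybT.
by rewrite ler_wpM2l ?powR_ge0// ge0_ler_powR ?nnegrE.
Qed.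

(** The summands bound the [K]-th moments of [V Q] and of the depth on [Q]; the exponent [q - 1] is
    [(1 - 1/q) * q], from the dual factor in Hoelder's inequality. *)
Definition schurC : R := (a + K`!%:R * eta^-1 ^+ K) `^ (q - 1).

Lemma schurC_ge0 : 0 <= schurC. Proof. exact: powR_ge0. Qed.

Variable F : seq (cube R n).
Hypothesis uF : uniq F.
Hypothesis lF : laminar F.
Hypothesis sF : sparse_seq eta F.

Local Open Scope ereal_scope.

Lemma depth_moment_cube Q : Q \in F ->
  \int[mu]_(x in cube_set Q) ((depth F (cube_set Q) x)%:R ^+ K)%:E <=
  (K`!%:R * eta^-1 ^+ K)%:E * mu (cube_set Q).
Proof.
move=> QF.
have := @depth_moment _ _ n_gt0 F (fun=> 1%R) (fun _ P => mu (cube_set P)) eta^-1%R uF lF.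
move=> H; apply: le_trans (H _ _ _ _ _ _ K _ QF).
- under [leRHS]eq_integral do rewrite mulr1.
  exact: lexx.
- by rewrite invr_ge0 ltW.
- by [].
- exact: measurable_cst.
- by move=> j P; exact: outer_measure_ge0.
- by move=> P _; rewrite -[leRHS]mul1e integral_cst//; exact: measurable_cube.
- by move=> j P _; exact: carleson_cubes.
Qed.

Variables (f : Rn -> R) (V : cube R n -> Rn -> R).
Hypothesis mf : measurable_fun setT f.
Hypothesis mV : forall Q, measurable_fun setT (V Q).
Hypothesis V0 : forall Q x, (0 <= V Q x)%R.
Hypothesis VK : forall Q, Q \in F ->
  \int[mu]_(x in cube_set Q) (V Q x ^+ K)%:E <= a%:E * mu (cube_set Q).

Let N Q x : R := (depth F (cube_set Q) x)%:R.

Let N_ge1 Q x : Q \in F -> cube_set Q x -> (1 <= N Q x)%R.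
Proof.
move=> QF Qx; rewrite /N ler1n -has_count; apply/hasP; exists Q => //.
by apply/asboolP; split.
Qed.

(** As [1/q + 1/r = 1], the product [u ^ (1/q) * v ^ (1/r)] equals [V * |f|]: the powers of the
    depth cancel. *)
Let u Q x : R := (`|f x| `^ q * N Q x `^ (- 2))%R.
Let v Q x : R := (V Q x `^ r * N Q x `^ (2 / q * r))%R.

Let mN Q : measurable_fun setT (N Q). Proof. exact: measurable_depth. Qed.

Let mu_ Q : measurable_fun setT (u Q).
Proof.
apply: measurable_funM.
  apply: (measurableT_comp (measurable_powR q)).
  exact: (measurableT_comp (@normr_measurable R setT) mf).
exact: (measurableT_comp (measurable_powR (- 2)) (mN Q)).
Qed.

Let mv Q : measurable_fun setT (v Q).
Proof.
apply: measurable_funM; first exact: (measurableT_comp (measurable_powR r) (mV Q)).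
exact: (measurableT_comp (measurable_powR (2 / q * r)) (mN Q)).
Qed.

Let u0 Q x : (0 <= u Q x)%R. Proof. by rewrite /u mulr_ge0 ?powR_ge0. Qed.
Let v0 Q x : (0 <= v Q x)%R. Proof. by rewrite /v mulr_ge0 ?powR_ge0. Qed.

Lemma integral_v Q : Q \in F ->
  \int[mu]_(x in cube_set Q) (v Q x)%:E <= (a + K`!%:R * eta^-1 ^+ K)%:E * mu (cube_set Q).
Proof.
move=> QF; have mQ := measurable_cube Q.
have mV1 : measurable_fun (cube_set Q) (fun x : Rn => (V Q x ^+ K)%:E).
  by apply/measurable_EFinP; apply: measurable_funTS; exact: measurable_funX.
have mN1 : measurable_fun (cube_set Q) (fun x : Rn => (N Q x ^+ K)%:E).
  by apply/measurable_EFinP; apply: measurable_funTS; exact: measurable_funX.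
have VK0 x : (0 <= V Q x ^+ K)%R by exact: exprn_ge0.
have NK0 x : (0 <= N Q x ^+ K)%R by exact: exprn_ge0.
apply: (@le_trans _ _ (\int[mu]_(x in cube_set Q) ((V Q x ^+ K)%:E + (N Q x ^+ K)%:E))).
  apply: le_integral_ge0.
  - by move=> x _; rewrite lee_fin.
  - by move=> x _; rewrite adde_ge0// lee_fin.
  - move=> x Qx; split=> //; rewrite -EFinD lee_fin /v.
    have q2 : (0 <= 2 / q)%R by rewrite divr_ge0// ltW.
    apply: powR_mul_le_max => //; [exact: N_ge1|exact: ltW| |].
      by rewrite mulr_ge0// ltW.
    apply: le_trans K_ge.
    have : (2 / q * r <= 2 * r)%R.
      by rewrite ler_wpM2r ?(ltW r_gt0)// ler_pdivrMr// ler_pMr// ltW.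
    lra.
rewrite ge0_integralD; last 5 first.
- exact: mQ.
- by move=> x _; rewrite lee_fin.
- exact: mV1.
- by move=> x _; rewrite lee_fin.
- exact: mN1.
rewrite EFinD muleDl ?fin_num_adde_defr// ?lebesgue_cube//.
by rewrite -lebesgue_cube; apply: leeD; [exact: VK|exact: depth_moment_cube].
Qed.

Lemma schur_cube Q : Q \in F ->
  avg Q (fun x => (V Q x * `|f x|)%:E) `^ q * mu (cube_set Q) <=
  schurC%:E * \int[mu]_(x in cube_set Q) (u Q x)%:E.
Proof.
move=> QF; have mQ := measurable_cube Q.
have qn0 : q != 0%R by rewrite gt_eqF.
have qi0 : (0 < q^-1)%R by rewrite invr_gt0.
have qi1 : (0 < 1 - q^-1)%R by rewrite subr_gt0 invf_lt1.
have rqi : (r * (1 - q^-1) = 1)%R by rewrite /r; field; rewrite qn0 gt_eqF.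
have h := @hoelder_family _ _ _ mu bool _ [:: Q] (fun Q => cube_set Q)
   (fun i => if i then q^-1 else (1 - q^-1))%R.
have {}h := h (fun j => measurable_cube j).
have {}h : \int[mu]_(x in cube_set Q) (u Q x `^ q^-1 * v Q x `^ (1 - q^-1))%:E <=
  (\int[mu]_(x in cube_set Q) (u Q x)%:E) `^ q^-1 *
  (\int[mu]_(x in cube_set Q) (v Q x)%:E) `^ (1 - q^-1).
  have := h _ _ (fun i Q x => if i then u Q x else v Q x).
  rewrite !big_bool /= !big_seq1.
  under eq_integral do rewrite big_bool/=.
  apply.
  - by case.
  - by rewrite addrC subrK.
  - by case=> j x; [exact: u0|exact: v0].
  - by case=> j; apply: measurable_funTS; [exact: mu_|exact: mv].
have I0 : 0 <= \int[mu]_(x in cube_set Q) (u Q x)%:E.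
  by apply: integral_ge0 => x _; rewrite lee_fin.
have J0 : 0 <= \int[mu]_(x in cube_set Q) (v Q x)%:E.
  by apply: integral_ge0 => x _; rewrite lee_fin.
have L0 : 0 <= \int[mu]_(x in cube_set Q) (V Q x * `|f x|)%:E.
  by apply: integral_ge0 => x _; rewrite lee_fin mulr_ge0.
have {}h : \int[mu]_(x in cube_set Q) (V Q x * `|f x|)%:E <=
  (\int[mu]_(x in cube_set Q) (u Q x)%:E) `^ q^-1 *
  (\int[mu]_(x in cube_set Q) (v Q x)%:E) `^ (1 - q^-1).
  apply: le_trans h; apply: le_integral_ge0.
  - by move=> x _; rewrite lee_fin mulr_ge0.
  - by move=> x _; rewrite lee_fin mulr_ge0 ?powR_ge0.
  - move=> x Qx; split=> //; rewrite lee_fin /u /v !powRM ?powR_ge0//.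
    have N0 : N Q x != 0%R by rewrite gt_eqF// (lt_le_trans ltr01)// N_ge1.
    have rqi2 : (2 / q * r * (1 - q^-1) = 2 / q)%R by rewrite -mulrA rqi mulr1.
    rewrite -!powRrM rqi rqi2 mulfV// !powRr1//.
    rewrite [X in (_ <= X)%R](_ : _ = `|f x| * V Q x * (N Q x `^ (- 2 * q^-1) * N Q x `^ (2 / q)))%R; last by ring.
    rewrite -powRD; last by rewrite N0 implybT.
    by rewrite mulNr addNr powRr0 mulr1 mulrC.
rewrite avgE lebesgue_cube; set m := (side Q ^+ n)%R.
have m0 : (0 < m)%R by rewrite exprn_gt0// side_gt0.
set c := (a + K`!%:R * eta^-1 ^+ K)%R.
have c0 : (0 <= c)%R.
  by rewrite /c addr_ge0// mulr_ge0// exprn_ge0// invr_ge0 ltW.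
have J1 : \int[mu]_(x in cube_set Q) (v Q x)%:E <= (c * m)%:E.
  by rewrite EFinM; have := integral_v QF; rewrite lebesgue_cube.
rewrite poweRM//; last by rewrite lee_fin invr_ge0 ltW.
apply: (@le_trans _ _ (((\int[mu]_(x in cube_set Q) (u Q x)%:E) * ((c * m) `^ (q - 1))%:E)
    * (m^-1)%:E `^ q * m%:E)).
  apply: lee_wpmul2r; first by rewrite lee_fin ltW.
  apply: lee_wpmul2r; first exact: poweR_ge0.
  apply: (le_trans (le_poweR (ltW q_gt0) L0 h)); rewrite poweRM ?poweR_ge0// -!poweRrM mulVf// poweRe1//.
  apply: lee_wpmul2l => //; rewrite -poweR_EFin.
  rewrite (_ : (1 - q^-1) * q = q - 1)%R; last by field.
  by apply: le_poweR; [exact: ltW|exact: J0|exact: J1].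
rewrite poweR_EFin -!muleA -!EFinM muleC; apply: lee_wpmul2r => //.
rewrite lee_fin /schurC -/c powRM ?(ltW m0)//.
rewrite -powR_inv1 ?(ltW m0)// -powRrM mulN1r -!mulrA.
(* The powers of the volume cancel: [q - 1] from the dual factor, [- q] from the average, [1] from
   the measure of [Q]. *)
have -> : (m `^ (q - 1) * (m `^ (- q) * m) = 1)%R.
  have mn0 : m != 0%R by rewrite gt_eqF.
  rewrite -[X in (_ * (_ * X))%R](powRr1 (ltW m0)) -powRD; last by rewrite mn0 implybT.
  rewrite -powRD; last by rewrite mn0 implybT.
  by rewrite (_ : q - 1 + (- q + 1) = 0)%R ?powRr0//; ring.
by rewrite mulr1.
Qed.

(** By [schur_cube] each cube is charged [lam Q * |f| ^ q / N_Q ^ 2] on [Q]. At a fixed point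
    [lam Q] is at most [m], and the inverse squares of the depths sum to at most 2 along the
    chain. *)
Lemma schur_test (lam : cube R n -> R) (m : Rn -> \bar R) :
  (forall Q, 0 <= lam Q)%R -> (forall x, 0 <= m x) ->
  (forall Q x, Q \in F -> cube_set Q x -> (lam Q)%:E <= m x) ->
  \sum_(Q <- F) avg Q (fun x => (V Q x * `|f x|)%:E) `^ q * ((lam Q)%:E * mu (cube_set Q)) <=
  (2 * schurC)%:E * \int[mu]_x ((`|f x| `^ q)%:E * m x).
Proof.
move=> lam0 m0 lamm.
pose h Q x := (2^-1 * lam Q)%:E * ((\1_(cube_set Q) x)%:E * (u Q x)%:E).
have h0 Q x : 0 <= h Q x.
  by rewrite /h !mule_ge0// lee_fin// mulr_ge0.
have miu Q : measurable_fun [set: Rn] (fun x => (\1_(cube_set Q) x)%:E * (u Q x)%:E).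
  apply: emeasurable_funM; apply/measurable_EFinP; last exact: mu_.
  exact: measurable_indic (measurable_cube Q).
have step1 : \sum_(Q <- F) avg Q (fun x => (V Q x * `|f x|)%:E) `^ q * ((lam Q)%:E * mu (cube_set Q)) <=
    (2 * schurC)%:E * \sum_(Q <- F) \int[mu]_x h Q x.
  rewrite ge0_sume_distrr; last by move=> Q _; apply: integral_ge0 => x _; exact: h0.
  rewrite big_seq [leRHS]big_seq; apply: lee_sum => Q QF.
  rewrite /h ge0_integralZl; last 4 first.
  - exact: measurableT.
  - exact: miu.
  - by move=> x _; rewrite mule_ge0 ?lee_fin.
  - by rewrite lee_fin mulr_ge0.
  rewrite integral_indicM// [leRHS]muleA -EFinM.
  have -> : (2 * schurC * (2^-1 * lam Q) = lam Q * schurC)%R by field.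
  rewrite [in leRHS]EFinM -[leRHS]muleA [leLHS]muleCA; apply: lee_wpmul2l; first by rewrite lee_fin.
  exact: schur_cube.
apply: (le_trans step1); apply: lee_wpmul2l; first by rewrite lee_fin mulr_ge0// schurC_ge0.
rewrite -ge0_integral_sum; last 3 first.
- exact: measurableT.
- by move=> Q; apply: emeasurable_funM; [exact: measurable_cst|exact: miu].
- by move=> Q x _; exact: h0.
apply: le_integral_ge0.
- by move=> x _; apply: sume_ge0 => Q _; exact: h0.
- by move=> x _; rewrite mule_ge0// lee_fin powR_ge0.
move=> x _; split=> //.
pose g i : R := ((i%:R `^ (-2))%R).
have cs := @chain_sum R n n_gt0 F setT x _ g uF lF.
have : (\sum_(i < depth F setT x) g i.+1 <= 2)%R.
  apply: le_trans (sum_inv_sqr_le2 R (depth F setT x)).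
  by apply: ler_sum => i _; rewrite /g powRN powR_mulrn.
rewrite -cs => cs2.
apply: (@le_trans _ _ ((`|f x| `^ q)%:E * (m x * (2^-1 * \sum_(P <- F | `[< cube_set P `<=` setT /\ cube_set P x >])
   g (depth F (cube_set P) x))%:E))).
  rewrite mulr_sumr -sumEFin ge0_sume_distrr; last first.
    by move=> P _; rewrite lee_fin mulr_ge0// powR_ge0.
  rewrite ge0_sume_distrr; last first.
    by move=> P _; rewrite mule_ge0// lee_fin mulr_ge0// powR_ge0.
  rewrite [leRHS]big_mkcond big_seq [leRHS]big_seq; apply: lee_sum => Q QF.
  have -> : `[< cube_set Q `<=` setT /\ cube_set Q x >] = (x \in cube_set Q).
    by apply/asboolP/idP => [[_ ?]|]; rewrite inE// => ?; split.
  rewrite /h indicE; case: ifPn => [|_]; last by rewrite mul0e mule0.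
  rewrite inE mul1e => Qx; rewrite /u -/(N Q x) /g.
  rewrite [leRHS]muleCA.
  rewrite (_ : (2^-1 * lam Q)%:E * _ = (lam Q)%:E * (`|f x| `^ q * (2^-1 * N Q x `^ (- 2)))%:E); last first.
    by rewrite -!EFinM; congr EFin; ring.
  rewrite -[X in _ <= _ * X]EFinM.
  apply: lee_wpmul2r; last exact: lamm.
  by rewrite lee_fin mulr_ge0 ?powR_ge0// mulr_ge0 ?powR_ge0.
apply: lee_wpmul2l; first by rewrite lee_fin powR_ge0.
rewrite -[leRHS]mule1; apply: lee_wpmul2l => //.
by rewrite lee_fin ler_pdivrMl// mulr1.
Qed.

End schur_test.

(** * The three sums attached to a single slot *)

Section slot_bounds.
Variables (R : realType) (n : nat).
Hypothesis n_gt0 : (0 < n)%N.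
Notation Rn := (euclid R n).
Notation mu := (@lebesgue R n).
Implicit Types (P Q : cube R n) (F : seq (cube R n)) (A : set Rn).

Variables (q eta : R).
Hypothesis q_gt1 : 1 < q.
Hypothesis eta_gt0 : 0 < eta.
Let q_gt0 : 0 < q. Proof. exact: lt_trans q_gt1. Qed.

Definition schur_exponent := Num.bound (3 * (q / (q - 1))).
Definition jn_exponent := Num.bound q.

Lemma schur_exponentP : 3 * (q / (q - 1)) <= schur_exponent%:R.
Proof.
apply: ltW; apply: archi_boundP; rewrite mulr_ge0// divr_ge0 ?(ltW q_gt0)//.
by rewrite subr_ge0 ltW.
Qed.

Definition jn_moment : R := jump R n ^+ schur_exponent * (schur_exponent`!%:R * 2 ^+ schur_exponent).

Lemma jn_moment_ge0 : 0 <= jn_moment.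
Proof. by rewrite /jn_moment !mulr_ge0 ?exprn_ge0 ?jump_ge0. Qed.

Definition avg_const k : R := 2 ^+ (k * n) * (2 * schurC q eta 1 schur_exponent).
Definition osc_const : R := 2 * schurC q eta jn_moment schur_exponent.
Definition wosc_const : R := avg_const jn_exponent * (1 + jnC R n jn_exponent).

Lemma avg_const_ge0 k : 0 <= avg_const k.
Proof. by rewrite /avg_const !mulr_ge0 ?exprn_ge0// schurC_ge0. Qed.

Lemma osc_const_ge0 : 0 <= osc_const.
Proof. by rewrite /osc_const mulr_ge0// schurC_ge0. Qed.

Lemma wosc_const_ge0 : 0 <= wosc_const.
Proof. by rewrite /wosc_const mulr_ge0 ?avg_const_ge0// addr_ge0// jnC_ge0. Qed.

Definition slot_const : R := 1 + avg_const 0 + osc_const + wosc_const.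

Lemma slot_const_gt0 : 0 < slot_const.
Proof.
by rewrite /slot_const -!addrA ltr_pwDl// !addr_ge0 ?avg_const_ge0 ?osc_const_ge0 ?wosc_const_ge0.
Qed.

Lemma slot_constP : [/\ avg_const 0 <= slot_const, osc_const <= slot_const & wosc_const <= slot_const].
Proof.
have := avg_const_ge0 0; have := osc_const_ge0; have := wosc_const_ge0.
by rewrite /slot_const; split; lra.
Qed.

Variable F : seq (cube R n).
Hypothesis uF : uniq F.
Hypothesis lF : laminar F.
Hypothesis sF : sparse_seq eta F.

Variables (w f b : Rn -> R).
Hypothesis ww : weight w.
Hypothesis mf : measurable_fun setT f.
Hypothesis bb : BMO b.

Local Open Scope ereal_scope.

Let J := \int[mu]_x ((`|f x| `^ q)%:E * maximal w x).

Let J_ge0 : 0 <= J.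
Proof. by apply: integral_ge0 => x _; rewrite mule_ge0 ?maximal_ge0// lee_fin powR_ge0. Qed.

Let w0 := weight_ge0 ww.
Let mw := measurable_weight ww.
Let mb : measurable_fun setT b. Proof. exact: bb.1.1. Qed.

Lemma wmeas_avg_le_maximal k Q x : cube_set Q x ->
  wmeas w (cube_set (dilate k Q)) * ((side (dilate k Q) ^+ n)^-1)%:E <= maximal w x.
Proof.
move=> Qx; rewrite -avg_wmeas//; apply: avg_le_maximal; exact: subset_dilate.
Qed.

(** The test with [V = 1] and [lam Q] the average of [w] over the [k]-th dilate, which [Mw]
    dominates on [Q]. Positive [k] serves the weighted oscillation, whose bound involves a dilated
    cube. *)
Lemma sum_avg_le k :
  \sum_(Q <- F) avg Q (fun x => `|f x|%:E) `^ q * wmeas w (cube_set (dilate k Q)) <=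
  (avg_const k)%:E * J.
Proof.
pose lam Q := fine (wmeas w (cube_set (dilate k Q)) * ((side (dilate k Q) ^+ n)^-1)%:E).
have lamE Q : (lam Q)%:E = wmeas w (cube_set (dilate k Q)) * ((side (dilate k Q) ^+ n)^-1)%:E.
  by rewrite fineK// fin_numM// wmeas_fin.
have lam0 Q : (0 <= lam Q)%R.
  by rewrite -lee_fin lamE mule_ge0 ?wmeas_ge0// lee_fin invr_ge0 exprn_ge0// ltW// side_gt0.
have V1 Q : Q \in F -> \int[mu]_(x in cube_set Q) (1 ^+ schur_exponent : R)%:E <= 1%:E * mu (cube_set Q).
  by move=> _; rewrite expr1n integral_cst//; exact: measurable_cube.
have H : \sum_(Q <- F) avg Q (fun x => (1 * `|f x|)%:E) `^ q * ((lam Q)%:E * mu (cube_set Q)) <=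
    (2 * schurC q eta 1 schur_exponent)%:E * J.
  apply: (@schur_test _ _ n_gt0 q eta 1%R schur_exponent q_gt1 eta_gt0 ler01 schur_exponentP
    F uF lF sF f (fun _ _ => 1%R) mf (fun _ => measurable_cst _) (fun _ _ => ler01) V1
    lam (maximal w) lam0 (maximal_ge0 w)).
  by move=> Q x _ Qx; rewrite lamE; exact: wmeas_avg_le_maximal.
rewrite /avg_const EFinM -muleA; apply: le_trans (lee_wpmul2l _ H); last first.
  by rewrite lee_fin exprn_ge0.
rewrite ge0_sume_distrr; last first.
  move=> Q _; rewrite mule_ge0 ?poweR_ge0// mule_ge0 ?lee_fin//.
apply: lee_sum => Q _; rewrite le_eqVlt; apply/orP; left; apply/eqP.
have -> : avg Q (fun x => (1 * `|f x|)%:E) = avg Q (fun x => `|f x|%:E).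
  by congr avg; apply/funext => x; rewrite mul1r.
rewrite muleCA; congr (_ * _).
rewrite muleCA -lebesgue_dilate lamE lebesgue_cube -muleA -EFinM mulVf ?mule1//.
by rewrite expf_neq0// gt_eqF// side_gt0.
Qed.

Local Notation bQ Q := (ravg Q b).

Let bmo_ge0 : 0 <= bmo_norm b.
Proof.
apply: le_trans (ereal_sup_ubound _); last by exists (unit_cube (0%R : 'rV[R]_n)).
by apply: avg_ge0 => x; rewrite lee_fin.
Qed.

Let bmo_fin : bmo_norm b \is a fin_num.
Proof. by rewrite ge0_fin_numE// bb.2. Qed.

Lemma osc_le_bmo Q : osc b (fun Q => bQ Q) Q (cube_set Q) <= bmo_norm b * mu (cube_set Q).
Proof.
rewrite /osc -avgM; apply: lee_wpmul2r; first exact: outer_measure_ge0.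
by apply: ereal_sup_ubound; exists Q.
Qed.

Let mbQ Q : measurable_fun setT (fun x => `|b x - bQ Q|%R).
Proof.
apply: (measurableT_comp (@normr_measurable R setT)).
by apply: measurable_funB; [exact: mb|exact: measurable_cst].
Qed.

(** A vanishing BMO norm forces [b = b_Q] almost everywhere on [Q]. This covers the case in which
    the normalisation by the norm is impossible. *)
Lemma integral_osc0 Q (h : Rn -> \bar R) : bmo_norm b = 0 -> (forall x, 0 <= h x) ->
  (forall x, b x = bQ Q -> h x = 0) -> \int[mu]_(x in cube_set Q) h x = 0.
Proof.
move=> b0 h0 hb.
apply: (@integral_eq0_dominated _ _ _ _ (cube_set Q) h (fun x => `|b x - bQ Q|%:E)).
- exact: measurable_cube.
- by apply/measurable_EFinP; apply: measurable_funTS; exact: mbQ.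
- by move=> x _; exact: h0.
- by move=> x _; rewrite lee_fin.
- by move=> x _ [] /eqP; rewrite normr_eq0 subr_eq0 => /eqP; exact: hb.
- apply/eqP; rewrite eq_le; apply/andP; split.
    by have := osc_le_bmo Q; rewrite b0 mul0e.
  by apply: integral_ge0 => x _; rewrite lee_fin.
Qed.

(** The test with [V Q = |b - b_Q| / ||b||], whose moments are controlled by the unweighted
    John-Nirenberg estimate; homogeneity brings back the factor [||b|| ^ q]. *)
Lemma sum_osc_avg_le :
  \sum_(Q <- F) avg Q (fun x => `|(b x - bQ Q) * f x|%:E) `^ q * wmeas w (cube_set Q) <=
  osc_const%:E * (bmo_norm b `^ q * J).
Proof.
have [b0|bn0] := eqVneq (bmo_norm b) 0.
  rewrite big1; last first.
    move=> Q _; rewrite avgE integral_osc0// ?mul0e ?poweR0r ?mul0e ?gt_eqF//.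
    by move=> x ->; rewrite subrr mul0r normr0.
  by rewrite mule_ge0 ?lee_fin ?osc_const_ge0// mule_ge0// poweR_ge0.
pose beta := fine (bmo_norm b).
have betaE : bmo_norm b = beta%:E by rewrite fineK.
have beta0 : (0 < beta)%R by rewrite -lte_fin -betaE lt_neqAle eq_sym bn0 bmo_ge0.
have oscb Q : osc b (fun Q => bQ Q) Q (cube_set Q) <= beta%:E * mu (cube_set Q).
  by rewrite -betaE; exact: osc_le_bmo.
pose V Q x : R := (beta^-1 * `|b x - bQ Q|)%R.
have V0 Q x : (0 <= V Q x)%R by rewrite mulr_ge0// invr_ge0 ltW.
have mV Q : measurable_fun setT (V Q).
  by apply: measurable_funM; [exact: measurable_cst|exact: mbQ].
have VK Q : Q \in F -> \int[mu]_(x in cube_set Q) (V Q x ^+ schur_exponent)%:E <=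
    jn_moment%:E * mu (cube_set Q).
  move=> _; have := @john_nirenberg_cube _ _ n_gt0 b (fun Q => bQ Q) beta mb beta0 oscb schur_exponent Q.
  move=> h; rewrite (eq_integral (fun x => ((beta^-1) ^+ schur_exponent)%:E * (`|b x - bQ Q| ^+ schur_exponent)%:E)); last first.
    by move=> x _; rewrite /V exprMn EFinM.
  rewrite ge0_integralZl; last 4 first.
  - exact: measurable_cube.
  - apply/measurable_EFinP; apply: measurable_funTS; apply: measurable_funX; exact: mbQ.
  - by move=> x _; rewrite lee_fin exprn_ge0.
  - by rewrite lee_fin exprn_ge0// invr_ge0 ltW.
  apply: le_trans (lee_wpmul2l _ h) _; first by rewrite lee_fin exprn_ge0// invr_ge0 ltW.
  rewrite muleA -EFinM; apply: lee_wpmul2r; first exact: outer_measure_ge0.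
  rewrite lee_fin /jn_moment exprMn exprVn le_eqVlt; apply/orP; left; apply/eqP.
  by field; rewrite expf_neq0// gt_eqF.
pose lam Q := fine (wmeas w (cube_set Q) * ((side Q ^+ n)^-1)%:E).
have lamE Q : (lam Q)%:E = wmeas w (cube_set Q) * ((side Q ^+ n)^-1)%:E.
  by rewrite fineK// fin_numM// wmeas_fin.
have lam0 Q : (0 <= lam Q)%R.
  by rewrite -lee_fin lamE mule_ge0 ?wmeas_ge0// lee_fin invr_ge0 exprn_ge0// ltW// side_gt0.
have H : \sum_(Q <- F) avg Q (fun x => (V Q x * `|f x|)%:E) `^ q * ((lam Q)%:E * mu (cube_set Q)) <=
    osc_const%:E * J.
  apply: (@schur_test _ _ n_gt0 q eta jn_moment schur_exponent q_gt1 eta_gt0 jn_moment_ge0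
     schur_exponentP F uF lF sF f V mf mV V0 VK lam (maximal w) lam0 (maximal_ge0 w)).
  by move=> Q x _ Qx; rewrite lamE; exact: (@wmeas_avg_le_maximal 0).
rewrite muleCA betaE; apply: le_trans (lee_wpmul2l _ H); last exact: poweR_ge0.
rewrite ge0_sume_distrr; last first.
  by move=> Q _; rewrite mule_ge0 ?poweR_ge0// mule_ge0 ?lee_fin.
apply: lee_sum => Q _; rewrite le_eqVlt; apply/orP; left; apply/eqP.
have -> : avg Q (fun x => `|(b x - bQ Q) * f x|%:E) =
    beta%:E * avg Q (fun x => (V Q x * `|f x|)%:E).
  rewrite !avgE muleA; congr (_ * _).
  rewrite -ge0_integralZl; last 4 first.
  - exact: measurable_cube.
  - apply/measurable_EFinP; apply: measurable_funTS; apply: measurable_funM; first exact: mV.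
    exact: (measurableT_comp (@normr_measurable R setT) mf).
  - by move=> x _; rewrite lee_fin mulr_ge0.
  - by rewrite lee_fin ltW.
  apply: eq_integral => x _; rewrite -EFinM /V normrM !mulrA divff ?mul1r//.
  by rewrite gt_eqF.
rewrite poweRM; last 2 first.
- by rewrite lee_fin ltW.
- by apply: avg_ge0 => x; rewrite lee_fin mulr_ge0.
rewrite -!muleA; congr (_ * (_ * _)).
rewrite lamE lebesgue_cube -muleA -EFinM mulVf ?mule1//.
by rewrite expf_neq0// gt_eqF// side_gt0.
Qed.

Local Notation Aw := (weak_A_infty_const w).

Lemma wmeas_le_maximal_integral Q : wmeas w (cube_set Q) <= maximal_integral w Q.
Proof.
rewrite -[leLHS](avgM Q (fun x => (w x)%:E)) -integral_cst; last exact: measurable_cube.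
apply: le_integral_ge0.
- by move=> x _; apply: avg_ge0 => y; rewrite lee_fin.
- by move=> x _; exact: maximal_ge0.
move=> x Qx; split; first exact: Qx.
apply: le_trans (avg_le_maximal _ Qx).
rewrite /avg; apply: lee_wpmul2r; first by rewrite inve_ge0 outer_measure_ge0.
apply: le_integral_ge0 => // y Qy; first by rewrite lee_fin.
by split=> //=; rewrite lee_fin indicE mem_set// mulr1 ler_norm.
Qed.

Lemma weak_const_ge0 : 0 <= Aw.
Proof.
apply: le_trans (ereal_sup_ubound _); last by exists (unit_cube (0%R : 'rV[R]_n)).
by rewrite mule_ge0 ?maximal_integral_ge0// inve_ge0 wmeas_ge0.
Qed.

(** With [t = alpha * beta] and [k > q], [y ^ q <= t ^ q * (1 + (y / t) ^ k)] according to whether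
    [y <= t] or not. The factor [t ^ k] of the [k]-th moment cancels, so that only [t ^ q]
    remains. *)
Lemma integral_powR_osc_le (alpha beta : R) Q : (0 < alpha)%R -> (0 < beta)%R ->
  Aw <= alpha%:E -> bmo_norm b <= beta%:E ->
  \int[mu]_(x in cube_set Q) (`|b x - bQ Q| `^ q * w x)%:E <=
  ((alpha * beta) `^ q * (1 + jnC R n jn_exponent))%:E * wmeas w (cube_set (dilate jn_exponent Q)).
Proof.
move=> alpha0 beta0 Aa bbeta.
have oscb S : osc b (fun Q => bQ Q) S (cube_set S) <= beta%:E * mu (cube_set S).
  by apply: le_trans (osc_le_bmo S) _; apply: lee_wpmul2r => //; exact: outer_measure_ge0.
set k := jn_exponent; set t := (alpha * beta)%R.
have t0 : (0 < t)%R by rewrite mulr_gt0.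
have h := @john_nirenberg_weight _ _ n_gt0 w ww b (fun Q => bQ Q) beta mb beta0 oscb k Q alpha (ltW alpha0) Aa.
have tk0 : (0 < t ^+ k)%R by rewrite exprn_gt0.
have mQ := measurable_cube Q.
have mbk : measurable_fun (cube_set Q) (fun x => (`|b x - bQ Q| ^+ k * w x)%:E).
  apply/measurable_EFinP; apply: measurable_funTS; apply: (measurable_funM _ mw).
  by apply: measurable_funX; exact: mbQ.
have mwE : measurable_fun (cube_set Q) (fun x => (w x)%:E).
  by apply/measurable_EFinP; apply: measurable_funTS.
have bk0 x : (0 <= `|b x - bQ Q| ^+ k * w x)%R by rewrite mulr_ge0// exprn_ge0.
apply: (@le_trans _ _ (\int[mu]_(x in cube_set Q)
    ((t `^ q)%:E * (w x)%:E + (t `^ q / t ^+ k)%:E * (`|b x - bQ Q| ^+ k * w x)%:E))).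
  apply: le_integral_ge0.
  - by move=> x _; rewrite lee_fin mulr_ge0// powR_ge0.
  - move=> x _; rewrite adde_ge0// mule_ge0 ?lee_fin ?powR_ge0//.
    by rewrite divr_ge0 ?powR_ge0// ltW.
  move=> x Qx; split=> //; rewrite -!EFinM -EFinD lee_fin mulrA -mulrDl.
  apply: ler_wpM2r => //.
  set y := `|b x - bQ Q|%R; have y0 : (0 <= y)%R by exact: normr_ge0.
  have -> : (y `^ q = t `^ q * (y / t) `^ q)%R.
    by rewrite -powRM ?divr_ge0 ?(ltW t0)// mulrC divfK// gt_eqF.
  have -> : (t `^ q + t `^ q / t ^+ k * y ^+ k = t `^ q * (1 + (y / t) ^+ k))%R.
    by rewrite (@expr_div_n _ y t k); field; rewrite gt_eqF.
  rewrite ler_wpM2l ?powR_ge0//; set z := (y / t)%R.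
  have z0 : (0 <= z)%R by rewrite divr_ge0// ltW.
  have [z1|/ltW z1] := leP z 1%R.
    apply: (@le_trans _ _ 1%R); last by rewrite lerDl exprn_ge0.
    have -> : (1 = 1 `^ q :> R)%R by rewrite powR1.
    by rewrite ge0_ler_powR ?nnegrE// ltW.
  apply: (@le_trans _ _ (z ^+ k)%R); last by rewrite lerDr.
  rewrite -powR_mulrn// ler_powR//; apply: ltW; apply: archi_boundP.
  exact: ltW.
rewrite ge0_integralD; last 5 first.
- exact: mQ.
- by move=> x _; rewrite mule_ge0 ?lee_fin// powR_ge0.
- by apply: emeasurable_funM; [exact: measurable_cst|exact: mwE].
- by move=> x _; rewrite mule_ge0 ?lee_fin// divr_ge0 ?powR_ge0// ltW.
- by apply: emeasurable_funM; [exact: measurable_cst|exact: mbk].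
rewrite ge0_integralZl; last 4 first.
- exact: mQ.
- exact: mwE.
- by move=> x _; rewrite lee_fin.
- by rewrite lee_fin powR_ge0.
rewrite ge0_integralZl; last 4 first.
- exact: mQ.
- exact: mbk.
- by move=> x _; rewrite lee_fin.
- by rewrite lee_fin divr_ge0 ?powR_ge0// ltW.
have h1 : (t `^ q)%:E * \int[mu]_(x in cube_set Q) (w x)%:E <=
    (t `^ q)%:E * wmeas w (cube_set (dilate k Q)).
  by apply: lee_wpmul2l; [rewrite lee_fin powR_ge0|apply: wmeas_le => //; exact: subset_dilate].
have h2 : (t `^ q / t ^+ k)%:E * \int[mu]_(x in cube_set Q) (`|b x - bQ Q| ^+ k * w x)%:E <=
    (t `^ q * jnC R n k)%:E * wmeas w (cube_set (dilate k Q)).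
  apply: le_trans (lee_wpmul2l _ h) _; first by rewrite lee_fin divr_ge0 ?powR_ge0// ltW.
  rewrite muleA -EFinM; apply: lee_wpmul2r; first exact: wmeas_ge0.
  rewrite lee_fin [(beta * alpha)%R]mulrC -/t le_eqVlt; apply/orP; left; apply/eqP.
  by field; rewrite gt_eqF.
apply: le_trans (leeD h1 h2) _.
rewrite -ge0_muleDl ?lee_fin ?powR_ge0//; last by rewrite mulr_ge0 ?powR_ge0// jnC_ge0.
by rewrite -EFinD mulrDr mulr1.
Qed.

Lemma sum_avg_wosc_le :
  \sum_(Q <- F) avg Q (fun x => `|f x|%:E) `^ q *
     \int[mu]_(x in cube_set Q) (`|b x - bQ Q| `^ q * w x)%:E <=
  wosc_const%:E * (Aw `^ q * (bmo_norm b `^ q * J)).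
Proof.
have iv0 Q : 0 <= \int[mu]_(x in cube_set Q) (`|b x - bQ Q| `^ q * w x)%:E.
  by apply: integral_ge0 => x _; rewrite lee_fin mulr_ge0// powR_ge0.
have rhs0 : 0 <= wosc_const%:E * (Aw `^ q * (bmo_norm b `^ q * J)).
  by rewrite !mule_ge0 ?poweR_ge0// lee_fin wosc_const_ge0.
have iw0 Q : wmeas w (cube_set Q) = 0 ->
    \int[mu]_(x in cube_set Q) (`|b x - bQ Q| `^ q * w x)%:E = 0.
  move=> wQ; apply: (@integral_eq0_dominated _ _ _ _ (cube_set Q) _ (fun x => (w x)%:E)); last exact: wQ.
  - exact: measurable_cube.
  - by apply/measurable_EFinP; apply: measurable_funTS.
  - by move=> x _; rewrite lee_fin mulr_ge0// powR_ge0.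
  - by move=> x _; rewrite lee_fin.
  - by move=> x _ [->]; rewrite mulr0.
have [b0|bn0] := eqVneq (bmo_norm b) 0.
  rewrite big1// => Q _; rewrite integral_osc0// ?mule0//.
  - by move=> x; rewrite lee_fin mulr_ge0// powR_ge0.
  - by move=> x ->; rewrite subrr normr0 powR0 ?mul0r// gt_eqF.
pose beta := fine (bmo_norm b).
have betaE : bmo_norm b = beta%:E by rewrite fineK.
have beta0 : (0 < beta)%R by rewrite -lte_fin -betaE lt_neqAle eq_sym bn0 bmo_ge0.
(* Here [w(Q) <= int_Q M(w 1_Q) <= 0 * w(2Q)], so [w] vanishes almost everywhere on each cube. *)
have [A0|An0] := eqVneq Aw 0.
  rewrite big1// => Q _; rewrite iw0 ?mule0//; apply/eqP; rewrite eq_le wmeas_ge0// andbT.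
  apply: le_trans (wmeas_le_maximal_integral Q) _.
  have := @maximal_integral_le _ _ _ ww 0%R Q; rewrite mul0e; apply.
  by rewrite A0.
have A0 : 0 < Aw by rewrite lt_neqAle eq_sym An0 weak_const_ge0.
have [Afin|] := boolP (Aw \is a fin_num); last first.
  (* With an infinite constant the right side is [+oo] unless [J = 0]; in that case [sum_avg_le]
     makes, for every [Q] in [F], either the average of [f] or [w(Q)] vanish. *)
  rewrite ge0_fin_numE ?weak_const_ge0// -leNgt leye_eq => /eqP Ay.
  have [J0|Jn0] := eqVneq J 0.
    have S0 := sum_avg_le 0; rewrite J0 mule0 in S0.
    rewrite big_seq big1// => Q QF.
    have : avg Q (fun x => `|f x|%:E) `^ q * wmeas w (cube_set Q) == 0.
      rewrite eq_le mule_ge0 ?poweR_ge0 ?wmeas_ge0// andbT; apply: le_trans S0.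
      rewrite (big_rem Q)//= leeDl//; apply: sume_ge0 => S _.
      by rewrite mule_ge0 ?poweR_ge0// wmeas_ge0.
    by rewrite mule_eq0 => /orP[/eqP ->|/eqP /iw0 ->]; rewrite ?mul0e ?mule0.
  rewrite (_ : _ * _ = +oo) ?leey// Ay poweRyr ?gt_eqF//.
  have C0 : (0 < wosc_const)%R.
    rewrite lt_neqAle wosc_const_ge0 andbT eq_sym /wosc_const mulf_neq0//.
      rewrite gt_eqF// /avg_const !mulr_gt0 ?exprn_gt0// /schurC powR_gt0//.
      by rewrite ltr_pwDl// mulr_ge0// exprn_ge0// invr_ge0 ltW.
    by rewrite gt_eqF// ltr_pwDl// jnC_ge0.
  rewrite gt0_mulye ?gt0_muley ?lte_fin// mule_gt0//.
    by apply: poweR_gt0; rewrite betaE lte_fin.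
  by rewrite lt_neqAle eq_sym Jn0.
pose alpha := fine Aw.
have alphaE : Aw = alpha%:E by rewrite fineK.
have alpha0 : (0 < alpha)%R by rewrite -lte_fin -alphaE.
apply: (@le_trans _ _ (\sum_(Q <- F) ((alpha * beta) `^ q * (1 + jnC R n jn_exponent))%:E *
   (avg Q (fun x => `|f x|%:E) `^ q * wmeas w (cube_set (dilate jn_exponent Q))))).
  apply: lee_sum => Q _; rewrite muleCA; apply: lee_wpmul2l; first exact: poweR_ge0.
  by apply: integral_powR_osc_le => //; rewrite ?alphaE ?betaE.
have c0 : 0 <= ((alpha * beta) `^ q * (1 + jnC R n jn_exponent))%:E.
  by rewrite lee_fin mulr_ge0 ?powR_ge0// addr_ge0// jnC_ge0.
rewrite -ge0_sume_distrr; last by move=> Q _; rewrite mule_ge0 ?poweR_ge0// wmeas_ge0.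
apply: le_trans (lee_wpmul2l c0 (sum_avg_le jn_exponent)) _.
rewrite alphaE betaE !poweR_EFin.
rewrite [X in _ <= _ * X]muleA -EFinM [leRHS]muleA -EFinM [leLHS]muleA -EFinM.
apply: (lee_wpmul2r J_ge0).
rewrite lee_fin powRM ?(ltW alpha0) ?(ltW beta0)// /wosc_const.
move: (avg_const _) (1 + _)%R (alpha `^ q)%R (beta `^ q)%R => x y u v.
by rewrite le_eqVlt; apply/orP; left; apply/eqP; ring.
Qed.

End slot_bounds.

(** * The sparse form *)

Section poweR_sums.
Variable R : realType.
Local Open Scope ereal_scope.

(** For [t = z / (x + y)] in [[0, 1]] and [p <= 1] one has [t <= t ^ p]; add the cases [z = x] and
    [z = y]. *)
Lemma powR_subadditive (x y p : R) : (0 <= x -> 0 <= y -> 0 < p -> p <= 1 ->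
  (x + y) `^ p <= x `^ p + y `^ p)%R.
Proof.
move=> x0 y0 p0 p1; have := addr_ge0 x0 y0; rewrite le_eqVlt => /predU1P[s0|s0].
  by rewrite -s0 powR0 ?gt_eqF// addr_ge0 ?powR_ge0.
have key z : (0 <= z -> z <= x + y -> z / (x + y) * (x + y) `^ p <= z `^ p)%R.
  rewrite le_eqVlt => /predU1P[<- _|z0 zs]; first by rewrite !mul0r powR_ge0.
  have -> : (z `^ p = (z / (x + y)) `^ p * (x + y) `^ p)%R.
    by rewrite -powRM ?divr_ge0 ?(ltW z0) ?(ltW s0)// divfK// gt_eqF.
  rewrite ler_wpM2r ?powR_ge0//; set t := (z / (x + y))%R.
  have t0 : (0 < t)%R by rewrite divr_gt0.
  have t1 : (t <= 1)%R by rewrite ler_pdivrMr// mul1r.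
  have tp0 : (0 < t `^ p <= 1)%R.
    rewrite powR_gt0//=; have -> : (1 = 1 `^ p :> R)%R by rewrite powR1.
    by rewrite ge0_ler_powR ?nnegrE// ltW.
  have pi1 : (1 <= p^-1)%R by rewrite invf_ge1.
  have := ge1r_powR tp0 pi1.
  by rewrite -powRrM divff ?gt_eqF// powRr1 ?(ltW t0).
have kx := key x x0; have ky := key y y0.
rewrite lerDl in kx; rewrite lerDr in ky.
apply: le_trans (lerD (kx y0) (ky x0)).
by rewrite -mulrDl -mulrDl divff ?mul1r// gt_eqF.
Qed.

Lemma poweR_subadditive (x y : \bar R) (p : R) : 0 <= x -> 0 <= y -> (0 < p)%R -> (p <= 1)%R ->
  (x + y) `^ p <= x `^ p + y `^ p.
Proof.
move=> + + p0 p1; case: x => [x| |]//; case: y => [y| |]// x0 y0.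
- by rewrite -EFinD !poweR_EFin -EFinD lee_fin powR_subadditive.
- by rewrite addey// poweRyr ?gt_eqF// addey.
- by rewrite addye// poweRyr ?gt_eqF// addye.
- by rewrite addye// poweRyr ?gt_eqF.
Qed.

Lemma poweR_sum_le (I : Type) (s : seq I) (P : pred I) (a : I -> \bar R) (p : R) :
  (forall i, 0 <= a i) -> (0 < p)%R -> (p <= 1)%R ->
  (\sum_(i <- s | P i) a i) `^ p <= \sum_(i <- s | P i) a i `^ p.
Proof.
move=> a0 p0 p1; elim: s => [|i s IH].
  by rewrite !big_nil poweR0r// gt_eqF.
rewrite !big_cons; case: ifP => _//; apply: le_trans (poweR_subadditive _ _ p0 p1) _ => //.
  exact: sume_ge0.
exact: leeD.
Qed.

Lemma poweR_prod (I : Type) (s : seq I) (P : pred I) (a : I -> \bar R) (p : R) :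
  (forall i, 0 <= a i) ->
  (\prod_(i <- s | P i) a i) `^ p = \prod_(i <- s | P i) a i `^ p.
Proof.
move=> a0; elim: s => [|i s IH]; first by rewrite !big_nil poweR1r.
rewrite !big_cons; case: ifP => _//; rewrite poweRM ?IH//.
exact: prode_ge0.
Qed.

Lemma lee_prod (I : Type) (s : seq I) (P : pred I) (a b : I -> \bar R) :
  (forall i, 0 <= a i) -> (forall i, a i <= b i) ->
  \prod_(i <- s | P i) a i <= \prod_(i <- s | P i) b i.
Proof.
move=> a0 ab; elim: s => [|i s IH]; first by rewrite !big_nil.
rewrite !big_cons; case: ifP => _//; apply: lee_pmul => //.
exact: prode_ge0.
Qed.

End poweR_sums.

(** * Exhausting a countable family by finite lists *)

Section exhaustion.
Variables (T : choiceType) (S : set T) (e : nat -> T) (g : T -> nat).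
Hypothesis eg : forall t, S t -> e (g t) = t.

(** The test [g (e i) == i] keeps one index per element, so the lists are duplicate free even if [e]
    repeats values. *)
Definition segment k : seq T :=
  [seq e i | i <- iota 0 k & `[< S (e i) >] && (g (e i) == i)].

Lemma segment_uniq k : uniq (segment k).
Proof.
rewrite map_inj_in_uniq ?filter_uniq ?iota_uniq// => i j.
rewrite !mem_filter => /andP[/andP[_ /eqP gi] _] /andP[/andP[_ /eqP gj] _] eij.
by rewrite -gi -gj eij.
Qed.

Lemma segment_sub k t : t \in segment k -> S t.
Proof. by move=> /mapP[i]; rewrite mem_filter => /andP[/andP[/asboolP Si _] _] ->. Qed.

Lemma mem_segment k t : S t -> (g t < k)%N -> t \in segment k.
Proof.
move=> St gk; apply/mapP; exists (g t); last by rewrite eg.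
by rewrite mem_filter eg// eqxx asboolT// mem_iota add0n gk.
Qed.

Variables (R : realType) (a : T -> \bar R).
Hypothesis a0 : forall t, (0 <= a t)%E.
Local Open Scope ereal_scope.

Lemma nondecreasing_segment : nondecreasing_seq (fun k => \sum_(t <- segment k) a t).
Proof.
apply/nondecreasing_seqP => k; rewrite /segment -addn1 iotaD filter_cat map_cat big_cat /=.
by rewrite leeDl// sume_ge0.
Qed.

Lemma esum_le_limn : esum S a <= limn (fun k => \sum_(t <- segment k) a t).
Proof.
rewrite (cvg_lim _ (ereal_nondecreasing_cvgn nondecreasing_segment))//.
apply: ge_ereal_sup => _ [X [/finite_seqP[s' Xs'] XS] <-].
pose s := undup s'.
have Xs : X = [set` s] by rewrite Xs'; apply/seteqP; split => t /=; rewrite mem_undup.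
rewrite Xs -fsbig_seq ?undup_uniq//.
have sS t : t \in s -> S t by move=> ts; apply: XS; rewrite Xs.
(* Past the largest index of an element of [s], the segment contains all of [s]. *)
pose k := (\max_(t <- s) g t).+1.
apply: (@le_trans _ _ (\sum_(t <- segment k) a t)); last by apply: ereal_sup_ubound; exists k.
have ps : perm_eq s [seq t <- segment k | t \in s].
  apply: uniq_perm; [exact: undup_uniq|by rewrite filter_uniq ?segment_uniq|].
  move=> t; rewrite mem_filter; case: (boolP (t \in _)) => //= ts.
  rewrite mem_segment//; first exact: sS.
  by rewrite /k ltnS; exact: leq_bigmax_seq.
rewrite (perm_big _ ps)/= big_filter big_mkcond/=.
by apply: lee_sum => t _; case: ifP.
Qed.

End exhaustion.

Section lattice_families.
Variables (R : realType) (n : nat).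
Hypothesis n_gt0 : (0 < n)%N.
Notation Rn := (euclid R n).
Notation mu := (@lebesgue R n).
Implicit Types (P Q : cube R n).

Lemma cube_eqP P Q : (forall i, corner P 0 i = corner Q 0 i) -> side P = side Q -> P = Q.
Proof.
move=> cPQ; have {cPQ} : corner P = corner Q by apply/rowP.
case: P Q => [p s] [q r]; rewrite /corner /side /= => -> rs.
by congr pair; apply/val_inj.
Qed.

Definition ancestor Q k (v : {ffun 'I_n -> nat}) : cube R n :=
  (\row_i (corner Q 0 i - (v i)%:R * side Q), (Q.2%:num * 2 ^+ k)%:pos).

Definition descendant Q k (v : {ffun 'I_n -> nat}) : cube R n :=
  (\row_i (corner Q 0 i + (v i)%:R * (side Q / 2 ^+ k)), (Q.2%:num / 2 ^+ k)%:pos).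

Lemma dyadic_descendantP Q P : dyadic_descendant Q P ->
  (exists k v, P = descendant Q k v) /\ (exists k v, Q = ancestor P k v).
Proof.
move=> [k [v [sE cE]]]; pose v' := [ffun i => val (v i)]; split; exists k, v'.
  apply: cube_eqP => // i.
  by rewrite /corner /= mxE -/(corner Q) /v' ffunE /= cE sE.
apply: cube_eqP => [i|].
  by rewrite [RHS]mxE /v' ffunE cE addrK.
rewrite /side /= -/(side P) sE -/(side Q) divfK// expf_neq0//.
Qed.

(** Every cube of the lattice is reached from a fixed [Q0] by going up to a common ancestor and down
    again; both moves are coded by a generation and a vector of naturals, so the codes are
    countable. *)
Lemma lattice_enum (D : set (cube R n)) : dyadic_lattice D ->
  exists (e : nat -> cube R n) (g : cube R n -> nat), forall Q, D Q -> e (g Q) = Q.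
Proof.
move=> [_ Danc Dcov]; have [Q0 DQ0 _] := Dcov set0 (@compact0 _).
pose code := (nat * {ffun 'I_n -> nat} * nat * {ffun 'I_n -> nat})%type.
pose dec (c : code) := let: (k, v, k', v') := c in descendant (ancestor Q0 k v) k' v'.
pose e i := if (unpickle i : option code) is Some c then dec c else Q0.
have ex Q : D Q -> exists i, e i = Q.
  move=> DQ; have [Q1 [_ d0 d]] := Danc _ _ DQ0 DQ.
  have [_ [k [v Q1E]]] := dyadic_descendantP d0.
  have [[k' [v' QE]] _] := dyadic_descendantP d.
  by exists (pickle ((k, v, k', v') : code)); rewrite /e pickleK /dec -Q1E -QE.
exists e, (fun Q => if pselect (exists i, e i = Q) is left h then projT1 (cid h) else 0%N).
by move=> Q /ex h; case: pselect => // h'; case: cid.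
Qed.

Lemma lattice_nested (D : set (cube R n)) P Q : dyadic_lattice D -> D P -> D Q ->
  (exists x, cube_set P x /\ cube_set Q x) ->
  cube_set P `<=` cube_set Q \/ cube_set Q `<=` cube_set P.
Proof.
move=> [_ Danc _] DP DQ; have [S [_ dP dQ]] := Danc _ _ DP DQ.
exact: descendant_nested dP dQ.
Qed.

Lemma sub_laminar (D : set (cube R n)) (F : seq (cube R n)) : dyadic_lattice D ->
  (forall P, P \in F -> D P) -> laminar F.
Proof. by move=> dD FD P Q /FD DP /FD DQ; exact: lattice_nested dD DP DQ. Qed.

Lemma sub_sparse (S : set (cube R n)) (F : seq (cube R n)) (eta : R) : sparse eta S ->
  (forall P, P \in F -> S P) -> sparse_seq eta F.
Proof.
move=> sS FS P PF; apply: le_trans (sS P (FS P PF)); apply: le_outer_measure.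
by move=> x [Q [QF QP] Qx]; exists Q => //; split => //; exact: FS.
Qed.

End lattice_families.

(** Lets one product over all [m] slots treat the first [l], which carry a symbol, differently from
    the others. *)
Lemma prod_insub (T : Type) (idx : T) (op : Monoid.com_law idx) (l m : nat)
    (llem : (l <= m)%N) (h : 'I_l -> T) (k : 'I_m -> T) :
  \big[op/idx]_(s < m) (if (insub (val s) : option 'I_l) is Some i then h i else k s) =
  op (\big[op/idx]_(i < l) h i) (\big[op/idx]_(s < m | (l <= s)%N) k s).
Proof.
rewrite (bigID (fun s : 'I_m => (s < l)%N))/=; congr (op _ _).
  rewrite (big_ord_narrow llem); apply: eq_bigr => i _ /=.
  by rewrite insubT //= => lt; congr h; exact: val_inj.
apply: eq_big => [s|s]; first by rewrite -leqNgt.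
by rewrite -leqNgt => ls; rewrite insubF// ltnNge ls.
Qed.

Section constants.
Variables (R : realType) (n : nat).
Notation Rn := (euclid R n).
Notation mu := (@lebesgue R n).
Local Open Scope ereal_scope.

Lemma bmo_norm_ge0 (b : Rn -> R) : 0 <= bmo_norm b.
Proof.
apply: le_trans (ereal_sup_ubound _); last by exists (unit_cube (0%R : 'rV[R]_n)).
by apply: avg_ge0 => x; rewrite lee_fin.
Qed.

Lemma weak_const_le (w : Rn -> R) : weight w -> weak_A_infty_const w <= A_infty_const w.
Proof.
move=> ww; apply: ge_ereal_sup => _ [Q _ <-].
apply: (@le_trans _ _ (maximal_integral w Q / wmeas w (cube_set Q))).
  apply: lee_wpmul2l; first exact: maximal_integral_ge0.
  by rewrite lee_pV2 ?inE ?wmeas_ge0//; apply: wmeas_le => //; exact: subset_double.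
by apply: ereal_sup_ubound; exists Q.
Qed.

(** If [w(Q) > 0], then [w(Q) <= int_Q M(w 1_Q)] makes the quotient at [Q] at least 1. A constant
    below 1 thus forces [w] to have no mass on any cube. *)
Lemma maximal_eq0 (w : Rn -> R) : weight w -> A_infty_const w < 1 -> forall x, maximal w x = 0.
Proof.
move=> ww A1 x; apply/eqP; rewrite eq_le maximal_ge0 andbT.
apply: ge_ereal_sup => _ [Q _ <-]; rewrite avg_wmeas//.
suff -> : wmeas w (cube_set Q) = 0 by rewrite mul0e.
apply/eqP/negP => /negP wn0; move: A1; rewrite ltNge => /negP; apply.
apply: (@le_trans _ _ (maximal_integral w Q / wmeas w (cube_set Q))); last first.
  by apply: ereal_sup_ubound; exists Q.
have wfin := wmeas_fin ww Q; have w0 := wmeas_ge0 ww (cube_set Q).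
have := wmeas_le_maximal_integral ww Q.
rewrite -(fineK wfin) in wn0 w0 *; move: (fine _) wn0 w0 => a an0 a0.
have {an0 a0} a0 : (0 < a)%R by rewrite lt_neqAle eq_sym -lee_fin a0 andbT.
by move=> h; rewrite inver gt_eqF// lee_pdivlMr// mul1e.
Qed.

End constants.

(** * From the single slots to the sparse form *)

Section sparse_form_bound.
Variables (R : realType) (n m l : nat) (p : R) (ps : 'I_m -> R) (C0 eta : R).
Hypotheses (n_gt0 : (0 < n)%N) (llem : (l <= m)%N).
Hypotheses (ps_gt1 : forall s, 1 < ps s) (pE : p^-1 = \sum_(s < m) (ps s)^-1).
Hypotheses (p_gt0 : 0 < p) (p_le1 : p <= 1) (C0_gt0 : 0 < C0) (eta_gt0 : 0 < eta).
Notation Rn := (euclid R n).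
Notation mu := (@lebesgue R n).
Notation slot := (slot llem).
Local Open Scope ereal_scope.

Variables (w : 'I_m -> Rn -> R) (b : 'I_l -> Rn -> R) (f : 'I_m -> Rn -> R).
Hypothesis ww : forall s, weight (w s).
Hypothesis bb : forall i, BMO (b i).
Hypothesis bf : forall s, bounded_compactly_supported (f s).

Let ps_gt0 s : (0 < ps s)%R. Proof. exact: lt_trans (ps_gt1 s). Qed.
Let mf s : measurable_fun setT (f s). Proof. by have [] := bf s. Qed.
Let mb i : measurable_fun setT (b i). Proof. exact: (bb i).1.1. Qed.

Definition osc_avg (g h : Rn -> R) Q := avg Q (fun y => `|(g y - ravg Q g) * h y|%:E).

Lemma avg_fin s Q : avg Q (fun y => `|f s y|%:E) \is a fin_num.
Proof.
have [_ [M fM] _] := bf s.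
rewrite avgE fin_numM// ge0_fin_numE; last by apply: integral_ge0 => x _; rewrite lee_fin.
apply: (@le_lt_trans _ _ (\int[mu]_(x in cube_set Q) (cst M%:E x))).
  apply: le_integral_ge0 => // x Qx.
    by rewrite lee_fin (le_trans _ (fM x)).
  by split => //; rewrite lee_fin.
rewrite integral_cst; last exact: measurable_cube.
by rewrite [X in _ * X]lebesgue_cube -EFinM ltry.
Qed.

Lemma osc_avg_fin i s Q : osc_avg (b i) (f s) Q \is a fin_num.
Proof.
have [_ [M fM] _] := bf s.
have M0 : (0 <= M)%R := le_trans (normr_ge0 _) (fM (0%R : 'rV[R]_n)).
rewrite /osc_avg avgE fin_numM// ge0_fin_numE; last by apply: integral_ge0 => x _; rewrite lee_fin.
apply: (@le_lt_trans _ _ (M%:E * (bmo_norm (b i) * mu (cube_set Q)))); last first.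
  have bfin : bmo_norm (b i) \is a fin_num.
    rewrite ge0_fin_numE ?(bb i).2//.
    apply: le_trans (ereal_sup_ubound _); last by exists Q.
    by apply: avg_ge0 => x; rewrite lee_fin.
  by rewrite -(fineK bfin) lebesgue_cube -!EFinM ltry.
apply: le_trans (lee_wpmul2l _ (osc_le_bmo (b i) Q)); last by rewrite lee_fin.
rewrite /osc -ge0_integralZl; last 4 first.
- exact: measurable_cube.
- apply/measurable_EFinP; apply: measurable_funTS.
  apply: (measurableT_comp (@normr_measurable R setT)).
  by apply: measurable_funB; [exact: mb|exact: measurable_cst].
- by move=> x _; rewrite lee_fin.
- by rewrite lee_fin.
apply: le_integral_ge0.
- by move=> x _; rewrite lee_fin.
- by move=> x _; rewrite mule_ge0 ?lee_fin.
- by move=> x Qx; split => //; rewrite lee_fin normrM mulrC ler_wpM2r.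
Qed.

(** Real-valued form of [U], as [hoelder_family] takes real functions; the averages are finite
    because [f s] is bounded and [b i] is in BMO. *)
Definition Ureal i s Q (gamma : bool) (x : Rn) : R :=
  if gamma then (`|b i x - ravg Q (b i)| * fine (avg Q (fun y => `|f s y|%:E)%E))%R
  else fine (osc_avg (b i) (f s) Q).

Lemma UrealE i s Q gamma x : U (b i) (f s) Q gamma x = (Ureal i s Q gamma x)%:E.
Proof.
rewrite /U /Ureal; case: gamma; first by rewrite EFinM fineK ?avg_fin.
by rewrite fineK ?osc_avg_fin.
Qed.

Definition factor (gamma : {ffun 'I_l -> bool}) (s : 'I_m) Q (x : Rn) : R :=
  if (insub (val s) : option 'I_l) is Some i then Ureal i s Q (gamma i) x
  else fine (avg Q (fun y => `|f s y|%:E)).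

Let Ureal_ge0 i s Q gamma x : (0 <= Ureal i s Q gamma x)%R.
Proof.
have a0 : (0 <= fine (avg Q (fun y => `|f s y|%:E)))%R.
  by rewrite fine_ge0// avg_ge0// => y; rewrite lee_fin.
rewrite /Ureal; case: gamma; first by rewrite mulr_ge0.
by rewrite fine_ge0// avg_ge0// => y; rewrite lee_fin.
Qed.

Let factor_ge0 gamma s Q x : (0 <= factor gamma s Q x)%R.
Proof.
rewrite /factor; case: insub => [i|]; first exact: Ureal_ge0.
by rewrite fine_ge0// avg_ge0// => y; rewrite lee_fin.
Qed.

Let measurable_factor gamma s Q : measurable_fun setT (factor gamma s Q).
Proof.
rewrite /factor; case: insub => [i|]; last exact: measurable_cst.
rewrite /Ureal; case: (gamma i); last exact: measurable_cst.
apply: measurable_funM; last exact: measurable_cst.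
apply: (measurableT_comp (@normr_measurable R setT)).
by apply: measurable_funB; [exact: mb|exact: measurable_cst].
Qed.

Lemma sparse_term_prod (gamma : {ffun 'I_l -> bool}) Q x :
  (\prod_(i < l) U (b i) (f (slot i)) Q (gamma i) x) *
  (\prod_(s < m | (l <= s)%N) avg Q (fun y => `|f s y|%:E)) =
  (\prod_(s < m) factor gamma s Q x)%:E.
Proof.
rewrite -prodEFin.
transitivity (\prod_(s < m) if (insub (val s) : option 'I_l) is Some i
   then U (b i) (f (slot i)) Q (gamma i) x else avg Q (fun y => `|f s y|%:E)).
  by rewrite (@prod_insub _ _ _ l m llem).
apply: eq_bigr => s _; rewrite /factor.
case: insubP => [i ls ei|_]; last by rewrite fineK ?avg_fin.
by have -> : s = slot i; [exact: val_inj|rewrite UrealE].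
Qed.

Let J s := \int[mu]_x ((`|f s x| `^ ps s)%:E * maximal (w s) x).

Let Aweak i := weak_A_infty_const (w (slot i)).

Let J_ge0 s : 0 <= J s.
Proof. by apply: integral_ge0 => x _; rewrite mule_ge0 ?maximal_ge0// lee_fin powR_ge0. Qed.

Let Aweak_ge0 i : 0 <= Aweak i. Proof. exact: weak_const_ge0. Qed.

Let bmo_ge0 i : 0 <= bmo_norm (b i). Proof. exact: bmo_norm_ge0. Qed.

Let coef gamma i := (if (gamma : {ffun 'I_l -> bool}) i then Aweak i else 1) * bmo_norm (b i).

Let coef_ge0 gamma i : 0 <= coef gamma i.
Proof. by rewrite /coef mule_ge0//; case: (gamma i). Qed.

Let bound gamma (s : 'I_m) :=
  (if (insub (val s) : option 'I_l) is Some i then coef gamma i else 1) *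
  weighted_norm (ps s) (maximal (w s)) (f s).

Let coef_insub_ge0 gamma (s : 'I_m) :
  0 <= (if (insub (val s) : option 'I_l) is Some i then coef gamma i else 1).
Proof. by case: insub. Qed.

Let bound_ge0 gamma s : 0 <= bound gamma s.
Proof. by rewrite /bound mule_ge0// /weighted_norm poweR_ge0. Qed.

Lemma boundE gamma (s : 'I_m) : bound gamma s `^ ps s =
  (if (insub (val s) : option 'I_l) is Some i then coef gamma i else 1) `^ ps s * J s.
Proof.
rewrite /bound poweRM ?poweR_ge0//; congr (_ * _).
rewrite /weighted_norm -poweRrM mulVf ?gt_eqF// poweRe1//; exact: J_ge0.
Qed.

Definition slotC s := slot_const n (ps s) eta.

Section one_family.
Variable F : seq (cube R n).
Hypothesis uF : uniq F.
Hypothesis lF : laminar F.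
Hypothesis sF : sparse_seq eta F.

Let wint gamma s := \sum_(Q <- F) \int[mu]_(x in cube_set Q) (factor gamma s Q x `^ ps s * w s x)%:E.

Let integralZ_weight (c : \bar R) Q (h : Rn -> R) : 0 <= c ->
  measurable_fun setT h -> (forall x, 0 <= h x)%R ->
  \int[mu]_(x in cube_set Q) (c * (h x)%:E) = c * \int[mu]_(x in cube_set Q) (h x)%:E.
Proof.
move=> c0 mh h0; apply: ge0_integralZl.
- exact: measurable_cube.
- by apply/measurable_EFinP; apply: measurable_funTS.
- by move=> x _; rewrite lee_fin.
- exact: c0.
Qed.

(** One estimate per kind of slot: no symbol, oscillation outside the average (the one that costs
    the weak constant), oscillation inside the average. *)
Lemma slot_bound gamma s : wint gamma s <= (slotC s)%:E * bound gamma s `^ ps s.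
Proof.
have [c1 c2 c3] := slot_constP n (ps s) eta.
rewrite boundE.
have mw := measurable_weight (ww s); have w0 := weight_ge0 (ww s).
have avgps Q : (fine (avg Q (fun y => `|f s y|%:E)) `^ ps s)%:E = avg Q (fun y => `|f s y|%:E) `^ ps s.
  by rewrite -poweR_EFin fineK ?avg_fin.
have Cle (c : R) x : (c <= slotC s)%R -> 0 <= x -> c%:E * x <= (slotC s)%:E * x.
  by move=> cC x0; apply: lee_wpmul2r; rewrite ?lee_fin.
rewrite /wint /factor; case: insubP => [i ls ei|_]; last first.
  rewrite poweR1r mul1e; apply: le_trans (Cle _ _ c1 (J_ge0 s)).
  apply: le_trans (sum_avg_le n_gt0 (ps_gt1 s) eta_gt0 uF lF sF (ww s) (mf s) 0).
  apply: lee_sum => Q _.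
  rewrite (eq_integral (fun x => avg Q (fun y => `|f s y|%:E) `^ ps s * (w s x)%:E)); last first.
    by move=> x _; rewrite EFinM avgps.
  rewrite integralZ_weight; [exact: lexx|exact: poweR_ge0|exact: mw|exact: w0].
have si : s = slot i by exact: val_inj.
have J0 := J_ge0 s.
rewrite /Ureal /coef; case: (gamma i).
  rewrite poweRM; [|exact: Aweak_ge0|exact: bmo_ge0].
  rewrite -muleA /Aweak -si.
  apply: le_trans (Cle _ _ c3 _); last by rewrite !mule_ge0 ?poweR_ge0.
  apply: le_trans (sum_avg_wosc_le n_gt0 (ps_gt1 s) eta_gt0 uF lF sF (ww s) (mf s) (bb i)).
  apply: lee_sum => Q _.
  rewrite (eq_integral (fun x => avg Q (fun y => `|f s y|%:E) `^ ps s *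
      (`|b i x - ravg Q (b i)| `^ ps s * w s x)%:E)); last first.
    move=> x _; rewrite powRM; [|exact: normr_ge0|]; last first.
      by rewrite fine_ge0// avg_ge0// => y; rewrite lee_fin.
    by rewrite -avgps -EFinM; congr EFin; rewrite mulrA; congr (_ * _)%R; exact: mulrC.
  rewrite integralZ_weight; first exact: lexx.
  - exact: poweR_ge0.
  - apply: (measurable_funM _ mw); apply: (measurableT_comp (measurable_powR _)).
    apply: (measurableT_comp (@normr_measurable R setT)).
    by apply: measurable_funB; [exact: mb|exact: measurable_cst].
  - by move=> x; rewrite mulr_ge0// powR_ge0.
rewrite mul1e; apply: le_trans (Cle _ _ c2 _); last by rewrite !mule_ge0 ?poweR_ge0.
apply: le_trans (sum_osc_avg_le n_gt0 (ps_gt1 s) eta_gt0 uF lF sF (ww s) (mf s) (bb i)).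
apply: lee_sum => Q _.
rewrite (eq_integral (fun x => osc_avg (b i) (f s) Q `^ ps s * (w s x)%:E)); last first.
  by move=> x _; rewrite EFinM -poweR_EFin fineK ?osc_avg_fin.
rewrite integralZ_weight; [exact: lexx|exact: poweR_ge0|exact: mw|exact: w0].
Qed.

Let th s := (p / ps s)%R.

Let th_gt0 s : (0 < th s)%R. Proof. by rewrite divr_gt0. Qed.

Let th1 : (\sum_s th s = 1)%R.
Proof. by rewrite /th -mulr_sumr -pE divff// gt_eqF. Qed.

(** The exponents [p / ps s] add up to 1, and [(bound ^ ps s) ^ (p / ps s) = bound ^ p] in every
    slot. *)
Lemma family_bound gamma :
  \sum_(Q <- F) \int[mu]_(x in cube_set Q)
     (\prod_s (factor gamma s Q x `^ ps s * w s x) `^ (p / ps s))%:E <=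
  (\prod_s slotC s `^ (p / ps s))%:E * (\prod_s bound gamma s) `^ p.
Proof.
have G0 s Q x : (0 <= factor gamma s Q x `^ ps s * w s x)%R.
  by rewrite mulr_ge0 ?powR_ge0// weight_ge0.
have mG s Q : measurable_fun (cube_set Q) (fun x => factor gamma s Q x `^ ps s * w s x)%R.
  apply: measurable_funTS; apply: measurable_funM; last exact: measurable_weight.
  exact: (measurableT_comp (measurable_powR (ps s)) (measurable_factor gamma s Q)).
apply: le_trans (@hoelder_family _ _ _ mu 'I_m _ F (fun Q => cube_set Q) th
  (fun Q => measurable_cube Q) th_gt0 th1 (fun s Q x => factor gamma s Q x `^ ps s * w s x)%R G0 mG) _.
rewrite poweR_prod//  -prodEFin -big_split/=.
apply: lee_prod => [s|s]; first exact: poweR_ge0.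
have slotC0 : (0 <= slotC s)%R by rewrite ltW// slot_const_gt0.
apply: le_trans (le_poweR (ltW (th_gt0 s)) _ (slot_bound gamma s)) _.
  by apply: sume_ge0 => Q _; apply: integral_ge0 => x _; rewrite lee_fin.
rewrite poweRM ?lee_fin ?poweR_ge0// poweR_EFin -poweRrM.
by rewrite /th mulrCA divff ?mulr1// gt_eqF.
Qed.

End one_family.

Definition total_const : R := \sum_(tau : 'I_(3 ^ n) * {ffun 'I_l -> bool})
  (C0 `^ p * \prod_s slotC s `^ (p / ps s)).

Variable S : 'I_(3 ^ n) -> set (cube R n).
Hypothesis latS : forall j, exists2 D, dyadic_lattice D & S j `<=` D.
Hypothesis spS : forall j, sparse eta (S j).

Let wprod x : R := \prod_s w s x `^ (p / ps s).

Let wprod_ge0 x : (0 <= wprod x)%R.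
Proof. by rewrite prodr_ge0// => s _; exact: powR_ge0. Qed.

Let u (gamma : {ffun 'I_l -> bool}) Q x : \bar R :=
  (\prod_s factor gamma s Q x)%:E * (\1_(cube_set Q) x)%:E.

(** By [tE] this is [C0 ^ p] times the product weight times [u ^ p], with the weights distributed
    over the slots as Hoelder's inequality requires. *)
Let t (gamma : {ffun 'I_l -> bool}) Q (x : Rn) : \bar R := (C0 `^ p)%:E * ((\1_(cube_set Q) x)%:E *
  (\prod_s (factor gamma s Q x `^ ps s * w s x) `^ (p / ps s))%:E).

Let fprod_ge0 gamma Q x : (0 <= \prod_s factor gamma s Q x)%R.
Proof. by apply: prodr_ge0 => s _. Qed.

Let u_ge0 gamma Q x : 0 <= u gamma Q x.
Proof. by rewrite /u mule_ge0 ?lee_fin. Qed.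

Let tE gamma Q x : t gamma Q x = (C0 `^ p * wprod x)%:E * u gamma Q x `^ p.
Proof.
rewrite /t /u indicE; case: (boolP (x \in cube_set Q)) => xQ; last first.
  by rewrite mul0e !mule0 poweR0r ?mule0// gt_eqF.
rewrite mul1e mule1.
have -> : (\prod_s factor gamma s Q x)%:E `^ p = \prod_s ((factor gamma s Q x)%:E `^ p).
  by rewrite -prodEFin poweR_prod// => s; rewrite lee_fin; exact: factor_ge0.
rewrite [in RHS]EFinM -muleA; congr (_ * _).
rewrite /wprod -!prodEFin -big_split/=; apply: eq_bigr => s _.
rewrite -EFinM; congr EFin.
rewrite powRM ?powR_ge0 ?weight_ge0// -powRrM mulrCA divff ?mulr1; last by rewrite gt_eqF.
exact: mulrC.
Qed.

Let t_ge0 gamma Q x : 0 <= t gamma Q x.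
Proof. by rewrite tE mule_ge0 ?poweR_ge0// lee_fin mulr_ge0// powR_ge0. Qed.

Let measurable_hoelder_product gamma Q : measurable_fun setT
  (fun x => \prod_s (factor gamma s Q x `^ ps s * w s x) `^ (p / ps s) : R)%R.
Proof.
apply: measurable_prod => s _ /=; apply: (measurableT_comp (measurable_powR _)).
apply: measurable_funM; last exact: measurable_weight.
exact: (measurableT_comp (measurable_powR (ps s)) (measurable_factor gamma s Q)).
Qed.

Let measurable_t gamma Q : measurable_fun setT (t gamma Q).
Proof.
apply: emeasurable_funM; first exact: measurable_cst.
apply: emeasurable_funM; apply/measurable_EFinP.
  exact: measurable_indic (measurable_cube Q).
exact: measurable_hoelder_product.
Qed.

Let integral_t gamma Q : \int[mu]_x t gamma Q x = (C0 `^ p)%:E * \int[mu]_(x in cube_set Q)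
  (\prod_s (factor gamma s Q x `^ ps s * w s x) `^ (p / ps s))%:E.
Proof.
have h0 x : (0 <= \prod_s (factor gamma s Q x `^ ps s * w s x) `^ (p / ps s))%R.
  by apply: prodr_ge0 => s _; exact: powR_ge0.
rewrite /t ge0_integralZl; last 4 first.
- exact: measurableT.
- apply: emeasurable_funM; apply/measurable_EFinP.
    exact: measurable_indic (measurable_cube Q).
  exact: measurable_hoelder_product.
- by move=> x _; rewrite mule_ge0 ?lee_fin.
- by rewrite lee_fin powR_ge0.
by rewrite integral_indicM.
Qed.

Lemma sparse_form_pair x : sparse_form llem b f S x =
  \sum_(tau : 'I_(3 ^ n) * {ffun 'I_l -> bool}) esum (S tau.1) (fun Q => u tau.2 Q x).
Proof.
rewrite /sparse_form pair_big/=; apply: eq_bigr => -[j gamma] _ /=.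
by apply: eq_esum => Q _; rewrite sparse_term_prod.
Qed.

Let total_bound := \sum_(gamma : {ffun 'I_l -> bool}) \prod_s bound gamma s.

(** The families are exhausted by finite segments, for which [family_bound] is uniform in [k]; the
    sparse form is compared with the limit pointwise off the null set. *)
Lemma sparse_form_integral (F : Rn -> R) :
  {ae mu, forall x, `|F x|%:E <= C0%:E * sparse_form llem b f S x} ->
  \int[mu]_x ((`|F x| `^ p)%:E * (wprod x)%:E) <= total_const%:E * total_bound `^ p.
Proof.
move=> [N [mN N0 FN]].
have /choice[eg egP] : forall j, exists eg : (nat -> cube R n) * (cube R n -> nat),
    forall Q, S j Q -> eg.1 (eg.2 Q) = Q.
  move=> j.
  have [D latD SD] := latS j; have [e [g egD]] := lattice_enum latD.
  by exists (e, g) => Q /SD; exact: egD.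
pose seg j k := segment (S j) (eg j).1 (eg j).2 k.
pose G k x := \sum_(tau : 'I_(3 ^ n) * {ffun 'I_l -> bool}) \sum_(Q <- seg tau.1 k) t tau.2 Q x.
have G0 k x : 0 <= G k x by apply: sume_ge0 => tau _; apply: sume_ge0.
have Gnd x : nondecreasing_seq (G ^~ x).
  by move=> i j ij; apply: lee_sum => tau _; exact: nondecreasing_segment.
apply: (@integral_le_of_limn _ _ _ mu setT N _ G).
- exact: measurableT.
- exact: mN.
- exact: N0.
- by move=> x _; rewrite mule_ge0 ?lee_fin// powR_ge0.
- move=> k; apply: emeasurable_sum => tau; apply: emeasurable_sum => Q; exact: measurable_t.
- by move=> k x _; exact: G0.
- by move=> x _; exact: Gnd.
- move=> x _ nNx.
  have Fx : `|F x|%:E <= C0%:E * sparse_form llem b f S x.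
    by apply: contrapT => h; apply: nNx; exact: FN.
  pose c := (C0 `^ p * wprod x)%R.
  (* [H k] are partial sums of the sparse form, [K k] those of the [p]-th powers of its terms. *)
  pose H k := \sum_(tau : 'I_(3 ^ n) * {ffun 'I_l -> bool}) \sum_(Q <- seg tau.1 k) u tau.2 Q x.
  pose K k := \sum_(tau : 'I_(3 ^ n) * {ffun 'I_l -> bool}) \sum_(Q <- seg tau.1 k) u tau.2 Q x `^ p.
  have Knd : nondecreasing_seq K.
    by move=> i j ij; apply: lee_sum => tau _; apply: nondecreasing_segment => // Q; exact: poweR_ge0.
  have GK : G ^~ x = (fun k => c%:E * K k).
    apply/funext => k; rewrite /G /K ge0_sume_distrr; last first.
      by move=> tau _; apply: sume_ge0 => Q _; exact: poweR_ge0.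
    apply: eq_bigr => tau _; rewrite ge0_sume_distrr; last by move=> Q _; exact: poweR_ge0.
    by apply: eq_bigr => Q _; rewrite tE.
  have Kcv : cvg (K @ \oo) by exact: ereal_nondecreasing_is_cvgn.
  have -> : limn (G ^~ x) = c%:E * limn K.
    by rewrite GK limeMl.
  have KL k : K k <= limn K.
    by rewrite (cvg_lim _ (ereal_nondecreasing_cvgn Knd))//; apply: ereal_sup_ubound; exists k.
  have H0 k : 0 <= H k by apply: sume_ge0 => tau _; apply: sume_ge0.
  (* The bound [H k ^ p <= K k], which uses [p <= 1], is put in this form so that the limit on the
     left is taken without passing through a power. *)
  have HK k : H k <= limn K `^ p^-1.
    have -> : H k = (H k `^ p) `^ p^-1 by rewrite -poweRrM mulfV ?poweRe1// gt_eqF.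
    apply: le_poweR; [by rewrite invr_ge0 ltW|exact: poweR_ge0|].
    apply: le_trans (KL k); apply: le_trans (poweR_sum_le _ _ _ p_gt0 p_le1) _.
      by move=> tau; exact: sume_ge0.
    by apply: lee_sum => tau _; apply: poweR_sum_le.
  have Hnd (tau : 'I_(3 ^ n) * {ffun 'I_l -> bool}) :
      cvg ((fun k => \sum_(Q <- seg tau.1 k) u tau.2 Q x) @ \oo).
    by apply: ereal_nondecreasing_is_cvgn; exact: nondecreasing_segment.
  have sfK : sparse_form llem b f S x <= limn K `^ p^-1.
    rewrite sparse_form_pair.
    apply: (@le_trans _ _ (\sum_(tau : 'I_(3 ^ n) * {ffun 'I_l -> bool})
        limn (fun k => \sum_(Q <- seg tau.1 k) u tau.2 Q x))).
      by apply: lee_sum => tau _; apply: esum_le_limn => // Q; exact: egP.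
    rewrite -(lim_nnesum _ (fun=> 0)); last 2 first.
    - by move=> tau _; apply: nearW => k; exact: sume_ge0.
    - by move=> tau _; exact: Hnd.
    apply: lime_le; last by apply: nearW => k; exact: HK.
    apply: ereal_nondecreasing_is_cvgn => i j ij.
    by apply: lee_sum => tau _; exact: nondecreasing_segment.
  have L0 : 0 <= limn K.
    by apply: le_trans (KL 0%N); apply: sume_ge0 => tau _; apply: sume_ge0 => Q _; exact: poweR_ge0.
  rewrite -poweR_EFin.
  have FL : `|F x|%:E <= C0%:E * limn K `^ p^-1.
    apply: le_trans Fx _; apply: lee_wpmul2l; last exact: sfK.
    by rewrite lee_fin (ltW C0_gt0).
  apply: (@le_trans _ _ ((C0%:E * limn K `^ p^-1) `^ p * (wprod x)%:E)).
    apply: lee_wpmul2r; first by rewrite lee_fin.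
    apply: le_poweR; [exact: ltW p_gt0|by rewrite lee_fin|].
    exact: FL.
  rewrite poweRM ?lee_fin ?(ltW C0_gt0) ?poweR_ge0// -poweRrM mulVf ?gt_eqF// poweRe1//.
  by rewrite poweR_EFin muleAC -EFinM.
move=> k.
have step : \int[mu]_x G k x = \sum_(tau : 'I_(3 ^ n) * {ffun 'I_l -> bool})
    (C0 `^ p)%:E * \sum_(Q <- seg tau.1 k) \int[mu]_(x in cube_set Q)
      (\prod_s (factor tau.2 s Q x `^ ps s * w s x) `^ (p / ps s))%:E.
  rewrite /G ge0_integral_sum; last 3 first.
  - exact: measurableT.
  - by move=> tau; apply: emeasurable_sum => Q; exact: measurable_t.
  - by move=> tau x _; exact: sume_ge0.
  apply: eq_bigr => tau _; rewrite ge0_integral_sum; last 3 first.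
  - exact: measurableT.
  - by move=> Q; exact: measurable_t.
  - by move=> Q x _; exact: t_ge0.
  rewrite ge0_sume_distrr; last first.
    move=> Q _; apply: integral_ge0 => x _; rewrite lee_fin prodr_ge0// => s _; exact: powR_ge0.
  by apply: eq_bigr => Q _; exact: integral_t.
rewrite step /total_const -sumEFin ge0_sume_distrl; last first.
  move=> tau _; rewrite lee_fin mulr_ge0 ?powR_ge0// prodr_ge0// => s _; exact: powR_ge0.
apply: lee_sum => tau _; rewrite [in leRHS]EFinM -muleA.
apply: lee_wpmul2l; first by rewrite lee_fin powR_ge0.
have [D latD SD] := latS tau.1.
have uF : uniq (seg tau.1 k) by exact: segment_uniq.
have subS P : P \in seg tau.1 k -> S tau.1 P by exact: segment_sub.
have lF : laminar (seg tau.1 k) by apply: (sub_laminar latD) => P /subS /SD.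
have sF : sparse_seq eta (seg tau.1 k) by exact (@sub_sparse _ _ _ _ _ (@spS tau.1) subS).
apply: le_trans (family_bound uF lF sF tau.2) _.
apply: lee_wpmul2l; first by rewrite lee_fin prodr_ge0// => s _; exact: powR_ge0.
apply: le_poweR; [exact: ltW|by apply: prode_ge0 => s _; exact: bound_ge0|].
rewrite /total_bound (bigD1 tau.2)//= leeDl//; apply: sume_ge0 => gamma _.
by apply: prode_ge0 => s _; exact: bound_ge0.
Qed.

Let weak_sum := \sum_(gamma : {ffun 'I_l -> bool}) \prod_(i < l | gamma i) Aweak i.
Let oscillations := \prod_(i < l) bmo_norm (b i).
Let norms := \prod_(s < m) weighted_norm (ps s) (maximal (w s)) (f s).

Let weak_sum_ge0 : 0 <= weak_sum.
Proof. by apply: sume_ge0 => gamma _; apply: prode_ge0. Qed.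

Let oscillations_ge0 : 0 <= oscillations.
Proof. exact: prode_ge0. Qed.

Let norms_ge0 : 0 <= norms.
Proof. by apply: prode_ge0 => s _; rewrite /weighted_norm poweR_ge0. Qed.

Let total_boundE : total_bound = weak_sum * oscillations * norms.
Proof.
have A0 (gamma : {ffun 'I_l -> bool}) : 0 <= \prod_(i < l | gamma i) weak_A_infty_const (w (slot i)).
  by apply: prode_ge0 => i _; exact: Aweak_ge0.
rewrite /weak_sum /oscillations /norms -muleA ge0_sume_distrl//; apply: eq_bigr => gamma _.
rewrite /bound big_split/= muleA; congr (_ * _).
rewrite (@prod_insub _ _ _ l m llem (coef gamma) (fun=> 1))/= [X in _ * X]big1// mule1.
rewrite [X in X * _]big_mkcond -big_split.
by apply: eq_bigr => i _.
Qed.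

Lemma weighted_norm_le (F : Rn -> R) :
  {ae mu, forall x, `|F x|%:E <= C0%:E * sparse_form llem b f S x} ->
  weighted_norm p (fun x => (\prod_(s < m) w s x `^ (p / ps s))%:E) F <=
    (total_const `^ p^-1)%:E * (weak_sum * oscillations * norms).
Proof.
move=> FS; have := sparse_form_integral FS.
rewrite total_boundE => H.
have I0 : 0 <= \int[mu]_x ((`|F x| `^ p)%:E * (\prod_(s < m) w s x `^ (p / ps s))%:E).
  apply: integral_ge0 => x _; rewrite mule_ge0 ?lee_fin ?powR_ge0//.
  by apply: prodr_ge0 => s _; exact: powR_ge0.
have pi0 : (0 <= p^-1)%R by rewrite invr_ge0 ltW.
apply: le_trans (le_poweR pi0 I0 H) _.
have t0 : (0 <= total_const)%R.
  apply: sumr_ge0 => tau _; rewrite mulr_ge0 ?powR_ge0//.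
  by apply: prodr_ge0 => s _; exact: powR_ge0.
rewrite poweRM ?lee_fin ?poweR_ge0// -poweRrM mulfV ?gt_eqF// poweRe1//.
by rewrite !mule_ge0.
Qed.

(** If some strong constant is below 1, its maximal function vanishes and so does the product of
    norms. Otherwise all of them are at least 1, so the factors missing for a given [gamma] may be
    inserted, and the sum over [gamma] costs the number of its terms. *)
Lemma weak_sum_le : weak_sum * oscillations * norms <=
  (#|{: {ffun 'I_l -> bool}}|%:R)%:E * (\prod_(i < l) A_infty_const (w (slot i))) * oscillations * norms.
Proof.
have [[i Ai]|A1] := pselect (exists i, A_infty_const (w (slot i)) < 1).
  have M0 := maximal_eq0 (ww (slot i)) Ai.
  suff -> : norms = 0 by rewrite !mule0.
  rewrite /norms (bigD1 (slot i))//= /weighted_norm integral0_eq; last first.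
    by move=> x _; rewrite M0 mule0.
  rewrite poweR0r ?mul0e// invr_neq0// gt_eqF//.
have s1 i : 1 <= A_infty_const (w (slot i)).
  by rewrite leNgt; apply/negP => h; apply: A1; exists i.
apply: lee_wpmul2r => //; apply: lee_wpmul2r => //.
rewrite /weak_sum cardE -sum1_size natr_sum -sumEFin big_enum/= ge0_sume_distrl//.
apply: lee_sum => gamma _; rewrite mul1e big_mkcond.
apply: lee_prod => i; first by case: (gamma i).
by case: (gamma i) => //; exact: weak_const_le (ww _).
Qed.

End sparse_form_bound.

Theorem corollary1p16 (R : realType) (n m l : nat) (p : R) (ps : 'I_m -> R)
    (C0 eta : R)
    (n_gt0 : (0 < n)%N) (m_ge2 : (2 <= m)%N)
    (l_gt0 : (0 < l)%N) (llem : (l <= m)%N)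
    (ps_gt1 : forall s, 1 < ps s) (pE : p^-1 = \sum_(s < m) (ps s)^-1)
    (p_gt0 : 0 < p) (p_le1 : p <= 1)
    (C0_gt0 : 0 < C0) (eta_gt0 : 0 < eta) (eta_lt1 : eta < 1) :
  exists2 C : R, 0 < C &
  forall (w : 'I_m -> euclid R n -> R) (b : 'I_l -> euclid R n -> R)
         (V : 'I_m -> set (euclid R n -> R))
         (T : ('I_m -> euclid R n -> R) -> euclid R n -> R),
    (forall s, weight (w s)) ->
    (forall s, BMO (b s)) ->
    multilinear_operator V T ->
    suitable_domain llem V b ->
    sparse_domination llem C0 eta T b ->
    let nu := fun x => (\prod_(s < m) w s x `^ (p / ps s))%:E in
    forall f : 'I_m -> euclid R n -> R,
      (forall s, bounded_compactly_supported (f s)) ->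
      ((forall s, A_infty (w s)) ->
       (weighted_norm p nu (iterated_commutator llem T b f) <=
        C%:E * (\prod_(s < l) A_infty_const (w (slot llem s)))
             * (\prod_(s < l) bmo_norm (b s))
             * \prod_(s < m) weighted_norm (ps s) (maximal (w s)) (f s))%E)
      /\
      ((forall s, weak_A_infty (w s)) ->
       (weighted_norm p nu (iterated_commutator llem T b f) <=
        C%:E * (\sum_(gamma : {ffun 'I_l -> bool})
                  \prod_(s < l | gamma s)
                     weak_A_infty_const (w (slot llem s)))
             * (\prod_(s < l) bmo_norm (b s))
             * \prod_(s < m) weighted_norm (ps s) (maximal (w s)) (f s))%E).
Proof.
pose N : R := #|{: {ffun 'I_l -> bool}}|%:R.
have N1 : 1 <= N by rewrite ler1n; apply/card_gt0P; exists [ffun=> true].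
pose kap : R := total_const n l p ps C0 eta `^ p^-1.
have kap0 : 0 <= kap by exact: powR_ge0.
(* [N], the number of choices of [gamma], is needed for the strong constants; [1 + kap] makes
   positivity immediate. *)
exists ((1 + kap) * N); first by rewrite mulr_gt0 ?(lt_le_trans ltr01)// lerDl.
move=> w b V T ww bb _ _ sd nu f bf.
have [S [HS FS]] := sd f bf.
have H := weighted_norm_le n_gt0 ps_gt1 pE p_gt0 p_le1 C0_gt0 eta_gt0 ww bb bf
  (fun j => (HS j).1) (fun j => (HS j).2) FS.
have osc0 : (0 <= \prod_(s < l) bmo_norm (b s))%E.
  by apply: prode_ge0 => s _; exact: bmo_norm_ge0.
have nor0 : (0 <= \prod_(s < m) weighted_norm (ps s) (maximal (w s)) (f s))%E.
  by apply: prode_ge0 => s _; rewrite /weighted_norm poweR_ge0.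
have wk0 : (0 <= \sum_(gamma : {ffun 'I_l -> bool})
    \prod_(s < l | gamma s) weak_A_infty_const (w (slot llem s)))%E.
  by apply: sume_ge0 => g _; apply: prode_ge0 => s _; exact: weak_const_ge0.
split=> _; apply: (le_trans H); rewrite -/kap.
  apply: (@le_trans _ _ ((1 + kap)%:E * (N%:E * (\prod_(s < l) A_infty_const (w (slot llem s)))
      * (\prod_(s < l) bmo_norm (b s))
      * \prod_(s < m) weighted_norm (ps s) (maximal (w s)) (f s)))%E).
    apply: lee_pmul.
    - by rewrite lee_fin.
    - by rewrite !mule_ge0.
    - by rewrite lee_fin lerDr.
    - exact: (weak_sum_le llem ps_gt1 b f ww).
  by rewrite EFinM !muleA.
rewrite -!muleA; apply: lee_wpmul2r; first by rewrite !mule_ge0.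
rewrite lee_fin (@le_trans _ _ (1 + kap)) ?lerDr// ler_peMr// addr_ge0//.
Qed.
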